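(* Let $p$ be a prime, let $S$ be a finite $p$-group, and let $(R,R')$ be a $\kappa$-preserving submodule of $A(S,S)_{(p)}$. There exists a saturated fusion system $\mathcal{F}$ on $S$ such that $R$ is the module of right $\mathcal{F}$-stable elements in $A(S,S)_{(p)}$ and $R'$ is the module of right $\mathcal{F}$-stable elements in $A(S,S\times S)_{(p)}$ if and only if $R$ is not contained in the Nishida ideal $J(S)_{(p)}$ of $A(S,S)_{(p)}$ and $(R,R')$ has a retractive transfer.
   Context: **Fusion systems.** Write $c_g(x)=gxg^{-1}$. A fusion system $\mathcal{F}$ on a finite $p$-group $S$ is a category whose objects are the subgroups of $S$ and whose morphism sets $\mathrm{Hom}_{\mathcal{F}}(P,Q)$ are sets of injective group homomorphisms $P\to Q$, with the usual composition, such that (1) every $c_x|_P:P\to Q$ with $x\in S$, $xPx^{-1}\le Q$, is in $\mathrm{Hom}_{\mathcal{F}}(P,Q)$; (2) for $\varphi\in\mathrm{Hom}_{\mathcal{F}}(P,Q)$ the induced isomorphism $P\to\varphi(P)$ and its inverse are morphisms in $\mathcal{F}$. Subgroups $P,Q$ are $\mathcal{F}$-conjugate if there is an isomorphism $P\to Q$ in $\mathcal{F}$. $P$ is fully $\mathcal{F}$-centralized (resp. fully $\mathcal{F}$-normalized) if $|C_S(P)|\ge|C_S(Q)|$ (resp. $|N_S(P)|\ge|N_S(Q)|$) for all $Q$ that are $\mathcal{F}$-conjugate to $P$. $\mathrm{Aut}_S(P)$ is the group of automorphisms of $P$ induced by conjugation by elements of $N_S(P)$. $\mathcal{F}$ is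 saturated if: (I) if $P\le S$ is fully $\mathcal{F}$-normalized, then $P$ is fully $\mathcal{F}$-centralized and $\mathrm{Aut}_S(P)$ is a Sylow $p$-subgroup of $\mathrm{Aut}_{\mathcal{F}}(P)$; (II) if $\varphi\in\mathrm{Hom}_{\mathcal{F}}(P,S)$ and $\varphi(P)$ is fully $\mathcal{F}$-centralized, then $\varphi$ extends to some $\overline\varphi\in\mathrm{Hom}_{\mathcal{F}}(N_\varphi,S)$, where $N_\varphi=\{x\in N_S(P)\mid \exists y\in N_S(\varphi(P)):\ \varphi(xux^{-1})=y\varphi(u)y^{-1}\ \forall u\in P\}$. **Burnside modules.** For finite groups $G,H$, a $(G,H)$-biset is a finite set with commuting right $G$-action and left $H$-action; it is left-free if $H$ acts freely. $A(G,H)$ is the Grothendieck group (under disjoint union) of isomorphism classes of finite left-free $(G,H)$-bisets. For $K\le G$ and a homomorphism $\varphi:K\to H$, $[K,\varphi]=[K,\varphi]_G^H\in A(G,H)$ is the class of $(H\times G)/\sim$ where $(x\varphi(k),y)\sim(x,ky)$ for $k\in K$. These classes form a $\mathbb{Z}$-basis, one for each $H\times G$-conjugacy class of graphs $\Delta(K,\varphi)=\{(\varphi(k),k)\mid k\in K\}$. Composition $A(H,L)\times A(G,H)\to A(G,L)$ is the bilinear map with $[X]\circ[Y]=[X\times_H Y]$. $A(G,H)_{(p)}=A(G,H)\otimes\mathbb{Z}_{(p)}$. Cartesian product of bisets induces bilinear pairings $A(G_1,H_1)\times A(G_2,H_2)\to A(G_1\times G_2,H_1\times H_2)$, $(X,Y)\mapsto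 X\times Y$. $\Delta:S\to S\times S$ is the diagonal. The Nishida ideal $J(S)\subset A(S,S)$ is the $\mathbb{Z}$-span of the $[P,\psi]$ with $\psi(P)\ne S$, and $J(S)_{(p)}=J(S)\otimes\mathbb{Z}_{(p)}$. For a finite group $H$, $X\in A(S,H)_{(p)}$ is right $\mathcal{F}$-stable if $X\circ[P,\varphi]_P^S=X\circ[P,\mathrm{incl}]_P^S$ in $A(P,H)_{(p)}$ for all $P\le S$, $\varphi\in\mathrm{Hom}_{\mathcal{F}}(P,S)$ (incl the inclusion $P\to S$). **Notation.** Put $M=A(S,S)_{(p)}$, $M'=A(S,S\times S)_{(p)}$ (viewed as modules), $\Lambda=A(S,S)_{(p)}$ (viewed as a ring acting on $M$ on the left by composition), $\Lambda'=A(S\times S,S\times S)_{(p)}$ (acting on $M'$ on the left by composition), and $\mathcal{H}=A(S,S\times S)_{(p)}$ (each $h\in\mathcal{H}$ inducing $h_*:M\to M'$, $x\mapsto h\circ x$). For $a,b\in\Lambda$, $a\times b\in\Lambda'$ acts on $M'$. Let $\kappa_A:M\times M\to M'$ be the bilinear map $\kappa_A(x,y)=(x\times y)\circ[S,\Delta]$; it satisfies $\kappa_A(a\circ x,b\circ y)=(a\times b)\circ\kappa_A(x,y)$ for $a,b\in\Lambda$. **$\kappa$-preserving submodule.** This is a pair $(R,R')$ consisting of a left $\Lambda$-submodule $R\subseteq M$ with inclusion $f:R\to M$ and a left $\Lambda'$-submodule $R'\subseteq M'$ with inclusion $f':R'\to M'$, equipped with a bilinear map $\kappa_R:R\times R\to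 R'$ compatible with the $\Lambda\times\Lambda$-actions (i.e. $\kappa_R(a\circ x,b\circ y)=(a\times b)\circ\kappa_R(x,y)$), such that ($\kappa$1) for every $h\in\mathcal{H}$, $h_*$ maps $R$ into $R'$; ($\kappa$2) $f'\circ\kappa_R=\kappa_A\circ(f\times f)$. **Retractive transfer for $(R,R')$.** This consists of a morphism of left $\Lambda$-modules $t:M\to R$ with $t\circ f=\mathrm{id}_R$ and a morphism of left $\Lambda'$-modules $t':M'\to R'$ with $t'\circ f'=\mathrm{id}_{R'}$, such that ($\kappa$3) $t'(h\circ x)=h\circ t(x)$ for all $h\in\mathcal{H}$, $x\in M$; ($\kappa$4) $t'(\kappa_A(f(r),x))=\kappa_R(r,t(x))$ for all $r\in R$, $x\in M$. *)

(* Defs.v *)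
From HB Require Import structures.
From mathcomp Require Import all_boot all_order all_algebra all_fingroup all_solvable.
From mathcomp Require Import boolp.
From mathcomp Require Import freeg ring.

Set Implicit Arguments.
Unset Strict Implicit.
Unset Printing Implicit Defensive.

Import GRing.Theory.
Local Open Scope ring_scope.

Section AddSpan.
Variables (V : zmodType) (B : V -> Prop).

Inductive addspan : V -> Prop :=
| addspan0 : addspan 0
| addspanB x y : addspan x -> addspan y -> addspan (x - y)
| addspan_gen x : B x -> addspan x.

Definition addspanb : {pred V} := fun x => `[< addspan x >].

Lemma addspan_zmod_closed : zmod_closed addspanb.
Proof.
split=> [|x y /asboolP Hx /asboolP Hy]; apply/asboolP; first exact: addspan0.
exact: addspanB.
Qed.

HB.instance Definition _ :=
  GRing.isZmodClosed.Build V addspanb addspan_zmod_closed.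

End AddSpan.

Definition fgen (K : choiceType) (k : K) : {freeg K} := << k >>.

Section FreeLift.
Variables (K : choiceType) (M : zmodType).
Implicit Types (f g : K -> M) (a b : {freeg K}).

(* [zmodule M] is [M] with its canonical structure of int-module.              *)
Definition flift f a : M := fglift (f : K -> zmodule M) a.

Lemma fliftB f : {morph flift f : a b / a - b}.
Proof. by move=> a b; exact: (@lift_is_additive int K (zmodule M) f a b). Qed.

Lemma flift0 f : flift f 0 = 0.
Proof. by have := fliftB f 0 0; rewrite subr0 subrr. Qed.

Lemma fliftU f k : flift f (fgen k) = f k.
Proof. by rewrite /flift /fgen liftU scale1r. Qed.

Lemma free_ind (P : {freeg K} -> Prop) :
  P 0 -> (forall a b, P a -> P b -> P (a - b)) -> (forall k, P (fgen k)) ->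
  forall a, P a.
Proof.
move=> P0 PB PU a; rewrite -[a]freeg_sumE.
have PN b : P b -> P (- b) by move=> Pb; rewrite -[- b]add0r; apply: PB.
have PD b c : P b -> P c -> P (b + c).
  by move=> Pb Pc; rewrite -[c]opprK; apply/PB/PN.
elim/big_ind: _ => // k _; have -> : << coeff k a *g k >> = fgen k *~ coeff k a.
  by rewrite /fgen freeg_mulz -[in RHS]mulrzr mul1r; congr (<< _ *g k >>); rewrite intz.
have PMn n : P (fgen k *+ n).
  by elim: n => [|n IHn]; rewrite ?mulr0n ?mulrS //; apply: PD.
by case: (coeff k a) => n; rewrite ?NegzE ?mulrNz -pmulrn; [|apply: PN].
Qed.

Lemma flift_funB f g a : flift (fun k => f k - g k) a = flift f a - flift g a.
Proof.
elim/free_ind: a => [|a b IHa IHb|k]; rewrite ?flift0 ?subr0 ?fliftU //.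
by rewrite !fliftB IHa IHb !opprD !opprK addrACA.
Qed.

End FreeLift.

Section Presented.
Variables (K : choiceType) (rel : {freeg K} -> Prop).

(* The abelian group presented by generators [K] and relators [rel].           *)
Definition pres : Type := Quotient.quot (addspanb rel).
HB.instance Definition _ := GRing.Zmodule.on pres.

Definition ppi : {freeg K} -> pres := \pi_(Quotient.quot (addspanb rel))%qT.

Definition pgen (k : K) : pres := ppi (fgen k).

(* [plift f] is computed on a representative; it is the homomorphism extending *)
(* [f] as soon as [kills f] holds (lemmas [plift_gen] and [pliftB] below).     *)
Definition plift (M : zmodType) (f : K -> M) (x : pres) : M :=
  flift f (generic_quotient.repr (x : Quotient.quot (addspanb rel))).

Lemma ppiB : {morph ppi : a b / a - b}.
Proof. exact: raddfB. Qed.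

Lemma ppi0 : ppi 0 = 0.
Proof. by have := ppiB 0 0; rewrite subr0 subrr. Qed.

Lemma ppi_rel a : rel a -> ppi a = 0.
Proof.
move=> ra; rewrite -ppi0; apply/eqP; rewrite eqmodE /= /Quotient.equiv subr0.
exact/asboolP/addspan_gen.
Qed.

Lemma pres_ind (P : pres -> Prop) :
  P 0 -> (forall x y, P x -> P y -> P (x - y)) -> (forall k, P (pgen k)) ->
  forall x, P x.
Proof.
move=> P0 PB PU; elim/quotW; apply: free_ind => [|a b Pa Pb|k].
- by rewrite -/ppi ppi0.
- by rewrite -/ppi ppiB; apply: PB.
- exact: PU.
Qed.

Definition kills (M : zmodType) (f : K -> M) := forall a, rel a -> flift f a = 0.

Section Lift.
Variables (M : zmodType) (f : K -> M).
Hypothesis killf : kills f.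

Lemma plift_pi a : plift f (ppi a) = flift f a.
Proof.
have key b : addspan rel b -> flift f b = 0.
  elim=> [|x y _ fx _ fy|x /killf//]; last by rewrite fliftB fx fy subr0.
  exact: flift0.
rewrite /plift; case: piP => b /eqP; rewrite eqmodE /= => /asboolP/key/eqP.
by rewrite fliftB subr_eq0 => /eqP.
Qed.

Lemma plift_gen k : plift f (pgen k) = f k.
Proof. by rewrite plift_pi fliftU. Qed.

Lemma pliftB : {morph plift f : x y / x - y}.
Proof.
by elim/quotW=> x; elim/quotW=> y; rewrite -/ppi -ppiB !plift_pi fliftB.
Qed.

Lemma plift0 : plift f 0 = 0.
Proof. by have := pliftB 0 0; rewrite subr0 subrr. Qed.

Lemma pliftN : {morph plift f : x / - x}.
Proof. by move=> x; rewrite -[- x]add0r pliftB plift0 add0r. Qed.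

Lemma pliftD : {morph plift f : x y / x + y}.
Proof. by move=> x y; rewrite -[y in LHS]opprK pliftB pliftN opprK. Qed.

End Lift.

Lemma plift_funB (M : zmodType) (f g : K -> M) x :
  plift (fun k => f k - g k) x = plift f x - plift g x.
Proof. exact: flift_funB. Qed.

Lemma plift_cst0 (M : zmodType) (x : pres) : plift (fun _ => 0 : M) x = 0.
Proof. by have := plift_funB (fun _ => 0 : M) (fun _ => 0) x; rewrite subr0 subrr. Qed.

End Presented.

Section BilinearLift.
Variables (K1 K2 : choiceType) (rel1 : {freeg K1} -> Prop)
  (rel2 : {freeg K2} -> Prop) (M : zmodType) (f : K1 -> K2 -> M).

Definition plift2 (x : pres rel1) (y : pres rel2) : M :=
  plift (fun k => plift (f k) y) x.

Hypotheses (kill1 : forall k2, kills rel1 (f ^~ k2))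
           (kill2 : forall k1, kills rel2 (f k1)).

Lemma kills_plift y : kills rel1 (fun k => plift (f k) (y : pres rel2)).
Proof.
move=> a ra; elim/pres_ind: y => [|x y IHx IHy|k].
- under eq_fun do rewrite plift0 //.
  by have := flift_funB (fun=> 0) (fun=> 0 : M) a; rewrite subr0 subrr.
- under eq_fun do rewrite pliftB //.
  by rewrite flift_funB IHx IHy subr0.
- under eq_fun do rewrite plift_gen //.
  exact: kill1.
Qed.

Lemma plift2Bl y : {morph plift2^~ y : x x' / x - x'}.
Proof. exact/pliftB/kills_plift. Qed.

Lemma plift2Br x : {morph plift2 x : y y' / y - y'}.
Proof.
move=> y y'; rewrite /plift2; under eq_fun do rewrite pliftB //.
exact: plift_funB.
Qed.

Lemma plift2_gen k1 k2 : plift2 (pgen rel1 k1) (pgen rel2 k2) = f k1 k2.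
Proof. by rewrite /plift2 plift_gen ?plift_gen //; apply: kills_plift. Qed.

End BilinearLift.

Section Tensor.
Variables U V : zmodType.

Inductive tensor_rel : {freeg (U * V)%type} -> Prop :=
| TensorDl u u' v :
    tensor_rel (fgen (u + u', v) - fgen (u, v) - fgen (u', v))
| TensorDr u v v' :
    tensor_rel (fgen (u, v + v') - fgen (u, v) - fgen (u, v')).

Definition tensor := pres tensor_rel.
HB.instance Definition _ := GRing.Zmodule.on tensor.

Definition tens (u : U) (v : V) : tensor := pgen tensor_rel (u, v).

Lemma tensDl v : {morph tens^~ v : u u' / u + u'}.
Proof.
move=> u u'; apply/eqP; rewrite -subr_eq0 opprD addrA -!ppiB.
by rewrite ppi_rel //; left.
Qed.

Lemma tensDr u : {morph tens u : v v' / v + v'}.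
Proof.
move=> v v'; apply/eqP; rewrite -subr_eq0 opprD addrA -!ppiB.
by rewrite ppi_rel //; right.
Qed.

Lemma kills_tensor (M : zmodType) (f : U * V -> M) :
  (forall v, {morph (fun u => f (u, v)) : u u' / u + u'}) ->
  (forall u, {morph (fun v => f (u, v)) : v v' / v + v'}) ->
  kills tensor_rel f.
Proof.
by move=> fDl fDr _ [u u' v|u v v']; rewrite !fliftB !fliftU ?fDl ?fDr addrAC addrK subrr.
Qed.

End Tensor.

Section Zloc.
Variable p : nat.

Definition zloc_pred : {pred rat} := fun x => coprime p `|denq x|.

Lemma zloc_predP x (n d : int) :
  coprime p `|d| -> d != 0 -> x * d%:~R = n%:~R -> x \in zloc_pred.
Proof.
move=> pd d0 xd; apply: coprime_dvdr pd.
suff : (`|denq x| %| `|numq x| * `|d|)%N.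
  by rewrite Gauss_dvdr // coprime_sym coprime_num_den.
rewrite -abszM; apply/dvdzP; exists n.
by apply/eqP; rewrite -(eqr_int rat) !rmorphM /= numqE mulrAC xd.
Qed.

Lemma zloc_subring_closed : subring_closed zloc_pred.
Proof.
have pos x : x \in zloc_pred -> coprime p `|denq x| by [].
split=> [|x y /pos px /pos py|x y /pos px /pos py].
- exact: (coprimen1 p).
- apply: (@zloc_predP _ (numq x * denq y - numq y * denq x) (denq x * denq y)).
  + by rewrite abszM coprimeMr px.
  + by rewrite mulf_neq0 ?denq_neq0.
  + by rewrite rmorphB !rmorphM /= !numqE; ring.
- apply: (@zloc_predP _ (numq x * numq y) (denq x * denq y)).
  + by rewrite abszM coprimeMr px.
  + by rewrite mulf_neq0 ?denq_neq0.
  + by rewrite !rmorphM /= !numqE mulrACA.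
Qed.

HB.instance Definition _ :=
  GRing.isSubringClosed.Build rat zloc_pred zloc_subring_closed.

(* Z_(p), as a subring of Q when p is prime.                                   *)
Definition Zloc := {x : rat | x \in zloc_pred}.
HB.instance Definition _ := SubType.on Zloc.
HB.instance Definition _ := Choice.on Zloc.
HB.instance Definition _ := [SubChoice_isSubComNzRing of Zloc by <:].
End Zloc.

Section BaseChange.
Variable p : nat.

Definition ploc (U : zmodType) := tensor U (Zloc p).
HB.instance Definition _ U := GRing.Zmodule.on (ploc U).

Variables (U V W : zmodType) (m : U -> V -> W).

(* (u (x) c, v (x) d) |-> m u v (x) (c * d), for a biadditive m.               *)
Definition ploc2 : ploc U -> ploc V -> ploc W :=
  plift2 (fun uc vd => tens (m uc.1 vd.1) (uc.2 * vd.2)).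

Hypotheses (mDl : forall v, {morph m^~ v : u u' / u + u'})
           (mDr : forall u, {morph m u : v v' / v + v'}).

Lemma ploc2_kill1 vd : kills (tensor_rel (V := Zloc p))
   ((fun (uc : U * Zloc p) (vd : V * Zloc p) => tens (m uc.1 vd.1) (uc.2 * vd.2))^~ vd).
Proof.
apply: kills_tensor => [c u u'|u c c'] /=; first by rewrite mDl tensDl.
by rewrite mulrDl tensDr.
Qed.

Lemma ploc2_kill2 uc : kills (tensor_rel (V := Zloc p))
   ((fun (uc : U * Zloc p) (vd : V * Zloc p) => tens (m uc.1 vd.1) (uc.2 * vd.2)) uc).
Proof.
apply: kills_tensor => [c u u'|u c c'] /=; first by rewrite mDr tensDl.
by rewrite mulrDr tensDr.
Qed.

Lemma ploc2Bl y : {morph ploc2^~ y : x x' / x - x'}.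
Proof. exact: plift2Bl ploc2_kill1 ploc2_kill2 y. Qed.

Lemma ploc2Br x : {morph ploc2 x : y y' / y - y'}.
Proof. exact: plift2Br ploc2_kill2 x. Qed.

Lemma ploc2_tens u c v d : ploc2 (tens u c) (tens v d) = tens (m u v) (c * d).
Proof. exact: (plift2_gen ploc2_kill1 ploc2_kill2). Qed.

End BaseChange.

Local Open Scope group_scope.
Local Open Scope quotient_scope.
Local Notation qrepr := generic_quotient.repr.

(* A finite left-free (G,H)-biset with carrier T: G acts on the right and H on *)
(* the left; the values of [lact] off H and of [ract] off G are irrelevant.    *)
Record lfbiset (gT hT : finGroupType) (G : {group gT}) (H : {group hT})
    (T : finType) := LFBiset {
  lact : hT -> T -> T;
  ract : T -> gT -> T;
  lact1 : forall x, lact 1 x = x;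
  lactM : {in H &, forall h k x, lact (h * k) x = lact h (lact k x)};
  ract1 : forall x, ract x 1 = x;
  ractM : {in G &, forall g k x, ract x (g * k) = ract (ract x g) k};
  lractA : {in H & G, forall h g x, ract (lact h x) g = lact h (ract x g)};
  lact_free : {in H, forall h x, lact h x = x -> h = 1}
}.

Section BisetIso.
Variables (gT hT : finGroupType) (G : {group gT}) (H : {group hT}).
Implicit Types T : finType.

Definition biset_iso (T1 T2 : finType) (X : lfbiset G H T1) (Y : lfbiset G H T2) : Prop :=
  exists f : T1 -> T2,
    [/\ bijective f,
        {in H, forall h x, f (lact X h x) = lact Y h (f x)} &
        {in G, forall g x, f (ract X x g) = ract Y (f x) g}].

Lemma biset_iso_refl T (X : lfbiset G H T) : biset_iso X X.
Proof. by exists id; split=> //; exists id. Qed.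

Lemma biset_iso_sym (T1 T2 : finType) (X : lfbiset G H T1) (Y : lfbiset G H T2) :
  biset_iso X Y -> biset_iso Y X.
Proof.
case=> f [[g fK gK] fl fr]; exists g; split; first by exists f.
- by move=> h Hh x; rewrite -{1}[x]gK -fl // fK.
- by move=> h Gh x; rewrite -{1}[x]gK -fr // fK.
Qed.

Lemma biset_iso_trans (T1 T2 T3 : finType) (X : lfbiset G H T1) (Y : lfbiset G H T2)
    (Z : lfbiset G H T3) : biset_iso X Y -> biset_iso Y Z -> biset_iso X Z.
Proof.
case=> f [bf fl fr] [g [bg gl gr]]; exists (g \o f); split=> [|h Hh x|h Gh x].
- exact: bij_comp.
- by rewrite /= fl // gl.
- by rewrite /= fr // gr.
Qed.

Lemma biset_iso_span (T T1 T2 : finType) (X : lfbiset G H T1)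
    (Y : lfbiset G H T2) (la : hT -> T -> T) (ra : T -> gT -> T)
    (f : T -> T1) (g : T -> T2) :
  (forall y, exists x, f x == y) -> (forall y, exists x, g x == y) ->
  (forall x y, f x = f y <-> g x = g y) ->
  {in H, forall h x, f (la h x) = lact X h (f x)} ->
  {in G, forall k x, f (ra x k) = ract X (f x) k} ->
  {in H, forall h x, g (la h x) = lact Y h (g x)} ->
  {in G, forall k x, g (ra x k) = ract Y (g x) k} ->
  biset_iso X Y.
Proof.
move=> fs gs fg fl fr gl gr.
pose f' y := xchoose (fs y); pose g' y := xchoose (gs y).
have f'K : cancel f' f by move=> y; apply/eqP/(xchooseP (fs y)).
have g'K : cancel g' g by move=> y; apply/eqP/(xchooseP (gs y)).
exists (g \o f'); split=> [|h Hh x|k Gk x].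
- exists (f \o g') => y /=; first by rewrite -[RHS]f'K; apply/fg; rewrite g'K.
  by rewrite -[RHS]g'K; apply/fg; rewrite f'K.
- by rewrite /= -gl //; apply/fg; rewrite fl // !f'K.
- by rewrite /= -gr //; apply/fg; rewrite fr // !f'K.
Qed.

Section Transport.
Variables (T1 T2 : finType) (X : lfbiset G H T1) (f : T1 -> T2) (g : T2 -> T1).
Hypotheses (fK : cancel f g) (gK : cancel g f).

Definition transport : lfbiset G H T2.
Proof.
exists (fun h y => f (lact X h (g y))) (fun y k => f (ract X (g y) k)).
- by move=> x; rewrite lact1.
- by move=> h k Hh Hk x; rewrite lactM // fK.
- by move=> x; rewrite ract1.
- by move=> h k Hh Hk x; rewrite ractM // fK.
- by move=> h k Hh Gk x; rewrite !fK lractA.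
- move=> h Hh x; rewrite -{2}[x]gK => /(can_inj fK); exact: lact_free.
Defined.

Lemma transport_iso : biset_iso transport X.
Proof. by exists g; split=> [|h _ x|h _ x] /=; [exists f| |]; rewrite ?fK. Qed.
End Transport.

Definition skel T (X : lfbiset G H T) : lfbiset G H 'I_#|T| :=
  transport X (@enum_rankK T) (@enum_valK T).

Lemma skel_iso T (X : lfbiset G H T) : biset_iso (skel X) X.
Proof. exact: transport_iso. Qed.

Definition bsum (T1 T2 : finType) (X : lfbiset G H T1) (Y : lfbiset G H T2) :
  lfbiset G H (T1 + T2)%type.
Proof.
exists (fun h z => match z with inl x => inl (lact X h x) | inr y => inr (lact Y h y) end)
       (fun z g => match z with inl x => inl (ract X x g) | inr y => inr (ract Y y g) end).
- by case=> x; rewrite lact1.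
- by move=> h k Hh Hk [] x; rewrite lactM.
- by case=> x; rewrite ract1.
- by move=> h k Hh Hk [] x; rewrite ractM.
- by move=> h k Hh Hk [] x; rewrite lractA.
- by move=> h Hh [] x [] /lact_free ->.
Defined.

Lemma bsum_iso (T1 T2 T1' T2' : finType) (X : lfbiset G H T1) (Y : lfbiset G H T2)
    (X' : lfbiset G H T1') (Y' : lfbiset G H T2') :
  biset_iso X X' -> biset_iso Y Y' -> biset_iso (bsum X Y) (bsum X' Y').
Proof.
case=> f [[f' fK f'K] fl fr] [g [[g' gK g'K] gl gr]].
exists (fun z => match z with inl x => inl (f x) | inr y => inr (g y) end).
split=> [|h Hh [] x|h Hh [] x] /=; rewrite ?fl ?fr ?gl ?gr //.
exists (fun z => match z with inl x => inl (f' x) | inr y => inr (g' y) end).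
  by case=> x; rewrite ?fK ?gK.
by case=> x; rewrite ?f'K ?g'K.
Qed.

(* Restricting carriers to ordinals keeps the type of generators small; every  *)
(* left-free biset is isomorphic to one of these, by [skel_iso].               *)
Definition biset_code := {classic {n : nat & lfbiset G H 'I_n}}.

Definition code T (X : lfbiset G H T) : biset_code := existT _ #|T| (skel X).

Inductive burnside_rel : {freeg biset_code} -> Prop :=
| BurnsideIso (c d : biset_code) : biset_iso (projT2 c) (projT2 d) ->
    burnside_rel (fgen c - fgen d)%R
| BurnsideSum (c d : biset_code) :
    burnside_rel
      (fgen (code (bsum (projT2 c) (projT2 d))) - fgen c - fgen d)%R.

(* The Grothendieck group A(G,H): isomorphism classes of bisets are identified *)
(* by BurnsideIso, and BurnsideSum makes disjoint union the addition.          *)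
Definition burnside := pres burnside_rel.
HB.instance Definition _ := GRing.Zmodule.on burnside.

Definition bclass T (X : lfbiset G H T) : burnside := pgen burnside_rel (code X).

Lemma bclass_iso (T1 T2 : finType) (X : lfbiset G H T1) (Y : lfbiset G H T2) :
  biset_iso X Y -> bclass X = bclass Y.
Proof.
move=> XY; apply/eqP; rewrite -subr_eq0 -ppiB ppi_rel //; left.
apply: biset_iso_trans (skel_iso X) _; apply: biset_iso_trans XY _.
exact/biset_iso_sym/skel_iso.
Qed.

Lemma bclass_sum (T1 T2 : finType) (X : lfbiset G H T1) (Y : lfbiset G H T2) :
  bclass (bsum X Y) = (bclass X + bclass Y)%R.
Proof.
have -> : bclass (bsum X Y) = bclass (bsum (skel X) (skel Y)).
  by apply/bclass_iso/bsum_iso; exact/biset_iso_sym/skel_iso.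
apply/eqP; rewrite -subr_eq0 opprD addrA -!ppiB ppi_rel //.
exact: (BurnsideSum (code X) (code Y)).
Qed.

Lemma pgen_code c : pgen burnside_rel c = bclass (projT2 c).
Proof.
apply/eqP; rewrite -subr_eq0 -ppiB ppi_rel //; left.
exact/biset_iso_sym/skel_iso.
Qed.

Lemma burnside_ind (P : burnside -> Prop) :
  P 0%R -> (forall x y, P x -> P y -> P (x - y)%R) ->
  (forall T (X : lfbiset G H T), P (bclass X)) -> forall x, P x.
Proof. by move=> P0 PB PX; apply: pres_ind => // c; rewrite pgen_code. Qed.

Lemma kills_burnside (M : zmodType) (f : biset_code -> M) :
  (forall c d, biset_iso (projT2 c) (projT2 d) -> f c = f d) ->
  (forall c d, f (code (bsum (projT2 c) (projT2 d))) = f c + f d)%R ->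
  kills burnside_rel f.
Proof.
move=> fiso fsum _ [c d cd|c d]; rewrite !fliftB !fliftU.
  by rewrite (fiso c d) // subrr.
by rewrite fsum addrAC addrK subrr.
Qed.
End BisetIso.

Section FiniteQuotient.
Variables (T : finType) (e : equiv_rel T).

Definition finquot : Type := {eq_quot e}.
HB.instance Definition _ := EqQuotient.on finquot.
HB.instance Definition _ := Countable.on finquot.

Lemma finquot_enumP : Finite.axiom (undup [seq \pi_finquot x | x : T]).
Proof.
move=> q; rewrite count_uniq_mem ?undup_uniq // mem_undup.
by elim/quotW: q => x; rewrite image_f.
Qed.

HB.instance Definition _ := isFinite.Build finquot finquot_enumP.

End FiniteQuotient.

Section QuotientBiset.
Variables (gT hT : finGroupType) (G : {group gT}) (H : {group hT}).
Variables (T : finType) (e : equiv_rel T) (la : hT -> T -> T) (ra : T -> gT -> T).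
Hypotheses (la1 : forall x, la 1 x = x)
  (laM : {in H &, forall h k x, la (h * k) x = la h (la k x)})
  (ra1 : forall x, ra x 1 = x)
  (raM : {in G &, forall g k x, ra x (g * k) = ra (ra x g) k})
  (laC : {in H & G, forall h g x, ra (la h x) g = la h (ra x g)})
  (la_e : {in H, forall h x y, e x y -> e (la h x) (la h y)})
  (ra_e : {in G, forall g x y, e x y -> e (ra x g) (ra y g)})
  (la_free : {in H, forall h x, e (la h x) x -> h = 1}).
Local Notation Q := (finquot e).
Local Notation cl x := (\pi_Q x).

Definition qlact h (q : Q) : Q := cl (la h (qrepr q)).
Definition qract (q : Q) g : Q := cl (ra (qrepr q) g).

Lemma qlactE h x : h \in H -> qlact h (cl x) = cl (la h x).
Proof.
by move=> Hh; apply/eqmodP/la_e => //; apply/eqmodP; rewrite reprK.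
Qed.

Lemma qractE g x : g \in G -> qract (cl x) g = cl (ra x g).
Proof.
by move=> Gg; apply/eqmodP/ra_e => //; apply/eqmodP; rewrite reprK.
Qed.

Definition quot_biset : lfbiset G H Q.
Proof.
exists qlact qract.
- by elim/quotW=> x; rewrite qlactE ?la1.
- by move=> h k Hh Hk; elim/quotW=> x; rewrite (qlactE x Hk) !qlactE ?groupM ?laM.
- by elim/quotW=> x; rewrite qractE ?ra1.
- by move=> h k Hh Hk; elim/quotW=> x; rewrite (qractE x Hh) !qractE ?groupM ?raM.
- by move=> h g Hh Gg; elim/quotW=> x; rewrite (qlactE x Hh) (qractE x Gg) qlactE // qractE // laC.
- move=> h Hh; elim/quotW=> x; rewrite qlactE // => /eqmodP/=; exact: la_free.
Defined.

Lemma lact_quot h x : h \in H -> lact quot_biset h (cl x) = cl (la h x).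
Proof. exact: qlactE. Qed.

Lemma ract_quot x g : g \in G -> ract quot_biset (cl x) g = cl (ra x g).
Proof. exact: qractE. Qed.

End QuotientBiset.

(* (H x G)/~ with (x phi(k), y) ~ (x, k y) for k in K; since K is a group, the *)
(* relation below is already an equivalence.                                   *)
Section HomBiset.
Variables (gT hT : finGroupType) (G : {group gT}) (H : {group hT}).
Variables (K : {group gT}) (phi : {morphism K >-> hT}).
Hypotheses (sKG : K \subset G) (sphiH : phi @* K \subset H).

Definition hombiset_rel (u v : [subg H] * [subg G]) : bool :=
  [exists k in K, (u.1 == v.1 * subg H (phi k)) && (v.2 == subg G k * u.2)].

Lemma hombiset_relP u v :
  reflect (exists2 k, k \in K &
             u.1 = v.1 * subg H (phi k) /\ v.2 = subg G k * u.2)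
          (hombiset_rel u v).
Proof.
apply: (iffP exists_inP) => [[k Kk /andP[/eqP uv /eqP vu]]|[k Kk [-> ->]]].
  by exists k.
by exists k => //; rewrite !eqxx.
Qed.

Let phiH k : k \in K -> phi k \in H.
Proof. by move=> Kk; apply: (subsetP sphiH); rewrite mem_morphim. Qed.
Let KG k : k \in K -> k \in G. Proof. exact: (subsetP sKG). Qed.

Lemma subg1 (aT : finGroupType) (A : {group aT}) : subg A 1 = 1.
Proof. by apply: val_inj; rewrite subgK. Qed.
Lemma subgV (aT : finGroupType) (A : {group aT}) x :
  x \in A -> subg A x^-1 = (subg A x)^-1.
Proof. by move=> Ax; apply: val_inj; rewrite /= !subgK ?groupV. Qed.

Lemma hombiset_equiv : equiv_class_of hombiset_rel.
Proof.
split=> [u|u v|v u w].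
- by apply/hombiset_relP; exists 1; rewrite ?morph1 ?subg1 ?mulg1 ?mul1g.
- apply/hombiset_relP/hombiset_relP => -[k Kk [Du Dv]];
  by exists k^-1; rewrite ?groupV // morphV // !subgV ?KG ?phiH // Du Dv mulgK mulKg.
- move=> /hombiset_relP[k Kk [Du Dv]] /hombiset_relP[l Kl [Dv' Dw]].
  apply/hombiset_relP; exists (l * k); first exact: groupM.
  by rewrite morphM // !subgM ?KG ?phiH // Du Dv' Dw Dv !mulgA.
Qed.

Definition hombiset_equiv_rel := EquivRelPack hombiset_equiv.

Definition hombiset : lfbiset G H (finquot hombiset_equiv_rel).
Proof.
apply: (@quot_biset _ _ G H _ hombiset_equiv_rel
  (fun h u => (subg H h * u.1, u.2)) (fun u g => (u.1, u.2 * subg G g))).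
- by case=> x y; rewrite subg1 mul1g.
- by move=> h k Hh Hk x; rewrite subgM // mulgA.
- by case=> x y; rewrite subg1 mulg1.
- by move=> h k Hh Hk x; rewrite subgM // mulgA.
- by [].
- move=> h Hh u v /hombiset_relP[k Kk [Du Dv]]; apply/hombiset_relP.
  by exists k; rewrite //= Du Dv mulgA.
- move=> h Hh u v /hombiset_relP[k Kk [Du Dv]]; apply/hombiset_relP.
  by exists k; rewrite //= Du Dv mulgA.
- move=> h Hh u /hombiset_relP[k Kk /= [Du Dv]].
  have k1 : k = 1.
    by rewrite -(@subgK _ G _ (KG Kk)) -[subg G k](mulgK u.2) -Dv mulgV.
  move: Du; rewrite k1 morph1 subg1 mulg1 => /(canRL (mulgK _)).
  by rewrite mulgV => /(congr1 val); rewrite subgK.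
Defined.

Definition hpair u : finquot hombiset_equiv_rel := \pi_(finquot _) u.

Lemma hpair_surj q : exists u, hpair u == q.
Proof. by exists (qrepr q); rewrite /hpair reprK. Qed.

Lemma hpairP u v : hpair u = hpair v <->
  exists2 k, k \in K & u.1 = v.1 * subg H (phi k) /\ v.2 = subg G k * u.2.
Proof. by split=> [/eqmodP/hombiset_relP//|uv]; apply/eqmodP/hombiset_relP. Qed.

Lemma lact_hpair h u :
  h \in H -> lact hombiset h (hpair u) = hpair (subg H h * u.1, u.2).
Proof. exact: lact_quot. Qed.

Lemma ract_hpair u g :
  g \in G -> ract hombiset (hpair u) g = hpair (u.1, u.2 * subg G g).
Proof. exact: ract_quot. Qed.

End HomBiset.

Section Composition.
Variables (gT hT lT : finGroupType).
Variables (G : {group gT}) (H : {group hT}) (L : {group lT}).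

Section Biset.
Variables (T1 T2 : finType) (X : lfbiset H L T1) (Y : lfbiset G H T2).

(* (x h, y) ~ (x, h y) for h in H; again already an equivalence.               *)
Definition bcomp_rel (u v : T1 * T2) : bool :=
  [exists h in H, (u.1 == ract X v.1 h) && (v.2 == lact Y h u.2)].

Lemma bcomp_relP u v :
  reflect (exists2 h, h \in H & u.1 = ract X v.1 h /\ v.2 = lact Y h u.2)
          (bcomp_rel u v).
Proof.
apply: (iffP exists_inP) => [[k Kk /andP[/eqP uv /eqP vu]]|[k Kk [-> ->]]].
  by exists k.
by exists k => //; rewrite !eqxx.
Qed.

Lemma bcomp_equiv : equiv_class_of bcomp_rel.
Proof.
split=> [u|u v|v u w].
- by apply/bcomp_relP; exists 1; rewrite ?lact1 ?ract1.
- apply/bcomp_relP/bcomp_relP => -[k Kk [Du Dv]]; exists k^-1;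
  by rewrite ?groupV // Du Dv -?ractM -?lactM ?groupV // ?mulVg ?mulgV ?lact1 ?ract1.
- move=> /bcomp_relP[k Kk [Du Dv]] /bcomp_relP[l Kl [Dv' Dw]].
  apply/bcomp_relP; exists (l * k); first exact: groupM.
  by rewrite ractM // lactM // -Dv -Dw -Dv'.
Qed.

Definition bcomp_equiv_rel := EquivRelPack bcomp_equiv.

Definition bcomp : lfbiset G L (finquot bcomp_equiv_rel).
Proof.
apply: (@quot_biset _ _ G L _ bcomp_equiv_rel
  (fun l u => (lact X l u.1, u.2)) (fun u g => (u.1, ract Y u.2 g))).
- by case=> x y; rewrite lact1.
- by move=> h k Hh Hk x; rewrite lactM.
- by case=> x y; rewrite ract1.
- by move=> h k Hh Hk x; rewrite ractM.
- by [].
- move=> h Hh u v /bcomp_relP[k Kk [Du Dv]]; apply/bcomp_relP.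
  by exists k; rewrite //= Du lractA.
- move=> h Hh u v /bcomp_relP[k Kk [Du Dv]]; apply/bcomp_relP.
  by exists k; rewrite //= Dv lractA.
- move=> h Hh u /bcomp_relP[k Kk /= [Du /esym Dv]].
  by move: Du; rewrite (lact_free Kk Dv) ract1; apply: lact_free.
Defined.

Definition bpair x y : finquot bcomp_equiv_rel := \pi_(finquot _) (x, y).

Lemma bpair_surj q : exists x y, bpair x y == q.
Proof.
exists (qrepr q).1; exists (qrepr q).2.
by rewrite /bpair -surjective_pairing reprK.
Qed.

Lemma bpairP x y x' y' : bpair x y = bpair x' y' <->
  exists2 h, h \in H & x = ract X x' h /\ y' = lact Y h y.
Proof. by split=> [/eqmodP/bcomp_relP//|uv]; apply/eqmodP/bcomp_relP. Qed.

Lemma lact_bpair l x y :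
  l \in L -> lact bcomp l (bpair x y) = bpair (lact X l x) y.
Proof. exact: lact_quot. Qed.

Lemma ract_bpair x y g :
  g \in G -> ract bcomp (bpair x y) g = bpair x (ract Y y g).
Proof. exact: ract_quot. Qed.

End Biset.

Lemma bcomp_iso (T1 T2 T1' T2' : finType) (X : lfbiset H L T1) (Y : lfbiset G H T2)
    (X' : lfbiset H L T1') (Y' : lfbiset G H T2') :
  biset_iso X X' -> biset_iso Y Y' -> biset_iso (bcomp X Y) (bcomp X' Y').
Proof.
case=> f [[f' fK f'K] fl fr] [g [[g' gK g'K] gl gr]].
apply: (@biset_iso_span _ _ _ _ (T1 * T2)%type _ _ _ _
  (fun l u => (lact X l u.1, u.2)) (fun u k => (u.1, ract Y u.2 k))
  (fun u => bpair X Y u.1 u.2) (fun u => bpair X' Y' (f u.1) (g u.2))).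
- by move=> q; have [x [y xy]] := bpair_surj q; exists (x, y).
- move=> q; have [x [y xy]] := bpair_surj q; exists (f' x, g' y).
  by rewrite /= f'K g'K.
- move=> [x y] [x' y'] /=; split=> /bpairP[h Hh [Dx Dy]]; apply/bpairP; exists h => //.
    by rewrite Dx Dy fr ?gl.
  split; first by apply: (can_inj fK); rewrite fr.
  by apply: (can_inj gK); rewrite gl.
- by move=> h Hh [x y]; rewrite lact_bpair.
- by move=> h Hh [x y]; rewrite ract_bpair.
- by move=> h Hh [x y]; rewrite lact_bpair // fl.
- by move=> h Hh [x y]; rewrite ract_bpair // gr.
Qed.

Lemma bcomp_suml (T1 T1' T2 : finType) (X : lfbiset H L T1) (X' : lfbiset H L T1')
    (Y : lfbiset G H T2) :
  biset_iso (bcomp (bsum X X') Y) (bsum (bcomp X Y) (bcomp X' Y)).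
Proof.
apply: (@biset_iso_span _ _ _ _ ((T1 + T1') * T2)%type _ _ _ _
  (fun l u => (lact (bsum X X') l u.1, u.2)) (fun u k => (u.1, ract Y u.2 k))
  (fun u => bpair (bsum X X') Y u.1 u.2)
  (fun u => match u.1 with inl x => inl (bpair X Y x u.2)
                         | inr x => inr (bpair X' Y x u.2) end)).
- by move=> q; have [x [y xy]] := bpair_surj q; exists (x, y).
- by case=> q; have [x [y /eqP <-]] := bpair_surj q;
    [exists (inl x, y) | exists (inr x, y)].
- move=> [[x|x] y] [[x'|x'] y'] /=; split=> //.
  + by case/bpairP=> h Hh [[-> ->]]; congr inl; apply/bpairP; exists h.
  + by case=> /bpairP[h Hh [-> ->]]; apply/bpairP; exists h.
  + by case/bpairP=> h Hh [].
  + by case/bpairP=> h Hh [].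
  + by case/bpairP=> h Hh [[-> ->]]; congr inr; apply/bpairP; exists h.
  + by case=> /bpairP[h Hh [-> ->]]; apply/bpairP; exists h.
- by move=> h Hh [x y]; rewrite lact_bpair.
- by move=> h Hh [x y]; rewrite ract_bpair.
- by move=> h Hh [[x|x] y] /=; rewrite -lact_bpair.
- by move=> h Hh [[x|x] y] /=; rewrite -ract_bpair.
Qed.

Lemma bcomp_sumr (T1 T2 T2' : finType) (X : lfbiset H L T1) (Y : lfbiset G H T2)
    (Y' : lfbiset G H T2') :
  biset_iso (bcomp X (bsum Y Y')) (bsum (bcomp X Y) (bcomp X Y')).
Proof.
apply: (@biset_iso_span _ _ _ _ (T1 * (T2 + T2'))%type _ _ _ _
  (fun l u => (lact X l u.1, u.2)) (fun u k => (u.1, ract (bsum Y Y') u.2 k))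
  (fun u => bpair X (bsum Y Y') u.1 u.2)
  (fun u => match u.2 with inl y => inl (bpair X Y u.1 y)
                         | inr y => inr (bpair X Y' u.1 y) end)).
- by move=> q; have [x [y xy]] := bpair_surj q; exists (x, y).
- by case=> q; have [x [y /eqP <-]] := bpair_surj q;
    [exists (x, inl y) | exists (x, inr y)].
- move=> [x [y|y]] [x' [y'|y']] /=; split=> //.
  + by case/bpairP=> h Hh [-> [->]]; congr inl; apply/bpairP; exists h.
  + by case=> /bpairP[h Hh [-> ->]]; apply/bpairP; exists h.
  + by case/bpairP=> h Hh [].
  + by case/bpairP=> h Hh [].
  + by case/bpairP=> h Hh [-> [->]]; congr inr; apply/bpairP; exists h.
  + by case=> /bpairP[h Hh [-> ->]]; apply/bpairP; exists h.
- by move=> h Hh [x y]; rewrite lact_bpair.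
- by move=> h Hh [x y]; rewrite ract_bpair.
- by move=> h Hh [x [y|y]] /=; rewrite -lact_bpair.
- by move=> h Hh [x [y|y]] /=; rewrite -ract_bpair.
Qed.

Definition burnside_comp : burnside H L -> burnside G H -> burnside G L :=
  plift2 (fun (c : biset_code H L) (d : biset_code G H) =>
            bclass (bcomp (projT2 c) (projT2 d))).

Lemma burnside_comp_kill1 (d : biset_code G H) : kills (@burnside_rel _ _ H L)
  ((fun (c : biset_code H L) (d : biset_code G H) => bclass (bcomp (projT2 c) (projT2 d)))^~ d).
Proof.
apply: kills_burnside => [c c' cc'|c c'].
  by apply/bclass_iso/bcomp_iso => //; exact: biset_iso_refl.
rewrite -bclass_sum; apply: bclass_iso; apply: biset_iso_trans (bcomp_suml _ _ _).
by apply: bcomp_iso; [exact: skel_iso | exact: biset_iso_refl].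
Qed.

Lemma burnside_comp_kill2 (c : biset_code H L) : kills (@burnside_rel _ _ G H)
  ((fun (c : biset_code H L) (d : biset_code G H) => bclass (bcomp (projT2 c) (projT2 d))) c).
Proof.
apply: kills_burnside => [d d' dd'|d d'].
  by apply/bclass_iso/bcomp_iso => //; exact: biset_iso_refl.
rewrite -bclass_sum; apply: bclass_iso; apply: biset_iso_trans (bcomp_sumr _ _ _).
by apply: bcomp_iso; [exact: biset_iso_refl | exact: skel_iso].
Qed.

Lemma burnside_compBl y : {morph burnside_comp^~ y : x x' / (x - x')%R}.
Proof. exact: plift2Bl burnside_comp_kill1 burnside_comp_kill2 y. Qed.

Lemma burnside_compBr x : {morph burnside_comp x : y y' / (y - y')%R}.
Proof. exact: plift2Br burnside_comp_kill2 x. Qed.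

Lemma burnside_compE (T1 T2 : finType) (X : lfbiset H L T1) (Y : lfbiset G H T2) :
  burnside_comp (bclass X) (bclass Y) = bclass (bcomp X Y).
Proof.
rewrite /burnside_comp (plift2_gen burnside_comp_kill1 burnside_comp_kill2).
by apply/bclass_iso/bcomp_iso; exact: skel_iso.
Qed.

End Composition.

Lemma bcomp_assoc (gT hT kT lT : finGroupType) (G : {group gT}) (H : {group hT})
    (K : {group kT}) (L : {group lT}) (T1 T2 T3 : finType)
    (X : lfbiset K L T1) (Y : lfbiset H K T2) (Z : lfbiset G H T3) :
  biset_iso (bcomp X (bcomp Y Z)) (bcomp (bcomp X Y) Z).
Proof.
apply: (@biset_iso_span _ _ _ _ (T1 * T2 * T3)%type _ _ _ _
  (fun l u => (lact X l u.1.1, u.1.2, u.2)) (fun u k => (u.1, ract Z u.2 k))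
  (fun u => bpair X (bcomp Y Z) u.1.1 (bpair Y Z u.1.2 u.2))
  (fun u => bpair (bcomp X Y) Z (bpair X Y u.1.1 u.1.2) u.2)).
- move=> q; have [x [q' /eqP <-]] := bpair_surj q.
  by have [y [z /eqP <-]] := bpair_surj q'; exists (x, y, z).
- move=> q; have [q' [z /eqP <-]] := bpair_surj q.
  by have [x [y /eqP <-]] := bpair_surj q'; exists (x, y, z).
- move=> [[x y] z] [[x' y'] z'] /=; split.
  + case/bpairP=> k Kk [Dx]; rewrite lact_bpair // => /bpairP[h Hh [Dy Dz]].
    apply/bpairP; exists h^-1; first by rewrite groupV.
    rewrite ract_bpair ?groupV //; split; last first.
      by rewrite Dz -lactM ?groupV // mulVg lact1.
    apply/bpairP; exists k => //; split=> //.
    by rewrite Dy -ractM ?groupV // mulgV ract1.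
  + case/bpairP=> h Hh []; rewrite ract_bpair // => /bpairP[k Kk [Dx Dy]] Dz.
    apply/bpairP; exists k => //; split=> //; rewrite lact_bpair //.
    apply/bpairP; exists h^-1; first by rewrite groupV.
    by rewrite -Dy Dz -ractM -?lactM ?groupV // mulVg mulgV lact1 ract1.
- by move=> h Hh [[x y] z]; rewrite lact_bpair.
- by move=> h Hh [[x y] z]; rewrite !ract_bpair.
- by move=> h Hh [[x y] z]; rewrite !lact_bpair.
- by move=> h Hh [[x y] z]; rewrite ract_bpair.
Qed.

Definition hclass (gT hT : finGroupType) (G : {group gT}) (H : {group hT})
    (K : {group gT}) (phi : {morphism K >-> hT}) (sKG : K \subset G)
    (sphiH : phi @* K \subset H) : burnside G H :=
  bclass (hombiset sKG sphiH).

Section Identity.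
Variables (gT hT : finGroupType) (G : {group gT}) (H : {group hT}).

Lemma sub_idm : idm G @* G \subset G. Proof. by rewrite morphim_idm. Qed.

Definition idbiset := hombiset (subxx G) sub_idm.

Lemma idbisetl (T : finType) (Y : lfbiset H G T) :
  biset_iso (bcomp idbiset Y) Y.
Proof.
apply: (@biset_iso_span _ _ _ _ ([subg G] * [subg G] * T)%type _ _ _ _
  (fun l u => (subg G l * u.1.1, u.1.2, u.2)) (fun u k => (u.1, ract Y u.2 k))
  (fun u => bpair idbiset Y (hpair (subxx G) sub_idm u.1) u.2)
  (fun u => lact Y (val (u.1.1 * u.1.2)) u.2)).
- move=> q; have [v [y /eqP <-]] := bpair_surj q.
  by have [x /eqP <-] := hpair_surj v; exists (x, y).
- by move=> y; exists (1, 1, y); rewrite /= mulg1 lact1.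
- move=> [[x y] z] [[x' y'] z'] /=; split.
  + case/bpairP=> g Gg []; rewrite ract_hpair //.
    case/hpairP=> k Gk /= [-> Dy] ->.
    rewrite -lactM ?groupM ?subgP //; congr lact.
    by rewrite /= -!mulgA; congr (_ * _); move/(congr1 val): Dy; rewrite /= !subgK // => ->.
  + move=> Dz; pose g := (val x' * val y')^-1 * (val x * val y).
    have Gg : g \in G by rewrite !(groupM, groupV, subgP).
    apply/bpairP; exists g => //; split; last first.
      by rewrite lactM ?Dz -?lactM ?mulVg ?lact1 // !(groupM, groupV, subgP).
    rewrite ract_hpair //; apply/hpairP; exists (val x'^-1 * val x) => /=.
      by rewrite !(groupM, groupV, subgP).
    split; apply: val_inj; rewrite /= !subgK ?(groupM, groupV, subgP) // ?mulKVg //.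
    by rewrite /g invMg /= !mulgA mulgV mul1g.
- by move=> h Hh [[x y] z]; rewrite lact_bpair // lact_hpair.
- by move=> h Hh [[x y] z]; rewrite ract_bpair.
- by move=> h Hh [[x y] z] /=; rewrite -lactM ?subgK ?groupM ?subgP ?mulgA.
- by move=> h Hh [[x y] z] /=; rewrite lractA ?groupM ?subgP.
Qed.

Lemma idbisetr (T : finType) (X : lfbiset G H T) :
  biset_iso (bcomp X idbiset) X.
Proof.
apply: (@biset_iso_span _ _ _ _ (T * ([subg G] * [subg G]))%type _ _ _ _
  (fun l u => (lact X l u.1, u.2)) (fun u k => (u.1, (u.2.1, u.2.2 * subg G k)))
  (fun u => bpair X idbiset u.1 (hpair (subxx G) sub_idm u.2))
  (fun u => ract X u.1 (val (u.2.1 * u.2.2)))).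
- move=> q; have [x [v /eqP <-]] := bpair_surj q.
  by have [y /eqP <-] := hpair_surj v; exists (x, y).
- by move=> y; exists (y, (1, 1)); rewrite /= mulg1 ract1.
- move=> [z [x y]] [z' [x' y']] /=; split.
  + case/bpairP=> g Gg [->]; rewrite lact_hpair //.
    case/hpairP=> k Gk /= [-> ->].
    rewrite -ractM ?groupM ?subgP //; congr ract.
    by rewrite /= !subgK // !mulgA.
  + move=> Dz; pose g := (val x' * val y') * (val x * val y)^-1.
    have Gg : g \in G by rewrite !(groupM, groupV, subgP).
    apply/bpairP; exists g => //; split.
      by rewrite ractM -?Dz -?ractM ?mulgV ?ract1 // !(groupM, groupV, subgP).
    rewrite lact_hpair //; apply/hpairP; exists (val y * val y'^-1).
      by rewrite !(groupM, groupV, subgP).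
    split; apply: val_inj; rewrite /= !subgK ?(groupM, groupV, subgP) // ?mulgKV //.
    by rewrite /g invMg /= !mulgA !mulgKV mulgK.
- by move=> h Hh [z [x y]]; rewrite lact_bpair.
- by move=> h Hh [z [x y]]; rewrite ract_bpair // ract_hpair.
- by move=> h Hh [z [x y]] /=; rewrite lractA ?groupM ?subgP.
- by move=> h Hh [z [x y]] /=; rewrite -ractM ?subgK ?groupM ?subgP ?mulgA.
Qed.
End Identity.

Section CartesianProduct.
Variables (gT1 gT2 hT1 hT2 : finGroupType).
Variables (G1 : {group gT1}) (G2 : {group gT2}).
Variables (H1 : {group hT1}) (H2 : {group hT2}).

Definition bprod (T1 T2 : finType) (X : lfbiset G1 H1 T1) (Y : lfbiset G2 H2 T2) :
  lfbiset (setX G1 G2) (setX H1 H2) (T1 * T2)%type.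
Proof.
exists (fun h z => (lact X h.1 z.1, lact Y h.2 z.2))
       (fun z g => (ract X z.1 g.1, ract Y z.2 g.2)).
- by case=> x y; rewrite !lact1.
- by move=> [h h'] [k k'] /setXP[? ?] /setXP[? ?] z; rewrite !lactM.
- by case=> x y; rewrite !ract1.
- by move=> [h h'] [k k'] /setXP[? ?] /setXP[? ?] z; rewrite !ractM.
- by move=> [h h'] [k k'] /setXP[? ?] /setXP[? ?] z; rewrite !lractA.
- by move=> [h k] /setXP[Hh Hk] [x y] [/(lact_free Hh) -> /(lact_free Hk) ->].
Defined.

Lemma bprod_iso (T1 T2 T1' T2' : finType) (X : lfbiset G1 H1 T1)
    (Y : lfbiset G2 H2 T2) (X' : lfbiset G1 H1 T1') (Y' : lfbiset G2 H2 T2') :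
  biset_iso X X' -> biset_iso Y Y' -> biset_iso (bprod X Y) (bprod X' Y').
Proof.
case=> f [[f' fK f'K] fl fr] [g [[g' gK g'K] gl gr]].
exists (fun z => (f z.1, g z.2)); split.
- by exists (fun z => (f' z.1, g' z.2)) => -[x y] /=; rewrite ?fK ?gK ?f'K ?g'K.
- by move=> [h h'] /setXP[? ?] z /=; rewrite fl ?gl.
- by move=> [h h'] /setXP[? ?] z /=; rewrite fr ?gr.
Qed.

Lemma bprod_suml (T1 T1' T2 : finType) (X : lfbiset G1 H1 T1)
    (X' : lfbiset G1 H1 T1') (Y : lfbiset G2 H2 T2) :
  biset_iso (bprod (bsum X X') Y) (bsum (bprod X Y) (bprod X' Y)).
Proof.
exists (fun z => match z.1 with inl x => inl (x, z.2) | inr x => inr (x, z.2) end).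
split=> [|h _ [[x|x] y]|h _ [[x|x] y]] //.
exists (fun z => match z with inl u => (inl u.1, u.2) | inr u => (inr u.1, u.2) end).
  by case=> [[x|x] y].
by case=> [[x y]|[x y]].
Qed.

Lemma bprod_sumr (T1 T2 T2' : finType) (X : lfbiset G1 H1 T1)
    (Y : lfbiset G2 H2 T2) (Y' : lfbiset G2 H2 T2') :
  biset_iso (bprod X (bsum Y Y')) (bsum (bprod X Y) (bprod X Y')).
Proof.
exists (fun z => match z.2 with inl y => inl (z.1, y) | inr y => inr (z.1, y) end).
split=> [|h _ [x [y|y]]|h _ [x [y|y]]] //.
exists (fun z => match z with inl u => (u.1, inl u.2) | inr u => (u.1, inr u.2) end).
  by case=> [x [y|y]].
by case=> [[x y]|[x y]].
Qed.

Definition burnside_prod :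
    burnside G1 H1 -> burnside G2 H2 -> burnside (setX G1 G2) (setX H1 H2) :=
  plift2 (fun (c : biset_code G1 H1) (d : biset_code G2 H2) =>
            bclass (bprod (projT2 c) (projT2 d))).

Lemma burnside_prod_kill1 (d : biset_code G2 H2) : kills (@burnside_rel _ _ G1 H1)
  ((fun (c : biset_code G1 H1) (d : biset_code G2 H2) =>
      bclass (bprod (projT2 c) (projT2 d)))^~ d).
Proof.
apply: kills_burnside => [c c' cc'|c c'].
  by apply/bclass_iso/bprod_iso => //; exact: biset_iso_refl.
rewrite -bclass_sum; apply: bclass_iso; apply: biset_iso_trans (bprod_suml _ _ _).
by apply: bprod_iso; [exact: skel_iso | exact: biset_iso_refl].
Qed.

Lemma burnside_prod_kill2 (c : biset_code G1 H1) : kills (@burnside_rel _ _ G2 H2)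
  ((fun (c : biset_code G1 H1) (d : biset_code G2 H2) =>
      bclass (bprod (projT2 c) (projT2 d))) c).
Proof.
apply: kills_burnside => [d d' dd'|d d'].
  by apply/bclass_iso/bprod_iso => //; exact: biset_iso_refl.
rewrite -bclass_sum; apply: bclass_iso; apply: biset_iso_trans (bprod_sumr _ _ _).
by apply: bprod_iso; [exact: biset_iso_refl | exact: skel_iso].
Qed.

Lemma burnside_prodBl y : {morph burnside_prod^~ y : x x' / (x - x')%R}.
Proof. exact: plift2Bl burnside_prod_kill1 burnside_prod_kill2 y. Qed.

Lemma burnside_prodBr x : {morph burnside_prod x : y y' / (y - y')%R}.
Proof. exact: plift2Br burnside_prod_kill2 x. Qed.

Lemma burnside_prodE (T1 T2 : finType) (X : lfbiset G1 H1 T1)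
    (Y : lfbiset G2 H2 T2) :
  burnside_prod (bclass X) (bclass Y) = bclass (bprod X Y).
Proof.
rewrite /burnside_prod (plift2_gen burnside_prod_kill1 burnside_prod_kill2).
by apply/bclass_iso/bprod_iso; exact: skel_iso.
Qed.

End CartesianProduct.

Lemma morphB_D (U V : zmodType) (f : U -> V) :
  {morph f : x y / (x - y)%R} -> {morph f : x y / (x + y)%R}.
Proof.
move=> fB x y; have f0 : f 0%R = 0%R by have := fB 0%R 0%R; rewrite subr0 subrr.
have fN z : f (- z)%R = (- f z)%R by rewrite -[(- z)%R]sub0r fB f0 sub0r.
by rewrite -[y in LHS]opprK fB fN opprK.
Qed.

Lemma morphB_0 (U V : zmodType) (f : U -> V) :
  {morph f : x y / (x - y)%R} -> f 0%R = 0%R.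
Proof. by move=> fB; have := fB 0%R 0%R; rewrite subr0 subrr. Qed.

Lemma burnside_compA (gT hT kT lT : finGroupType) (G : {group gT})
    (H : {group hT}) (K : {group kT}) (L : {group lT})
    (x : burnside K L) (y : burnside H K) (z : burnside G H) :
  burnside_comp x (burnside_comp y z) = burnside_comp (burnside_comp x y) z.
Proof.
elim/burnside_ind: x => [|x x' IH IH'|T X].
- by rewrite !(morphB_0 (burnside_compBl _)).
- by rewrite !burnside_compBl IH IH'.
elim/burnside_ind: y => [|y y' IH IH'|T' Y].
- by rewrite !(morphB_0 (burnside_compBl _)) !(morphB_0 (burnside_compBr _)) (morphB_0 (burnside_compBl _)).
- by rewrite burnside_compBl !burnside_compBr burnside_compBl IH IH'.
elim/burnside_ind: z => [|z z' IH IH'|T'' Z].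
- by rewrite !(morphB_0 (burnside_compBr _)).
- by rewrite !burnside_compBr IH IH'.
by rewrite !burnside_compE; apply/bclass_iso/bcomp_assoc.
Qed.

Section Unit.
Variables (gT hT : finGroupType) (G : {group gT}) (H : {group hT}).

Definition burnside_id : burnside G G := hclass (subxx G) (sub_idm G).

Lemma burnside_comp1l (x : burnside H G) : burnside_comp burnside_id x = x.
Proof.
elim/burnside_ind: x => [|x x' IH IH'|T X].
- by rewrite (morphB_0 (burnside_compBr _)).
- by rewrite burnside_compBr IH IH'.
- by rewrite burnside_compE; apply/bclass_iso/idbisetl.
Qed.

Lemma burnside_comp1r (x : burnside G H) : burnside_comp x burnside_id = x.
Proof.
elim/burnside_ind: x => [|x x' IH IH'|T X].
- by rewrite (morphB_0 (burnside_compBl _)).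
- by rewrite burnside_compBl IH IH'.
- by rewrite burnside_compE; apply/bclass_iso/idbisetr.
Qed.

End Unit.

Local Open Scope ring_scope.

Section Localized.
Variable p : nat.

Section Defs.
Variables (gT hT : finGroupType) (G : {group gT}) (H : {group hT}).

(* A(G,H)_(p) = A(G,H) (x) Z_(p).                                              *)
Definition burnside_loc : Type := ploc p (burnside G H).
HB.instance Definition _ := GRing.Zmodule.on burnside_loc.

(* The canonical map from A(G,H) to A(G,H)_(p).                                *)
Definition bloc (x : burnside G H) : burnside_loc := tens x 1.

Definition hclass_loc (K : {group gT}) (phi : {morphism K >-> hT})
    (sKG : K \subset G) (sphiH : phi @* K \subset H) : burnside_loc :=
  bloc (hclass sKG sphiH).

Lemma burnside_loc_ind (P : burnside_loc -> Prop) :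
  P 0 -> (forall x y, P x -> P y -> P (x - y)) ->
  (forall (x : burnside G H) (c : Zloc p), P (tens x c)) -> forall x, P x.
Proof. by move=> P0 PB PX; apply: pres_ind => // -[x c]; apply: PX. Qed.

End Defs.

Section Comp.
Variables (gT hT lT : finGroupType).
Variables (G : {group gT}) (H : {group hT}) (L : {group lT}).

Definition comp_loc : burnside_loc H L -> burnside_loc G H -> burnside_loc G L :=
  ploc2 (@burnside_comp _ _ _ G H L).

Lemma comp_locBl y : {morph comp_loc^~ y : x x' / x - x'}.
Proof.
by apply: ploc2Bl => z; apply: morphB_D; first [exact: burnside_compBl | exact: burnside_compBr].
Qed.

Lemma comp_locBr x : {morph comp_loc x : y y' / y - y'}.
Proof.
by apply: ploc2Br => z; apply: morphB_D; first [exact: burnside_compBl | exact: burnside_compBr].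
Qed.

Lemma comp_loc_tens x c y d :
  comp_loc (tens x c) (tens y d) = tens (burnside_comp x y) (c * d).
Proof.
by apply: ploc2_tens => z; apply: morphB_D; first [exact: burnside_compBl | exact: burnside_compBr].
Qed.
End Comp.

Section Prod.
Variables (gT1 gT2 hT1 hT2 : finGroupType).
Variables (G1 : {group gT1}) (G2 : {group gT2}).
Variables (H1 : {group hT1}) (H2 : {group hT2}).

Definition prod_loc : burnside_loc G1 H1 -> burnside_loc G2 H2 ->
    burnside_loc (setX G1 G2) (setX H1 H2) :=
  ploc2 (@burnside_prod _ _ _ _ G1 G2 H1 H2).

Lemma prod_locBl y : {morph prod_loc^~ y : x x' / x - x'}.
Proof.
by apply: ploc2Bl => z; apply: morphB_D; first [exact: burnside_prodBl | exact: burnside_prodBr].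
Qed.

Lemma prod_locBr x : {morph prod_loc x : y y' / y - y'}.
Proof.
by apply: ploc2Br => z; apply: morphB_D; first [exact: burnside_prodBl | exact: burnside_prodBr].
Qed.

Lemma prod_loc_tens x c y d :
  prod_loc (tens x c) (tens y d) = tens (burnside_prod x y) (c * d).
Proof.
by apply: ploc2_tens => z; apply: morphB_D; first [exact: burnside_prodBl | exact: burnside_prodBr].
Qed.
End Prod.

Lemma comp_locA (gT hT kT lT : finGroupType) (G : {group gT})
    (H : {group hT}) (K : {group kT}) (L : {group lT}) (x : burnside_loc K L)
    (y : burnside_loc H K) (z : burnside_loc G H) :
  comp_loc x (comp_loc y z) = comp_loc (comp_loc x y) z.
Proof.
elim/burnside_loc_ind: x => [|x x' IH IH'|x c].
- by rewrite !(morphB_0 (comp_locBl _)).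
- by rewrite !comp_locBl IH IH'.
elim/burnside_loc_ind: y => [|y y' IH IH'|y d].
- by rewrite !(morphB_0 (comp_locBl _)) !(morphB_0 (comp_locBr _)) (morphB_0 (comp_locBl _)).
- by rewrite comp_locBl !comp_locBr comp_locBl IH IH'.
elim/burnside_loc_ind: z => [|z z' IH IH'|z e].
- by rewrite !(morphB_0 (comp_locBr _)).
- by rewrite !comp_locBr IH IH'.
by rewrite !comp_loc_tens burnside_compA mulrA.
Qed.

Section Ring.
Variables (gT hT : finGroupType) (G : {group gT}) (H : {group hT}).

Lemma comp_loc1l (x : burnside_loc G H) : comp_loc (bloc (burnside_id H)) x = x.
Proof.
elim/burnside_loc_ind: x => [|x x' IH IH'|x c].
- by rewrite (morphB_0 (comp_locBr _)).
- by rewrite comp_locBr IH IH'.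
- by rewrite comp_loc_tens burnside_comp1l mul1r.
Qed.

Lemma comp_loc1r (x : burnside_loc G H) : comp_loc x (bloc (burnside_id G)) = x.
Proof.
elim/burnside_loc_ind: x => [|x x' IH IH'|x c].
- by rewrite (morphB_0 (comp_locBl _)).
- by rewrite comp_locBl IH IH'.
- by rewrite comp_loc_tens burnside_comp1r mulr1.
Qed.
End Ring.

Definition burnside_ring (hT : finGroupType) (H : {group hT}) : Type :=
  burnside_loc H H.

HB.instance Definition _ hT H := GRing.Zmodule.on (@burnside_ring hT H).

HB.instance Definition _ hT H :=
  GRing.Zmodule_isPzRing.Build (@burnside_ring hT H)
    (@comp_locA _ _ _ _ H H H H) (@comp_loc1l _ _ H H) (@comp_loc1r _ _ H H)
    (fun x y z => morphB_D (@comp_locBl _ _ _ H H H z) x y)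
    (fun x => morphB_D (@comp_locBr _ _ _ H H H x)).

HB.instance Definition _ gT hT (G : {group gT}) (H : {group hT}) :=
  GRing.Zmodule_isLmodule.Build (burnside_ring H) (burnside_loc G H)
    (fun a b x => comp_locA a b x) (@comp_loc1l _ _ G H)
    (fun a => morphB_D (comp_locBr a))
    (fun x => morphB_D (comp_locBl x)).

End Localized.

Section Submodule.
Variables (A : pzRingType) (V : lmodType A) (W : submodClosed V).

(* [val] is the inclusion of the A-module [submod_of] into [V].                *)
Record submod_of := SubmodOf { submod_val : V; _ : submod_val \in W }.

HB.instance Definition _ := [isSub for submod_val].
HB.instance Definition _ := [Choice of submod_of by <:].
HB.instance Definition _ := [SubChoice_isSubLmodule of submod_of by <:].

End Submodule.

Section FusionSystem.
Local Open Scope group_scope.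
Variables (gT : finGroupType) (S : {group gT}).

(* Membership in [fhom Q f] only depends on the values of f on P, by          *)
(* [fhom_comp] and [fhom_conj].                                               *)
Record fusion_system := FusionSystem {
  fhom (P Q : {group gT}) : {morphism P >-> gT} -> Prop;
  fhom_sub (P Q : {group gT}) (f : {morphism P >-> gT}) : fhom Q f ->
    [/\ P \subset S, Q \subset S, 'injm f & f @* P \subset Q];
  fhom_comp (P Q R : {group gT}) (f : {morphism P >-> gT}) (g : {morphism Q >-> gT})
      (h : {morphism P >-> gT}) :
    fhom Q f -> fhom R g -> {in P, forall u, h u = g (f u)} -> fhom R h;
  fhom_conj (P Q : {group gT}) x (f : {morphism P >-> gT}) :
    P \subset S -> Q \subset S -> x \in S ->
    {in P, forall u, x * u * x^-1 \in Q} ->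
    {in P, forall u, f u = x * u * x^-1} -> fhom Q f;
  fhom_iso (P Q : {group gT}) (f : {morphism P >-> gT}) : fhom Q f ->
    fhom (f @* P)%G f /\
    forall g : {morphism f @* P >-> gT}, {in P, cancel f g} -> fhom P g
}.

Variable F : fusion_system.
Implicit Types P Q : {group gT}.

Definition fconjugate P Q : Prop :=
  exists (f : {morphism P >-> gT}) (g : {morphism Q >-> gT}),
    [/\ fhom F Q f, fhom F P g, {in P, cancel f g} & {in Q, cancel g f}].

Definition fully_centralized P : Prop :=
  forall Q, fconjugate P Q -> (#|'C_S(Q)| <= #|'C_S(P)|)%N.

Definition fully_normalized P : Prop :=
  forall Q, fconjugate P Q -> (#|'N_S(Q)| <= #|'N_S(P)|)%N.

Definition AutS P : {set {perm gT}} :=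
  [set a in Aut P | [exists x in 'N_S(P), [forall u in P, a u == x * u * x^-1]]].

Definition AutF P : {set {perm gT}} :=
  [set a in Aut P |
    `[< exists f : {morphism P >-> gT}, fhom F P f /\ {in P, f =1 a} >]].

Section Nphi.
Variables (P : {group gT}) (phi : {morphism P >-> gT}).

Definition Nphi : {set gT} :=
  [set x in 'N_S(P) | [exists y in 'N_S(phi @* P),
     [forall u in P, phi (x * u * x^-1) == y * phi u * y^-1]]].

Lemma Nphi_group_set : group_set Nphi.
Proof.
apply/group_setP; split=> [|x1 x2].
  rewrite inE group1; apply/exists_inP; exists 1; first exact: group1.
  by apply/forall_inP => u Pu; rewrite !mul1g invg1 !mulg1.
case/setIdP=> Nx1 /exists_inP[y1 Ny1 /forall_inP E1].
case/setIdP=> Nx2 /exists_inP[y2 Ny2 /forall_inP E2].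
apply/setIdP; split; first exact: groupM.
apply/exists_inP; exists (y1 * y2); first exact: groupM.
apply/forall_inP => u Pu; rewrite !invMg.
have Pu2 : x2 * u * x2^-1 \in P.
  case/setIP: Nx2 => _ Nx2; have : u ^ x2^-1 \in P by rewrite memJ_norm ?groupV.
  by rewrite conjgE invgK mulgA.
have /eqP := E1 _ Pu2; rewrite (eqP (E2 _ Pu)) !mulgA => ->.
exact: eqxx.
Qed.

Canonical Nphi_group := Group Nphi_group_set.

End Nphi.

Definition saturated (p : nat) : Prop :=
  (forall P, P \subset S -> fully_normalized P ->
     fully_centralized P /\ p.-Sylow(AutF P) (AutS P)) /\
  (forall P (phi : {morphism P >-> gT}),
     fhom F S phi -> fully_centralized (phi @* P)%G ->
     exists2 psi : {morphism Nphi phi >-> gT},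
       fhom F S psi & {in P, psi =1 phi}).

Lemma AutF_group_set P : P \subset S -> group_set (AutF P).
Proof.
move=> sPS; apply/group_setP; split=> [|a b].
  rewrite inE group1; apply/asboolP; exists (idm P).
  split=> [|u _]; last by rewrite perm1.
  apply: (@fhom_conj _ _ _ 1) => // u Pu; rewrite mul1g invg1 mulg1 //.
case/setIdP=> Aa /asboolP[f [Ff fa]] /setIdP[Ab /asboolP[g [Fg gb]]].
apply/setIdP; split; first exact: groupM.
apply/asboolP.
pose h := autm_morphism (groupM Aa Ab); have hE u : h u = (a * b) u by [].
exists h; split=> [|u _]; last exact: hE.
apply: fhom_comp Ff Fg _ => u Pu; rewrite hE permM fa // gb //.
by have /setIdP[Pa _] := Aa; rewrite (perm_closed u Pa).
Qed.

End FusionSystem.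

Section Stable.
Variables (p : nat) (gT hT : finGroupType) (S : {group gT}) (H : {group hT}).
Variable F : fusion_system S.

Lemma fhom_dom (P Q : {group gT}) (f : {morphism P >-> gT}) :
  fhom F Q f -> P \subset S.
Proof. by case/fhom_sub. Qed.

Lemma fhom_im (P : {group gT}) (f : {morphism P >-> gT}) :
  fhom F S f -> f @* P \subset S.
Proof. by case/fhom_sub. Qed.

Lemma incl_im (P : {group gT}) : P \subset S -> idm P @* P \subset S.
Proof. by rewrite morphim_idm. Qed.

Definition right_stable (X : burnside_loc p S H) : Prop :=
  forall (P : {group gT}) (phi : {morphism P >-> gT}) (Fphi : fhom F S phi),
    comp_loc X (hclass_loc p (subxx P) (fhom_im Fphi)) =
    comp_loc X (hclass_loc p (subxx P) (incl_im (fhom_dom Fphi))).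

End Stable.

Section Nishida.
Variables (p : nat) (gT : finGroupType) (S : {group gT}).

Definition nishida : burnside S S -> Prop :=
  addspan (fun X => exists (P : {group gT}) (psi : {morphism P >-> gT})
    (sPS : P \subset S) (spsiS : psi @* P \subset S),
    psi @* P <> S /\ X = hclass sPS spsiS).

(* J(S)_(p), as the image of J(S) (x) Z_(p) in A(S,S) (x) Z_(p).               *)
Definition nishida_loc : burnside_loc p S S -> Prop :=
  addspan (fun X => exists (x : burnside S S) (c : Zloc p),
    nishida x /\ X = tens x c).

End Nishida.

Section Kappa.
Variables (p : nat) (gT : finGroupType) (S : {group gT}).
Local Notation SS := (setX S S).

Lemma diagM : {in S &, {morph (fun x => (x, x)) : x y / (x * y)%g}}.
Proof. by []. Qed.
Definition diag_morphism : {morphism S >-> gT * gT} := Morphism diagM.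

Lemma diag_im : (diag_morphism @* S)%g \subset SS.
Proof.
by apply/subsetP=> _ /morphimP[x Sx _ ->]; apply/setXP.
Qed.

Definition kappaA (x y : burnside_loc p S S) : burnside_loc p S SS :=
  comp_loc (prod_loc x y) (hclass_loc p (subxx S) diag_im).

(* Homogeneity of [kmap] for scalars in Z_(p) is the case of [kmap_act] where  *)
(* a and b are multiples of the identity of burnside_ring p S.                 *)
Record kappa_submodule := KappaSubmodule {
  ksub : submodClosed (burnside_loc p S S : lmodType (burnside_ring p S));
  ksub' : submodClosed (burnside_loc p S SS : lmodType (burnside_ring p SS));
  kmap : submod_of ksub -> submod_of ksub -> submod_of ksub';
  kmapDl x x' y : kmap (x + x') y = kmap x y + kmap x' y;
  kmapDr x y y' : kmap x (y + y') = kmap x y + kmap x y';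
  kmap_act (a b : burnside_ring p S) x y :
    kmap (a *: x) (b *: y) = (prod_loc a b : burnside_ring p SS) *: kmap x y;
  kappa1 (h : burnside_loc p S SS) x : x \in ksub -> comp_loc h x \in ksub';
  kappa2 x y : val (kmap x y) = kappaA (val x) (val y)
}.

Definition has_retractive_transfer (K : kappa_submodule) : Prop :=
  exists (t : {linear burnside_loc p S S -> submod_of (ksub K)})
         (t' : {linear burnside_loc p S SS -> submod_of (ksub' K)}),
    [/\ forall r : submod_of (ksub K), t (val r) = r,
        forall r' : submod_of (ksub' K), t' (val r') = r',
        forall (h : burnside_loc p S SS) (x : burnside_loc p S S),
          val (t' (comp_loc h x)) = comp_loc h (val (t x)) &
        forall (r : submod_of (ksub K)) (x : burnside_loc p S S),
          t' (kappaA (val r) x) = kmap r (t x)].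

End Kappa.

(* Main.v *)
(* The mark of x in A(G,H)_(p) at a pair a : P -> H, b : P -> G counts the points z with          *)
(* a(u) z = z b(u) for all u in P. The marks with b = id separate the elements of A(G,H)_(p), and *)
(* |H| times the mark of x o y at (a, c) is the sum over all b : P -> H of the mark of x at       *)
(* (a, b) times that of y at (b, c).                                                              *)
(*   From fusion systems to transfers: a saturated F has a characteristic element w, whose marks  *)
(* at (a, id) vanish for a outside F and sum to |S| over a : P -> S, and whose marks at (a, f)    *)
(* and (a, id) agree for f in F. Then x is right F-stable iff x o w = x, the transfer is          *)
(* x |-> x o w, and k4 can be read off on marks.                                                  *)
(*   Conversely a transfer is x |-> x o w with w = t(1) idempotent, and k4 at r = w, x = 1 is a   *)
(* Frobenius reciprocity law: if the mark of w at (b, id) is nonzero then its marks at (a, b) and *)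
(* (a, id) agree for all a. Let F consist of the injective maps f such that all restrictions of f *)
(* have the latter property. Congruences mod p between the marks at P and at Q, for P normal in   *)
(* Q, show that F contains every b with nonzero mark at (b, id), and that each F-class contains   *)
(* some R such that Aut_S(R) is Sylow in Aut_F(R) and the mark of w at the inclusion of R,        *)
(* divided by |C_S(R)|, is a p-local unit. Every morphism P -> R onto such an R extends to        *)
(* N_phi, and this suffices for saturation.                                                       *)
From HB Require Import structures.
Require Import Defs.
From mathcomp Require Import all_boot all_order all_algebra all_fingroup all_solvable.
From mathcomp Require Import boolp zify ring.
(* Imported again because fingroup shadows lact and ract.                      *)
Import Defs.

Set Implicit Arguments.
Unset Strict Implicit.
Unset Printing Implicit Defensive.

Import Order.TTheory GRing.Theory Num.Theory.
Local Open Scope group_scope.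

(** * Marks of bisets *)

(** All arguments are made on marks. Left freeness makes [a] a function of z and [b] whenever a(u) z
    = z b(u) on P; this gives the composition formula [mark_comp]. Transitive bisets have a
    triangular table of marks, so the marks at pairs (a, id) determine an element ([mark_inj]). The
    p-local input consists of [mark_sum_dvd], [mark_sum_mod] and the orbit count [mark_cauchy].

    From F to a transfer: x is stable exactly when its marks at (a, f) and (a, id) agree for f in F
    ([right_stableP]). If w is stable, its marks at (a, id) are supported on F and sum to |S| over
    each P, then composition with w projects onto the stable elements ([right_stable_comp]), and k4
    holds because only maps in F contribute to the composite ([kappaA_comp]). Such a w comes from
    [ex_characteristic]: descending through the orders of subgroups, multiples of classes [P, f]
    with f in F are added until the mark at f depends only on the S-class of f(P)
    ([ex_level_target], [adjust_level]); the resulting stable element is then normalised by repeated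
    composition ([ex_normalized]). Since its marks at S do not all vanish, w is outside the Nishida
    ideal.

    From a transfer to F: linearity and k3 show that t and t' are composition with w = t(1), and k4
    at r = w, x = 1 gives [frobenius_marks]. Because R is not inside the Nishida ideal, w has a
    nonzero mark at some automorphism of S ([exists_mark_neq0]). Descending along normal inclusions,
    the marks of w at each P sum to |S| ([sum_mark1]), some of them are units after division by the
    order of a centraliser ([ex_unitn]), maps with nonzero mark are injective ([frob_inj]), and
    stability of w passes to subgroups ([stab_sub]). Hence w has the three properties above for the
    fusion system [rst w], whose stable elements are therefore those fixed by w, i.e. R and R'.
    Saturation needs only one receptive, fully automized subgroup in each class
    ([saturated_criterion]): a unit mark gives receptivity ([unitn_receptive]), and sorting the sum
    |S| of marks by image gives both properties at once ([ex_unitn_automized]). *)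

Section Homs.
Variables (aT hT : finGroupType).

(** Maps are total functions of which only the values on P matter, so that restriction, composition
    and change of source are free. *)
Definition ishom (P : {set aT}) (H : {set hT}) (f : aT -> hT) : Prop :=
  {in P, forall u, f u \in H} /\ {in P &, {morph f : u v / u * v}}.

(* The value 1 off P makes restriction to P injective on homs P H.             *)
Definition homs (P : {set aT}) (H : {set hT}) : {set {ffun aT -> hT}} :=
  [set f : {ffun aT -> hT} | [&& [forall u in P, f u \in H],
     [forall u in P, forall v in P, f (u * v) == f u * f v] &
     [forall u, (u \in P) || (f u == 1)]]].

Definition rs (P : {set aT}) (f : aT -> hT) : {ffun aT -> hT} :=
  [ffun u => if u \in P then f u else 1].

Lemma homsP (P : {set aT}) (H : {set hT}) (f : {ffun aT -> hT}) :
  reflect (ishom P H f /\ forall u, u \notin P -> f u = 1) (f \in homs P H).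
Proof.
rewrite inE; apply: (iffP and3P) => [[/forall_inP fH /forall_inP fM /forallP f1]|[[fH fM] f1]].
  split; first split=> [|u v Pu Pv] //; first by apply/eqP; move/forall_inP: (fM u Pu); apply.
  by move=> u Pu; have := f1 u; rewrite (negbTE Pu) => /eqP.
split; first exact/forall_inP.
  by apply/forall_inP => u Pu; apply/forall_inP => v Pv; rewrite fM.
by apply/forallP=> u; case: (boolP (u \in P)) => //= /f1 ->.
Qed.

Lemma homs_ishom (P : {set aT}) (H : {set hT}) f : f \in homs P H -> ishom P H f.
Proof. by case/homsP. Qed.

Lemma rsE (P : {set aT}) (f : aT -> hT) : {in P, rs P f =1 f}.
Proof. by move=> u Pu; rewrite ffunE Pu. Qed.

Lemma eq_rs (P : {set aT}) (f g : aT -> hT) : {in P, f =1 g} -> rs P f = rs P g.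
Proof. by move=> fg; apply/ffunP => u; rewrite !ffunE; case: ifP => // /fg. Qed.

Lemma rs_eqP (P : {set aT}) (f g : aT -> hT) : rs P f = rs P g -> {in P, f =1 g}.
Proof. by move=> fg u Pu; rewrite -[f u](rsE _ Pu) fg rsE. Qed.

Lemma eq_ishom (P : {set aT}) (H : {set hT}) (f g : aT -> hT) :
  (forall u v, u \in P -> v \in P -> u * v \in P) ->
  {in P, f =1 g} -> ishom P H f -> ishom P H g.
Proof.
move=> PM fg [fH fM]; split=> [u Pu|u v Pu Pv]; first by rewrite -fg ?fH.
by rewrite -!fg ?fM ?PM.
Qed.

Lemma rs_homs (P : {group aT}) (H : {set hT}) (f : aT -> hT) :
  ishom P H f -> rs P f \in homs P H.
Proof.
move=> hf; apply/homsP; split=> [|u /negbTE Pu]; last by rewrite ffunE Pu.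
by apply: eq_ishom hf; [exact: groupM | move=> u Pu; rewrite rsE].
Qed.

Lemma rs_id (P : {set aT}) (H : {set hT}) (f : {ffun aT -> hT}) :
  f \in homs P H -> rs P f = f.
Proof.
by case/homsP => _ f1; apply/ffunP => u; rewrite ffunE; case: ifPn => // /f1 ->.
Qed.

Lemma homs_eq (P : {set aT}) (H : {set hT}) (f g : {ffun aT -> hT}) :
  f \in homs P H -> g \in homs P H -> {in P, f =1 g} -> f = g.
Proof. by move=> hf hg fg; rewrite -(rs_id hf) -(rs_id hg); apply: eq_rs. Qed.

Lemma ishom_sub (P Q : {set aT}) (H : {set hT}) f :
  P \subset Q -> ishom Q H f -> ishom P H f.
Proof.
move=> /subsetP sPQ [fH fM]; split=> [u /sPQ/fH//|u v /sPQ Qu /sPQ Qv]; exact: fM.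
Qed.

Lemma ishom1 (P : {group aT}) (H : {set hT}) f : ishom P H f -> f 1 = 1.
Proof.
case=> _ fM; apply: (mulgI (f 1)).
by rewrite -fM ?group1 // !mulg1.
Qed.

Lemma ishomV (P : {group aT}) (H : {set hT}) f :
  ishom P H f -> {in P, {morph f : u / u^-1}}.
Proof.
move=> hf u Pu; apply: (mulgI (f u)); rewrite mulgV.
by case: (hf) => _ <-; rewrite ?groupV // mulgV (ishom1 hf).
Qed.

Lemma morph_ishom (P : {group aT}) (H : {set hT}) (f : {morphism P >-> hT}) :
  f @* P \subset H -> ishom P H f.
Proof.
move=> /subsetP sfH; split=> [u Pu|u v Pu Pv]; last exact: morphM.
by apply: sfH; rewrite mem_morphim.
Qed.

End Homs.

Lemma ishom_id (aT : finGroupType) (P H : {set aT}) : P \subset H -> ishom P H id.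
Proof. by move=> /subsetP sPH; split. Qed.

Lemma ishom_comp (aT hT lT : finGroupType) (P : {set aT}) (H : {set hT})
    (L : {set lT}) f g : ishom P H f -> ishom H L g -> ishom P L (g \o f).
Proof.
move=> [fH fM] [gL gM]; split=> [u Pu|u v Pu Pv] /=; first exact/gL/fH.
by rewrite fM // gM ?fH.
Qed.

(** * Fixed points of a biset and the homomorphisms they determine *)

Section BisetMarks.
Variables (aT gT hT : finGroupType) (G : {group gT}) (H : {group hT}).

Definition bfix T (X : lfbiset G H T) (P : {set aT}) (a : aT -> hT) (b : aT -> gT)
    : {set T} :=
  [set z | [forall u in P, [&& a u \in H, b u \in G & lact X (a u) z == ract X z (b u)]]].

Definition bmark T (X : lfbiset G H T) P a b := #|bfix X P a b|.

Lemma bfixP T (X : lfbiset G H T) (P : {set aT}) a b z :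
  reflect {in P, forall u, [/\ a u \in H, b u \in G & lact X (a u) z = ract X z (b u)]}
          (z \in bfix X P a b).
Proof.
rewrite inE; apply: (iffP forall_inP) => [fz u /fz/and3P[? ? /eqP]//|fz u /fz[-> -> ->]].
by rewrite eqxx.
Qed.

Lemma bmark_iso T1 T2 (X : lfbiset G H T1) (Y : lfbiset G H T2) (P : {set aT}) a b :
  biset_iso X Y -> bmark X P a b = bmark Y P a b.
Proof.
case=> f [bf fl fr]; have fI := bij_inj bf.
rewrite /bmark -(card_imset _ fI); apply: eq_card => y.
case: bf => g fK gK; rewrite -[y]gK mem_imset //.
apply/bfixP/bfixP => fz u /fz [Ha Hb E]; split=> //.
  by rewrite -fl // E fr.
by apply: fI; rewrite fl // E fr.
Qed.

Lemma bmark_sum T1 T2 (X : lfbiset G H T1) (Y : lfbiset G H T2) (P : {set aT}) a b :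
  bmark (bsum X Y) P a b = (bmark X P a b + bmark Y P a b)%N.
Proof.
rewrite /bmark -!sum1_card big_sumType /=.
by congr addn; apply: eq_bigl => z; apply/bfixP/bfixP => fz u /fz [Ha Hb /= E];
  split=> //=; first [by case: E | by rewrite E].
Qed.

Lemma eq_bfix T (X : lfbiset G H T) (P : {set aT}) a a' b b' :
  {in P, a =1 a'} -> {in P, b =1 b'} -> bfix X P a b = bfix X P a' b'.
Proof.
move=> aa bb; apply/setP => z; apply/bfixP/bfixP => fz u Pu; case: (fz u Pu);
by rewrite aa ?bb.
Qed.

Lemma lact_inj T (X : lfbiset G H T) z :
  {in H &, forall h k, lact X h z = lact X k z -> h = k}.
Proof.
move=> h k Hh Hk E; apply: (mulIg k^-1); rewrite mulgV.
have Hhk : h * k^-1 \in H by rewrite groupM ?groupV.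
have E' : lact X (h * k^-1) (lact X k z) = lact X k z by rewrite -lactM // mulgKV.
by have := lact_free Hhk E'.
Qed.

(** Points z whose left orbit Hz is preserved by right multiplication by b(P). *)
Definition lstab T (X : lfbiset G H T) (P : {set aT}) (b : aT -> gT) : {set T} :=
  [set z | [forall u in P, [exists h in H, lact X h z == ract X z (b u)]]].

(** The h with h z = z b(u), unique by left freeness. The defaults are reached only off P or for z
    outside [lstab]. *)
Definition gam T (X : lfbiset G H T) (P : {set aT}) (b : aT -> gT) z : {ffun aT -> hT} :=
  [ffun u => if u \in P then odflt 1 [pick h in H | lact X h z == ract X z (b u)] else 1].

Lemma gamP T (X : lfbiset G H T) (P : {set aT}) (b : aT -> gT) z :
  z \in lstab X P b ->
  {in P, forall u, gam X P b z u \in H /\ lact X (gam X P b z u) z = ract X z (b u)}.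
Proof.
rewrite inE => /forall_inP fz u Pu; rewrite ffunE Pu.
case: pickP => [h /andP[Hh /eqP]//|no].
by case/exists_inP: (fz u Pu) => h Hh E; have := no h; rewrite Hh E.
Qed.

Lemma bfix_lstab T (X : lfbiset G H T) (P : {set aT}) a b :
  bfix X P a b \subset lstab X P b.
Proof.
apply/subsetP => z /bfixP fz; rewrite inE; apply/forall_inP => u /fz[Ha _ E].
by apply/exists_inP; exists (a u); rewrite ?E.
Qed.

(** Multiplicativity comes from z b(u) b(v) = gam(u) z b(v) = gam(u) gam(v) z and left freeness. *)
Lemma gam_homs T (X : lfbiset G H T) (P : {group aT}) (b : aT -> gT) z :
  ishom P G b -> z \in lstab X P b ->
  gam X P b z \in homs P H /\ z \in bfix X P (gam X P b z) b.
Proof.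
move=> [bG bM] sz; have gP := gamP sz.
split; last by apply/bfixP => u Pu; have [? ->] := gP u Pu; split=> //; apply: bG.
apply/homsP; split=> [|u /negbTE Pu]; last by rewrite ffunE Pu.
split=> [u /gP[]//|u v Pu Pv].
have [Hu Eu] := gP u Pu; have [Hv Ev] := gP v Pv; have [Huv Euv] := gP _ (groupM Pu Pv).
apply: (lact_inj (X := X) (z := z)) => //; first exact: groupM.
by rewrite Euv bM // ractM ?bG // lactM // -Eu Ev -lractA ?bG.
Qed.

Lemma bfix_uniq T (X : lfbiset G H T) (P : {set aT}) a a' b z :
  z \in bfix X P a b -> z \in bfix X P a' b -> {in P, a =1 a'}.
Proof.
move=> /bfixP fz /bfixP fz' u Pu; have [Ha _ E] := fz u Pu; have [Ha' _ E'] := fz' u Pu.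
by apply: (lact_inj (X := X) (z := z)); rewrite ?E ?E'.
Qed.

(** The sets [bfix X P c b], for [c] in [homs P H], partition [lstab X P b]: z lies in the one
    indexed by [gam X P b z] and in no other. *)
Lemma sum_bfix T (X : lfbiset G H T) (P : {group aT}) (b : aT -> gT) (E : {set T}) (B : pred {ffun aT -> hT}) :
  ishom P G b ->
  \sum_(c in homs P H | B c) #|E :&: bfix X P c b| =
  #|[set z in E :&: lstab X P b | B (gam X P b z)]|.
Proof.
move=> hb; rewrite -[RHS]sum1_card.
rewrite (partition_big (gam X P b) (fun c => (c \in homs P H) && B c)) /=.
  apply: eq_bigr => c /andP[hc Bc]; rewrite -sum1_card; apply: eq_bigl => z.
  rewrite !inE -andbA -andbA; congr andb; apply/idP/and3P.
    move=> fz; have sz: z \in lstab X P b by apply: (subsetP (bfix_lstab X P c b)); rewrite inE.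
    have [hg fg] := gam_homs hb sz.
    have Eg : gam X P b z = c.
      by apply: homs_eq hg hc _; apply: bfix_uniq fg _; rewrite inE.
    by rewrite Eg Bc eqxx; split=> //; move: sz; rewrite inE.
  case=> sz Bg /eqP <-; have sz' : z \in lstab X P b by rewrite inE.
  by have [_] := gam_homs hb sz'; rewrite inE.
move=> z; rewrite inE => /andP[/setIP[_ sz] ->]; rewrite andbT.
by case: (gam_homs hb sz).
Qed.

End BisetMarks.

(** * Marks of composites and products *)

Section CompMarks.
Variables (aT gT hT lT : finGroupType).
Variables (G : {group gT}) (H : {group hT}) (L : {group lT}).

(** If the class of (x, y) is fixed at (a, c), then y determines a unique [b] with b(u) y = y c(u),
    and x is fixed at (a, b). Both sides count the pairs (x, y) representing fixed classes. *)
Lemma bmark_comp (T1 T2 : finType) (X : lfbiset H L T1) (Y : lfbiset G H T2)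
    (P : {group aT}) a c : {in P, forall u, a u \in L} -> ishom P G c ->
  (#|H| * bmark (bcomp X Y) P a c)%N =
  \sum_(b in homs P H) (bmark X P a b * bmark Y P b c)%N.
Proof.
move=> aL hc; have [cG _] := hc.
pose A := [set u : T1 * T2 | bpair X Y u.1 u.2 \in bfix (bcomp X Y) P a c].
have AP x y : reflect (exists2 b : {ffun aT -> hT}, b \in homs P H &
    (x \in bfix X P a b) && (y \in bfix Y P b c)) ((x, y) \in A).
  rewrite inE /=; apply: (iffP idP) => [/bfixP fxy|[b hb /andP[/bfixP fx /bfixP fy]]].
    have fxyE u : u \in P -> exists h, [/\ h \in H, lact X (a u) x = ract X x h & ract Y y (c u) = lact Y h y].
      move=> Pu; have [La Gc] := fxy u Pu.
      by rewrite lact_bpair // ract_bpair // => /bpairP[h Hh [-> ->]]; exists h.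
    have sy : y \in lstab Y P c.
      rewrite inE; apply/forall_inP => u Pu; have [h [Hh _ ->]] := fxyE u Pu.
      by apply/exists_inP; exists h.
    have [hb fb] := gam_homs hc sy.
    exists (gam Y P c y) => //; rewrite fb andbT; apply/bfixP => u Pu.
    have [Hg Eg] := gamP sy Pu; split=> //; first exact: aL.
    have [h [Hh -> Eh]] := fxyE u Pu; congr ract.
    by apply: (lact_inj (X := Y) (z := y)); rewrite // Eg.
  apply/bfixP => u Pu; split; [exact: aL | exact: cG | ].
  rewrite lact_bpair ?aL // ract_bpair ?cG //.
  have [_ Hb ->] := fx u Pu; have [_ _ <-] := fy u Pu.
  by apply/bpairP; exists (b u).
(* As H acts freely on Y, each fixed class has exactly |H| representatives. *)
transitivity #|A|.
  rewrite -[in RHS]sum1_card (partition_big (fun u => bpair X Y u.1 u.2) (mem (bfix (bcomp X Y) P a c))) /=; last first.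
    by move=> u; rewrite inE.
  rewrite mulnC -sum_nat_const; apply: eq_bigr => q qf.
  have [x [y /eqP Exy]] := bpair_surj q.
  rewrite sum1dep_card.
  rewrite -(card_in_imset (f := fun h => (ract X x h^-1, lact Y h y)) (D := H)).
    apply: eq_card => -[x' y']; rewrite [RHS]in_set [_ \in A]in_set /=; apply/imsetP/andP => [[h Hh [-> ->]]|].
      have E : bpair X Y (ract X x h^-1) (lact Y h y) = q.
        by rewrite -Exy; apply/esym/bpairP; exists h; rewrite // -ractM ?groupV // mulVg ract1.
      by rewrite E eqxx.
    case=> _ /eqP; rewrite -Exy => /esym/bpairP[h Hh [-> ->]]; exists h => //.
    by rewrite -ractM ?groupV // mulgV ract1.
  by move=> h k Hh Hk [_]; apply: lact_inj.
(* The union is disjoint, since [b] is recovered from y as [gam Y P c y]. *)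
have -> : A = \bigcup_(b in homs P H) setX (bfix X P a b) (bfix Y P b c).
  apply/setP => -[x y]; apply/AP/bigcupP => -[b hb fxy]; exists b => //.
    by rewrite inE.
  by move: fxy; rewrite inE.
rewrite -[LHS]sum1_card.
rewrite (partition_big (fun u => gam Y P c u.2) (mem (homs P H))) /=.
  apply: eq_bigr => b hb; rewrite sum1dep_card /bmark -cardsX; apply: eq_card => -[x y].
  rewrite [LHS]in_set [RHS]in_setX /=.
  apply/andP/andP => [[/bigcupP[b' hb' /setXP[fx fy]] /eqP Eg]|[fx fy]].
    have sy := subsetP (bfix_lstab Y P b' c) _ fy.
    have [hg fg] := gam_homs hc sy.
    by have <- : b' = b by rewrite -Eg; apply: homs_eq hb' hg _; apply: bfix_uniq fy fg.
  have sy := subsetP (bfix_lstab Y P b c) y fy.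
  have [hg fg] := gam_homs hc sy; split.
    by apply/bigcupP; exists b => //; apply/setXP.
  by apply/eqP; apply: homs_eq hg hb _; apply: bfix_uniq fg fy.
move=> [x y] /bigcupP[b hb /setXP[_ fy]] /=.
by have sy := subsetP (bfix_lstab Y P b c) _ fy; have [] := gam_homs hc sy.
Qed.

End CompMarks.

Lemma bmark_prod (aT gT1 gT2 hT1 hT2 : finGroupType) (G1 : {group gT1}) (G2 : {group gT2})
    (H1 : {group hT1}) (H2 : {group hT2}) (T1 T2 : finType) (X : lfbiset G1 H1 T1)
    (Y : lfbiset G2 H2 T2) (P : {set aT}) (a : aT -> hT1 * hT2) (b : aT -> gT1 * gT2) :
  bmark (bprod X Y) P a b =
  (bmark X P (fst \o a) (fst \o b) * bmark Y P (snd \o a) (snd \o b))%N.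
Proof.
rewrite /bmark -cardsX; apply: eq_card => -[x y]; rewrite [RHS]in_setX.
apply/bfixP/andP => [fz|[/bfixP fx /bfixP fy] u Pu].
  by split; apply/bfixP => u /fz; rewrite !inE => -[/andP[? ?] /andP[? ?] [? ?]].
have [? ? E1] := fx u Pu; have [? ? E2] := fy u Pu.
by split; [rewrite inE; apply/andP | rewrite inE; apply/andP | rewrite /= [lact X _ _]E1 [lact Y _ _]E2].
Qed.

Section HomComp.
Variables (aT gT hT lT : finGroupType).
Variables (K : {group gT}) (H : {group hT}) (L : {group lT}).
Variables (phi : {morphism K >-> hT}) (sphiH : phi @* K \subset H).

(** With [o] the class of (1, 1), every point of the composite is the class of (x, o) for a unique
    x, and o k = phi(k) o for k in K. *)
Lemma bmark_hom (T : finType) (X : lfbiset H L T) (P : {set aT}) a (b : aT -> gT) :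
  {in P, forall u, b u \in K} ->
  bmark (bcomp X (hombiset (subxx K) sphiH)) P a b = bmark X P a (phi \o b).
Proof.
move=> bK; set Y := hombiset _ _.
have phiH k : k \in K -> phi k \in H by move=> Kk; apply: (subsetP sphiH); rewrite mem_morphim.
pose o := hpair (subxx K) sphiH (1, 1).
have oK k : k \in K -> ract Y o k = lact Y (phi k) o.
  move=> Kk; rewrite ract_hpair // lact_hpair ?phiH //; apply/esym/hpairP; exists k => //=.
  by rewrite !mulg1 !mul1g.
have oS q : exists2 h, h \in H & q = lact Y h o.
  have [[s t] /eqP <-] := hpair_surj q.
  have -> : hpair (subxx K) sphiH (s, t) = lact Y (val s) (ract Y o (val t)).
    by rewrite ract_hpair ?subgP // lact_hpair ?subgP //= !sgvalK mulg1 mul1g.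
  by rewrite oK ?subgP // -lactM ?phiH ?subgP //; exists (val s * phi (val t)); rewrite ?groupM ?phiH ?subgP.
pose f x := bpair X Y x o.
have fI : injective f.
  by move=> x x' /bpairP[h Hh [-> /esym/(lact_free Hh)->]]; rewrite ract1.
have fS q : exists x, q = f x.
  have [x [y /eqP <-]] := bpair_surj q; have [h Hh ->] := oS y.
  by exists (ract X x h); apply/esym/bpairP; exists h.
rewrite /bmark -(card_imset _ fI); apply: eq_card => q; have [x ->] := fS q.
rewrite mem_imset //; apply/bfixP/bfixP => fz u Pu; have [La _] := fz u Pu.
  rewrite lact_bpair // ract_bpair ?bK // oK ?bK // => E; split; rewrite ?phiH ?bK //.
  by apply: fI; rewrite /f E; apply/esym/bpairP; exists (phi (b u)); rewrite ?phiH ?bK.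
move=> E; split=> //; first exact: bK.
rewrite lact_bpair // ract_bpair ?bK // oK ?bK // E.
by apply/bpairP; exists (phi (b u)); rewrite ?phiH ?bK.
Qed.

End HomComp.

Lemma acts_onI (aT : finGroupType) (D : {group aT}) (rT : finType) (to : action D rT)
    (A : {set aT}) (S : {set rT}) : A \subset D ->
  (forall a x, a \in A -> x \in S -> to x a \in S) -> [acts A, on S | to].
Proof.
move=> sAD h; apply/subsetP => a Aa; rewrite inE (subsetP sAD) // inE.
by apply/subsetP => x Sx; rewrite inE h.
Qed.

(** * Congruences from the action of H x N on a biset *)

Section BisetAction.
Variables (aT gT hT : finGroupType) (G : {group gT}) (H : {group hT}).
Variables (T : finType) (X : lfbiset G H T) (N : {group aT}) (b : aT -> gT).
Hypothesis hb : ishom N G b.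
Local Notation HN := (setX H N).

Let bG u : u \in N -> b u \in G. Proof. by case: hb => bG _; apply: bG. Qed.
Let bM : {in N &, {morph b : u v / u * v}}. Proof. by case: hb. Qed.

(** The inverse turns the left action of H into a right action; (h, u) fixes z exactly when h z = z
    b(u) ([bact_fixE]). *)
Definition bact (z : T) (w : hT * aT) : T :=
  if w \in HN then lact X w.1^-1 (ract X z (b w.2)) else z.

Lemma bactE z h u : h \in H -> u \in N -> bact z (h, u) = lact X h^-1 (ract X z (b u)).
Proof. by move=> Hh Nu; rewrite /bact inE Hh Nu. Qed.

Lemma bact_is_action : is_action HN bact.
Proof.
split=> [[h u] x y|x [h u] [k v] /setXP[/= Hh Nu] /setXP[/= Hk Nv]].
  rewrite /bact; case: ifP => // /setXP[/= Hh Nu].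
  move/(congr1 (fun z => ract X (lact X h z) (b u)^-1)).
  by rewrite -!lactM ?groupV // mulgV !lact1 -!ractM ?groupV ?bG // mulgV !ract1.
rewrite !bactE ?groupM // invMg bM // lactM ?groupV // ractM ?bG //.
by rewrite lractA ?groupV ?bG.
Qed.

Canonical bact_action := Action bact_is_action.

Lemma bact_fixE z h u : h \in H -> u \in N ->
  (bact z (h, u) == z) = (lact X h z == ract X z (b u)).
Proof.
move=> Hh Nu; rewrite bactE //; apply/eqP/eqP => [{1}<-|<-].
  by rewrite -lactM ?groupV // mulgV lact1.
by rewrite -lactM ?groupV // mulVg lact1.
Qed.

End BisetAction.

Section Congruence.
Variables (aT gT hT : finGroupType) (G : {group gT}) (H : {group hT}).
Variables (T : finType) (X : lfbiset G H T).

Lemma bfix_bact (P : {group aT}) (N : {group aT}) (a : aT -> hT) (b : aT -> gT) z h u :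
  P <| N -> ishom N G b -> h \in H -> u \in N -> z \in bfix X P a b ->
  bact X N b z (h, u) \in bfix X P (fun v => a (v ^ u^-1) ^ h) b.
Proof.
move=> /andP[sPN /subsetP nPN] [bG bM] Hh Nu /bfixP fz.
have nPu v : v \in P -> v ^ u^-1 \in P by move=> Pv; rewrite memJ_norm // groupV nPN.
apply/bfixP => v Pv; have Nv := subsetP sPN v Pv.
have [Ha _ E] := fz _ (nPu _ Pv).
split; [by rewrite groupJ | exact: bG | rewrite bactE //].
rewrite [a _ ^ h]conjgE mulgA -lactM ?groupM ?groupV // mulgK lactM ?groupV // -lractA ?bG // E.
rewrite lractA ?groupV ?bG // -!ractM ?bG ?groupM ?groupV // -!bM ?groupM ?groupV //.
by congr (lact _ _ (ract _ _ (b _))); rewrite conjgE invgK -mulgA mulgKV.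
Qed.

Lemma gam_bact (P : {group aT}) (N : {group aT}) (b : aT -> gT) z h u :
  P <| N -> ishom N G b -> h \in H -> u \in N -> z \in lstab X P b ->
  bact X N b z (h, u) \in lstab X P b /\
  gam X P b (bact X N b z (h, u)) = rs P (fun v => (gam X P b z (v ^ u^-1)) ^ h).
Proof.
move=> nPN hb Hh Nu sz; have /andP[sPN /subsetP nPN'] := nPN.
have hbP : ishom P G b := ishom_sub sPN hb.
have [hg fg] := gam_homs hbP sz.
have nPu v : v \in P -> v ^ u^-1 \in P by move=> Pv; rewrite memJ_norm // groupV nPN'.
have hf : ishom P H (fun v => (gam X P b z (v ^ u^-1)) ^ h).
  have [gH gM] := homs_ishom hg.
  split=> [v Pv|v w Pv Pw]; first by rewrite groupJ // gH ?nPu.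
  by rewrite conjMg gM ?nPu // conjMg.
have fz := bfix_bact nPN hb Hh Nu fg.
have sz' := subsetP (bfix_lstab X P _ b) _ fz.
split=> //; have [hg' fg'] := gam_homs hbP sz'.
apply: homs_eq hg' (rs_homs hf) _ => v Pv; rewrite rsE //.
by apply: bfix_uniq fg' fz v Pv.
Qed.

Lemma gam_rs (P Q : {group aT}) (b : aT -> gT) z : P \subset Q -> ishom Q G b ->
  z \in lstab X Q b -> z \in lstab X P b /\ rs P (gam X Q b z) = gam X P b z.
Proof.
move=> sPQ hb sz; have [hg fg] := gam_homs hb sz.
have fg' : z \in bfix X P (gam X Q b z) b.
  by apply/bfixP => u Pu; move/bfixP: fg; apply; apply: (subsetP sPQ).
have sz' := subsetP (bfix_lstab X P _ b) _ fg'.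
split=> //; have [hg' fg''] := gam_homs (ishom_sub sPQ hb) sz'.
apply: homs_eq (rs_homs (ishom_sub sPQ (homs_ishom hg))) hg' _ => u Pu; rewrite rsE //.
exact: bfix_uniq fg' fg'' u Pu.
Qed.

Variable p : nat.
Hypotheses (p_prime : prime p) (pH : p.-group H).

Section Normal.
Variables (P Q : {group aT}) (b : aT -> gT) (B : pred {ffun aT -> hT}).
Hypotheses (pQ : p.-group Q) (nPQ : P <| Q) (hb : ishom Q G b).
Hypothesis BJ : forall a h u, a \in homs P H -> h \in H -> u \in Q -> B a ->
  B (rs P (fun v => (a (v ^ u^-1)) ^ h)).

Let sPQ : P \subset Q. Proof. exact: normal_sub. Qed.
Let to := bact_action X hb.
Let A := setX H Q.
Let Z := [set z in lstab X P b | B (gam X P b z)].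

Let actsZ : [acts A, on Z | to].
Proof.
apply: acts_onI => // -[h u] z /setXP[/= Hh Qu]; rewrite !inE => /andP[sz Bz].
have sz' : z \in lstab X P b by rewrite inE.
have [] := gam_bact nPQ hb Hh Qu sz'; rewrite inE => -> Eg /=.
by rewrite [gam _ _ _ _]Eg BJ //; have [] := gam_homs (ishom_sub sPQ hb) sz'.
Qed.

Let orbH z : z \in Z -> [set lact X h z | h in H] \subset orbit to A z.
Proof.
move=> _; apply/subsetP => _ /imsetP[h Hh ->]; apply/orbitP; exists (h^-1, 1).
  by apply/setXP; rewrite groupV.
by rewrite /= bactE ?groupV // invgK (ishom1 hb) ract1.
Qed.

Let cardHz z : #|[set lact X h z | h in H]| = #|H|.
Proof. by apply: card_in_imset => h k; apply: lact_inj. Qed.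

Let pA : p.-group A. Proof. by rewrite /pgroup cardsX pnatM; apply/andP. Qed.

Let orb_pow z : exists k, #|orbit to A z| = (p ^ k)%N.
Proof.
have : p.-nat #|orbit to A z|.
  apply: pnat_dvd pA; rewrite -(card_orbit_in_stab to z (subxx A)); exact: dvdn_mulr.
by case/p_natP=> k ->; exists k.
Qed.

Let Hpow : exists k, #|H| = (p ^ k)%N.
Proof. by have /p_natP[k ->] : p.-nat #|H| by []; exists k. Qed.

(** Every H x Q-orbit has p-power size and contains a free H-orbit, hence its size is a multiple of
    |H|. *)
Lemma sum_bmark_dvd : (#|H| %| \sum_(a in homs P H | B a) bmark X P a b)%N.
Proof.
have -> : \sum_(a in homs P H | B a) bmark X P a b = #|Z|.
  have := sum_bfix X setT B (ishom_sub sPQ hb); rewrite setTI => <-.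
  by apply: eq_bigr => a _; rewrite setTI.
rewrite -(acts_sum_card_orbit actsZ); apply: dvdn_sum => _ /imsetP[z Zz ->].
have := subset_leq_card (orbH Zz); rewrite cardHz.
have [k ->] := orb_pow z; have [l ->] := Hpow.
by rewrite leq_exp2l ?prime_gt1 // => le; apply: dvdn_exp2l.
Qed.

(* H x Q acts on X with orbits of p-power size at least |H|, and the orbits of *)
(* size exactly |H| are those contained in lstab X Q b.                        *)
Lemma sum_bmark_mod :
  \sum_(a in homs P H | B a) bmark X P a b =
  \sum_(c in homs Q H | B (rs P c)) bmark X Q c b %[mod p * #|H|].
Proof.
pose Z' := Z :&: lstab X Q b.
have -> : \sum_(a in homs P H | B a) bmark X P a b = #|Z|.
  have := sum_bfix X setT B (ishom_sub sPQ hb); rewrite setTI => <-.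
  by apply: eq_bigr => a _; rewrite setTI.
have -> : \sum_(c in homs Q H | B (rs P c)) bmark X Q c b = #|Z'|.
  transitivity #|[set z in setT :&: lstab X Q b | B (rs P (gam X Q b z))]|.
    rewrite -(sum_bfix X setT (fun c => B (rs P c)) hb).
    by apply: eq_bigr => a _; rewrite setTI.
  rewrite setTI; apply: eq_card => z; rewrite [LHS]in_set in_setI [z \in Z]in_set.
  case: (boolP (z \in lstab X Q b)) => [sz|_]; last by rewrite andbF.
  by have [-> ->] := gam_rs sPQ hb sz; rewrite andbT.
have actsZ' : [acts A, on Z :\: Z' | to].
  apply: acts_onI => // -[h u] z Ahu /setDP[Zz nZz].
  have /setXP[/= Hh Qu] := Ahu.
  apply/setDP; split; first by rewrite (acts_act actsZ).
  apply: contra nZz => /setIP[_ sz]; rewrite in_setI Zz /=.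
  have [] := gam_bact (normal_refl Q) hb (groupVr Hh) (groupVr Qu) sz.
  by rewrite -[bact _ _ _ _ _]/(to (to z (h, u)) ((h, u)^-1)) actKin.
rewrite -(cardsID Z' Z) (setIidPr (subsetIl _ _)); apply/eqP.
rewrite -[X in _ == X %[mod _]]addn0 eqn_modDl mod0n -/(dvdn _ _).
rewrite -(acts_sum_card_orbit actsZ'); apply: dvdn_sum => _ /imsetP[z /setDP[Zz nZ'z] ->].
have sub := orbH Zz.
have lt : (#|H| < #|orbit to A z|)%N.
  rewrite -(cardHz z); apply: proper_card; rewrite properE sub /=.
  apply: contra nZ'z => sub'; rewrite in_setI Zz inE; apply/forall_inP => u Qu.
  have : to z (1, u) \in orbit to A z by apply: mem_orbit; apply/setXP.
  move/(subsetP sub')/imsetP => [h Hh]; rewrite /= bactE // invg1 lact1 => ->.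
  by apply/exists_inP; exists h.
move: lt; have [k ->] := orb_pow z; have [l ->] := Hpow.
by rewrite ltn_exp2l ?prime_gt1 // => lt; rewrite -expnS; apply: dvdn_exp2l.
Qed.

End Normal.
End Congruence.

Lemma sum_cardI (I T : finType) (N : {set I}) (S : {set T}) (F : I -> {set T}) :
  (\sum_(u in N) #|S :&: F u| = \sum_(z in S) #|[set u in N | z \in F u]|)%N.
Proof.
transitivity (\sum_(u in N) \sum_(z in S) (z \in F u))%N.
  apply: eq_bigr => u _; rewrite -sum1_card big_mkcond [RHS]big_mkcond /=.
  by apply: eq_bigr => z _; rewrite inE; case: (z \in S); case: (z \in F u).
rewrite exchange_big; apply: eq_bigr => z _; rewrite -sum1_card big_mkcond [RHS]big_mkcond /=.
by apply: eq_bigr => u _; rewrite inE; case: (u \in N); case: (z \in F u).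
Qed.

(** * Divisibility from orbit counting *)

Section Transporter.
Variables (aT hT : finGroupType) (H : {group hT}) (P N : {group aT}) (a : aT -> hT).
Hypothesis nPN : P <| N.

Let nPu u v : u \in N -> v \in P -> v ^ u \in P.
Proof. by move=> Nu Pv; rewrite memJ_norm // (subsetP (normal_norm nPN)). Qed.

(* The pairs (h, u) conjugating the graph of a to itself.                      *)
Definition gnorm : {set hT * aT} :=
  [set w in setX H N | [forall u in P, a (u ^ w.2^-1) == a u ^ w.1^-1]].

Lemma gnormP h u :
  reflect [/\ h \in H, u \in N & {in P, forall v, a (v ^ u^-1) = a v ^ h^-1}]
          ((h, u) \in gnorm).
Proof.
rewrite !inE /= -andbA; apply: (iffP and3P) => [[-> -> /forall_inP f]|[-> -> f]].
  by split=> // v /f/eqP.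
by split=> //; apply/forall_inP => v /f ->.
Qed.

Lemma gnorm_group_set : group_set gnorm.
Proof.
apply/group_setP; split=> [|[h u] [k w] /gnormP[Hh Nu hu] /gnormP[Hk Nw kw]].
  by apply/gnormP; split=> // v _; rewrite !invg1 !conjg1.
apply/gnormP; split; [exact: groupM | exact: groupM |] => v Pv.
by rewrite !invMg !conjgM hu ?kw // nPu ?groupV.
Qed.
Canonical gnorm_group := Group gnorm_group_set.

(** The fibre of the projection to N over u is a left coset of the centraliser of a(P) in H. *)
Lemma card_gnorm :
  (forall u, u \in N -> exists2 h, h \in H & {in P, forall v, a (v ^ u^-1) = a v ^ h^-1}) ->
  #|gnorm| = (#|N| * #|'C_H(a @: P)|)%N.
Proof.
move=> ex; rewrite -[LHS]sum1_card (partition_big snd (mem N)) /=; last first.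
  by case=> h u /gnormP[].
rewrite -sum_nat_const; apply: eq_bigr => u Nu.
have [h0 Hh0 h0E] := ex u Nu.
rewrite sum1dep_card -(card_lcoset _ h0).
rewrite -(card_in_imset (f := fst) (D := [set x in gnorm | x.2 == u])); last first.
  by move=> [h v] [h' v']; rewrite !in_set /= => /andP[_ /eqP->] /andP[_ /eqP->] /= ->.
apply: eq_card => h; rewrite mem_lcoset; apply/imsetP/setIP => [[[h' u'] ]|[Hh0h Ch]].
  rewrite in_set => /andP[/gnormP[Hh' _ hE] /eqP/= Eu ->]; subst u'.
  split; first by rewrite groupM ?groupV.
  apply/centP => _ /imsetP[v Pv ->]; apply/commute_sym/commgP/conjg_fixP.
  by rewrite conjgM -h0E // hE // conjgKV.
exists (h, u) => //; rewrite in_set eqxx andbT; apply/gnormP; split=> //.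
  by rewrite -[h](mulKVg h0) groupM.
move=> v Pv; rewrite h0E // -[h](mulKVg h0) invMg conjgM; congr (_ ^ _).
have := centP Ch (a v) (imset_f _ Pv) => cc; symmetry; apply/conjg_fixP/commgP.
by apply: commuteV; apply: commute_sym.
Qed.

End Transporter.

Section Cauchy.
Variables (aT gT hT : finGroupType) (G : {group gT}) (H : {group hT}).
Variables (T : finType) (X : lfbiset G H T).
Variables (P N : {group aT}) (a : aT -> hT) (b : aT -> gT).
Hypotheses (nPN : P <| N) (hb : ishom N G b).

Let sPN : P \subset N. Proof. exact: normal_sub. Qed.

(** The v in N with z b(v) in Hz form a subgroup, which contains P by assumption; only the generator
    u remains to be tested. *)
Lemma lstab_gen u z : u \in N -> z \in lstab X P b ->
  (z \in lstab X <<u |: P>> b) = [exists h in H, lact X h z == ract X z (b u)].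
Proof.
move=> Nu sz; have [bG bM] := hb.
apply/idP/idP => [|ex].
  by rewrite inE => /forall_inP; apply; rewrite mem_gen // setU11.
pose D := [set v in N | [exists h in H, lact X h z == ract X z (b v)]].
have gD : group_set D.
  apply/group_setP; split=> [|v w].
    rewrite inE group1; apply/exists_inP; exists 1 => //.
    by rewrite lact1 (ishom1 hb) ract1.
  rewrite !inE => /andP[Nv /exists_inP[h Hh /eqP hE]] /andP[Nw /exists_inP[k Hk /eqP kE]].
  rewrite groupM //; apply/exists_inP; exists (h * k); rewrite ?groupM //.
  by rewrite bM // ractM ?bG // -hE lactM // kE lractA ?bG.
have sD : <<u |: P>> \subset Group gD.
  rewrite gen_subG subUset sub1set inE Nu ex /=; apply/subsetP => v Pv.
  by rewrite inE (subsetP sPN) //=; move: sz; rewrite inE => /forall_inP; apply.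
by rewrite inE; apply/forall_inP => v /(subsetP sD); rewrite inE => /andP[].
Qed.

(** The Cauchy-Frobenius formula for [gnorm] acting on the points fixed at (a, b). A pair (h, u)
    fixes z when h z = z b(u), so h is determined by u and z, and the pairs fixing z correspond to
    the u such that z lies in [lstab] of the group generated by u and P. Such a z singles out one
    extension [c] of [a] to that group. *)
Lemma bmark_cauchy :
  (#|gnorm H P N a| %| \sum_(u in N) \sum_(c in homs <<u |: P>> H | [forall v in P, c v == a v])
     bmark X <<u |: P>> c b)%N.
Proof.
pose to := bact_action X hb; pose S := bfix X P a b; pose W := gnorm_group H a nPN.
have sPS z : z \in S -> z \in lstab X P b by apply: subsetP; apply: bfix_lstab.
have actsW : [acts W, on S | to].
  apply: acts_onI => [|[h u] z /gnormP[Hh Nu E] Sz]; first by apply/subsetP => w; rewrite inE => /andP[].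
  have := bfix_bact nPN hb Hh Nu Sz; rewrite (@eq_bfix _ _ _ _ _ _ X P _ a b b) // => v Pv.
  by rewrite E // conjgKV.
have -> : (\sum_(u in N) \sum_(c in homs <<u |: P>> H | [forall v in P, c v == a v])
     bmark X <<u |: P>> c b)%N = (\sum_(u in N) #|S :&: lstab X <<u |: P>> b|)%N.
  apply: eq_bigr => u Nu; have sub : <<u |: P>> \subset N by rewrite gen_subG subUset sub1set Nu.
  have hbu := ishom_sub sub hb; have sPu : P \subset <<u |: P>> by rewrite sub_gen // subsetUr.
  transitivity #|[set z in setT :&: lstab X <<u |: P>> b | [forall v in P, gam X <<u |: P>> b z v == a v]]|.
    rewrite -(sum_bfix X setT (fun c : {ffun aT -> hT} => [forall v in P, c v == a v]) hbu).
    by apply: eq_bigr => c _; rewrite setTI.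
  rewrite setTI; apply: eq_card => z; rewrite [LHS]in_set in_setI andbC.
  case: (boolP (z \in lstab X <<u |: P>> b)) => [sz|_]; last by rewrite !andbF.
  have [hg fg] := gam_homs hbu sz; rewrite !andbT.
  have fg' : z \in bfix X P (gam X <<u |: P>> b z) b.
    by apply/bfixP => v Pv; move/bfixP: fg; apply; apply: (subsetP sPu).
  apply/forall_inP/idP => [gE|fz v Pv]; last by rewrite (bfix_uniq fg' fz).
  by move: fg'; rewrite (@eq_bfix _ _ _ _ _ _ X P _ a b b) // => v /gE/eqP.
have -> : (\sum_(u in N) #|S :&: lstab X <<u |: P>> b|)%N = (\sum_(w in W) #|'Fix_(S | to)[w]|)%N.
  transitivity (\sum_(z in S) #|[set u in N | z \in lstab X <<u |: P>> b]|)%N.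
    exact: sum_cardI.
  transitivity (\sum_(z in S) #|[set w in W | to z w == z]|)%N; last first.
    rewrite sum_cardI; apply: eq_bigr => z Sz; apply: eq_card => w.
    by rewrite [LHS]in_set [RHS]in_set (sameP afix1P eqP).
  apply: eq_bigr => z Sz; rewrite -(card_in_imset (f := snd) (D := [set w in W | to z w == z])).
    apply: eq_card => u; rewrite in_set; apply/andP/imsetP => [[Nu]|[[h u']]].
      rewrite lstab_gen ?sPS // => /exists_inP[h Hh E].
      exists (h, u) => //; rewrite in_set [to _ _ == _]bact_fixE // E andbT.
      apply/gnormP; split=> // v Pv.
      have := bfix_bact nPN hb Hh Nu Sz; rewrite [bact _ _ _ _ _](eqP (_ : _ == z)) ?bact_fixE //.
      by move=> fz; rewrite (bfix_uniq Sz fz Pv) conjgK.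
    rewrite in_set => /andP[/gnormP[Hh Nu _] fz ->] /=; split=> //.
    rewrite lstab_gen ?sPS //; apply/exists_inP; exists h => //.
    by rewrite -(@bact_fixE _ _ _ _ _ _ X N).
  move=> [h u] [h' u']; rewrite 2!(in_set (fun w => _ && (to z w == z))).
  move=> /andP[/gnormP[Hh Nu _] fz] /andP[/gnormP[Hh' Nu' _] fz'] /= Eu.
  move: fz fz'; rewrite -Eu [to _ _ == _]bact_fixE // [to _ _ == _]bact_fixE -?Eu //.
  by move=> /eqP E /eqP E'; congr (_, _); apply: (lact_inj (X := X) (z := z)); rewrite ?E ?E'.
by rewrite (Frobenius_Cauchy actsW) dvdn_mull.
Qed.

End Cauchy.

(** * Transitive bisets *)

Section HomMarks.
Variables (gT hT : finGroupType) (G : {group gT}) (H : {group hT}).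
Variables (K : {group gT}) (al : {morphism K >-> hT}).
Hypotheses (sKG : K \subset G) (saH : al @* K \subset H).
Local Notation E := (hombiset sKG saH).

Let aH k : k \in K -> al k \in H.
Proof. by move=> Kk; apply: (subsetP saH); rewrite mem_morphim. Qed.
Let KG k : k \in K -> k \in G. Proof. exact: (subsetP sKG). Qed.

(** The pairs (s, t) whose translation carries the graph of [c] on Q into the graph of [al]. *)
Definition subconj (Q : {set gT}) (c : gT -> hT) : {set hT * gT} :=
  [set w in setX H G | [forall q in Q, (q ^ w.2^-1 \in K) && (c q == al (q ^ w.2^-1) ^ w.1^-1)]].

Lemma subconjP (Q : {set gT}) (c : gT -> hT) s t :
  reflect [/\ s \in H, t \in G & {in Q, forall q, q ^ t^-1 \in K /\ c q = al (q ^ t^-1) ^ s^-1}]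
          ((s, t) \in subconj Q c).
Proof.
rewrite !inE /= -andbA; apply: (iffP and3P) => [[-> -> /forall_inP f]|[-> -> f]].
  by split=> // v /f/andP[? /eqP].
by split=> //; apply/forall_inP => v /f[-> ->] /=.
Qed.

Lemma hpair_bfix (Q : {set gT}) (c : gT -> hT) u : {in Q, forall q, c q \in H} -> Q \subset G ->
  (hpair sKG saH u \in bfix E Q c id) = ((val u.1, val u.2) \in subconj Q c).
Proof.
move=> cH /subsetP sQG; case: u => s t /=.
apply/bfixP/subconjP => [fz|[_ _ f] q Qq].
  split; rewrite ?subgP // => q Qq; have [Hc Gq] := fz q Qq.
  rewrite lact_hpair // ract_hpair // => /hpairP[k Kk /= [E1 E2]].
  have -> : q ^ (val t)^-1 = k.
    move/(congr1 val): E2; rewrite /= !subgK ?(KG Kk) // => E2.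
    by rewrite conjgE invgK mulgA E2 mulgK.
  split=> //; move/(congr1 val): E1; rewrite /= !subgK ?(aH Kk) // => E1.
  by rewrite conjgE invgK mulgA -E1 mulgK.
have [Kq cE] := f q Qq; split; [exact: cH | exact: sQG |].
rewrite lact_hpair ?cH // ract_hpair ?sQG //; apply/hpairP.
exists (q ^ (val t)^-1) => //=; split; apply: val_inj; rewrite /= !subgK ?(KG Kq) ?(aH Kq) ?cH ?sQG //.
  by rewrite cE conjgE invgK -mulgA mulgKV.
by rewrite conjgE invgK -mulgA mulgKV.
Qed.

(** The class of (s, t) is fixed at (c, id) exactly when (s, t) lies in [subconj] ([hpair_bfix]),
    and each class has |K| representatives. *)
Lemma card_subconj (Q : {set gT}) (c : gT -> hT) : {in Q, forall q, c q \in H} -> Q \subset G ->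
  #|subconj Q c| = (#|K| * bmark E Q c id)%N.
Proof.
move=> cH sQG.
pose A := [set u | hpair sKG saH u \in bfix E Q c id].
have -> : #|subconj Q c| = #|A|.
  rewrite -(card_in_imset (f := fun u : [subg H] * [subg G] => (val u.1, val u.2)) (D := A)).
    apply: eq_card => -[s t]; apply/idP/imsetP => [st|[u Au ->]].
      have /subconjP[Hs Gt _] := st.
      exists (subg H s, subg G t); last by rewrite /= !subgK.
      by rewrite in_set hpair_bfix //= !subgK.
    by move: Au; rewrite in_set hpair_bfix.
  by move=> [s t] [s' t'] _ _ /= [/val_inj -> /val_inj ->].
rewrite -[LHS]sum1_card (partition_big (hpair sKG saH) (mem (bfix E Q c id))) /=; last first.
  by move=> u; rewrite inE.
rewrite mulnC -sum_nat_const; apply: eq_bigr => q qf.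
have [[s t] /eqP Eu] := hpair_surj q.
rewrite sum1dep_card.
rewrite -(card_in_imset (f := fun k => (s * (subg H (al k))^-1, subg G k * t)) (D := K)).
  apply: eq_card => -[s' t']; rewrite [LHS]in_set [_ \in A]in_set; apply/andP/imsetP => [[_ /eqP]|[k Kk [-> ->]]].
    rewrite -Eu => /esym/hpairP[k Kk /= [-> ->]]; exists k => //.
    by rewrite mulgK.
  have Ek : hpair sKG saH (s * (subg H (al k))^-1, subg G k * t) = q.
    by rewrite -Eu; apply/esym/hpairP; exists k => //=; rewrite mulgKV.
  by rewrite Ek eqxx.
by move=> k l Kk Kl E; have /= /mulIg := congr1 (fun u => val u.2) E; rewrite !subgK ?KG.
Qed.

End HomMarks.

(** The translation (x, y) -> (x s^-1, t^-1 y) carries one defining relation to the other. *)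
Lemma hombiset_conj_iso (gT hT : finGroupType) (G : {group gT}) (H : {group hT})
    (K L : {group gT}) (al : {morphism K >-> hT}) (be : {morphism L >-> hT})
    (sKG : K \subset G) (saH : al @* K \subset H)
    (sLG : L \subset G) (sbH : be @* L \subset H) s t :
  s \in H -> t \in G -> L :^ t^-1 = K ->
  {in L, forall q, be q = al (q ^ t^-1) ^ s^-1} ->
  biset_iso (hombiset sKG saH) (hombiset sLG sbH).
Proof.
move=> Hs Gt LK bE.
have aH k : k \in K -> al k \in H.
  by move=> Kk; apply: (subsetP saH); rewrite mem_morphim.
have bH k : k \in L -> be k \in H.
  by move=> Kk; apply: (subsetP sbH); rewrite mem_morphim.
have KG k : k \in K -> k \in G by exact: (subsetP sKG).
have LG k : k \in L -> k \in G by exact: (subsetP sLG).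
apply: (@biset_iso_span _ _ _ _ ([subg H] * [subg G])%type _ _ _ _
  (fun h u => (subg H h * u.1, u.2)) (fun u k => (u.1, u.2 * subg G k))
  (hpair sKG saH) (fun u => hpair sLG sbH (u.1 * (subg H s)^-1, (subg G t)^-1 * u.2))).
- by move=> q; have [u] := hpair_surj q; exists u.
- move=> q; have [[x y] E] := hpair_surj q; exists (x * subg H s, subg G t * y).
  by rewrite /= mulgK mulKg.
- move=> [x y] [x' y'] /=; split=> /hpairP[k Kk /= [E1 E2]]; apply/hpairP.
    have Lk : k ^ t \in L by rewrite -mem_conjgV LK.
    have Gk := KG k Kk; have Gkt := LG _ Lk.
    exists (k ^ t) => //=; split.
      rewrite E1 -!mulgA; congr (_ * _); apply: val_inj.
      by rewrite /= !subgK ?bH ?aH // bE // conjgK conjgE invgK !mulgA mulVg mul1g.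
    rewrite E2 !mulgA; congr (_ * _); apply: val_inj.
    by rewrite /= !subgK // conjgE -!mulgA mulgV mulg1.
  have Kk' : k ^ t^-1 \in K by rewrite -LK memJ_conjg.
  have Gk := LG k Kk; have Gkt := KG _ Kk'.
  exists (k ^ t^-1) => //=; split.
    apply: (mulIg (subg H s)^-1); rewrite E1 -!mulgA; congr (_ * _); apply: val_inj.
    by rewrite /= !subgK ?bH ?aH // bE // conjgE invgK !mulgA mulVg mul1g.
  apply: (mulgI (subg G t)^-1); rewrite E2 !mulgA; congr (_ * _); apply: val_inj.
  by rewrite /= !subgK // conjgE invgK !mulgA mulVg mul1g.
- by move=> h Hh u; rewrite lact_hpair.
- by move=> h Hh u; rewrite ract_hpair.
- by move=> h Hh u; rewrite lact_hpair //= mulgA.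
- by move=> h Hh u; rewrite ract_hpair //= mulgA.
Qed.

(** * Decomposition into transitive bisets *)

Section SubBiset.
Variables (gT hT : finGroupType) (G : {group gT}) (H : {group hT}).
Variables (T : finType) (X : lfbiset G H T).

Section Sub.
Variables (A : {set T}).
Hypotheses (lA : forall h x, h \in H -> x \in A -> lact X h x \in A)
           (rA : forall x g, g \in G -> x \in A -> ract X x g \in A).

Let valA h (x : {x | x \in A}) : h \in H -> val (insubd x (lact X h (val x))) = lact X h (val x).
Proof. by move=> Hh; rewrite insubdK // -topredE /= lA // (valP x). Qed.
Let valR g (x : {x | x \in A}) : g \in G -> val (insubd x (ract X (val x) g)) = ract X (val x) g.
Proof. by move=> Hh; rewrite insubdK // -topredE /= rA // (valP x). Qed.

Definition subbiset : lfbiset G H {x | x \in A}.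
Proof.
apply: (@LFBiset gT hT G H {x | x \in A}
  (fun h x => insubd x (lact X h (val x))) (fun x g => insubd x (ract X (val x) g))).
- by move=> x; apply: val_inj; rewrite valA // lact1.
- by move=> h k Hh Hk x; apply: val_inj; rewrite !valA ?groupM // lactM.
- by move=> x; apply: val_inj; rewrite valR // ract1.
- by move=> h k Hh Hk x; apply: val_inj; rewrite !valR ?groupM // ractM.
- by move=> h g Hh Gg x; apply: val_inj; rewrite valR // !valA // valR // lractA.
- by move=> h Hh x /(congr1 val); rewrite valA //; apply: lact_free.
Defined.

Lemma lact_sub h x : h \in H -> val (lact subbiset h x) = lact X h (val x).
Proof. exact: valA. Qed.
Lemma ract_sub g x : g \in G -> val (ract subbiset x g) = ract X (val x) g.
Proof. exact: valR. Qed.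

End Sub.

Lemma biset_split (A : {set T})
   (lA : forall h x, h \in H -> x \in A -> lact X h x \in A)
   (rA : forall x g, g \in G -> x \in A -> ract X x g \in A)
   (lA' : forall h x, h \in H -> x \in ~: A -> lact X h x \in ~: A)
   (rA' : forall x g, g \in G -> x \in ~: A -> ract X x g \in ~: A) :
  biset_iso (bsum (subbiset lA rA) (subbiset lA' rA')) X.
Proof.
exists (fun z => match z with inl x => val x | inr y => val y end); split.
- have dec x : {x \in A} + {x \in ~: A}.
    by case: (boolP (x \in A)) => Ax; [left | right; rewrite inE].
  exists (fun x => match dec x with left p => inl (exist _ x p) | right q => inr (exist _ x q) end).
    case=> -[x Ax] /=; case: (dec x) => [p|q].
    + by congr inl; apply: val_inj.
    + by exfalso; move: q; rewrite inE Ax.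
    + by exfalso; move: (Ax); rewrite inE p.
    + by congr inr; apply: val_inj.
  by move=> x; case: (dec x).
- by move=> h Hh [x|y]; rewrite -lact_sub.
- by move=> g Gg [x|y]; rewrite -ract_sub.
Qed.

(** K is the stabiliser in G of the left orbit Hz, and [gam] on K is the homomorphism describing the
    orbit of z. *)
Lemma orbit_hombiset z (A : {set T})
   (lA : forall h x, h \in H -> x \in A -> lact X h x \in A)
   (rA : forall x g, g \in G -> x \in A -> ract X x g \in A) :
  z \in A -> (forall x, x \in A -> exists h g, [/\ h \in H, g \in G & x = lact X h (ract X z g)]) ->
  exists (K : {group gT}) (al : {morphism K >-> hT}) (sKG : K \subset G) (saH : al @* K \subset H),
    biset_iso (hombiset sKG saH) (subbiset lA rA).
Proof.
move=> Az oz.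
pose D := [set v in G | [exists h in H, lact X h z == ract X z v]].
have gD : group_set D.
  apply/group_setP; split=> [|v w].
    rewrite inE group1; apply/exists_inP; exists 1 => //.
    by rewrite lact1 ract1.
  rewrite !inE => /andP[Nv /exists_inP[h Hh /eqP hE]] /andP[Nw /exists_inP[k Hk /eqP kE]].
  rewrite groupM //; apply/exists_inP; exists (h * k); rewrite ?groupM //.
  by rewrite ractM // -hE lactM // kE lractA.
pose K := Group gD.
have sKG : K \subset G by apply/subsetP => v; rewrite inE => /andP[].
have sz : z \in lstab X K id.
  by rewrite inE; apply/forall_inP => v; rewrite inE => /andP[].
have hK : ishom K G id := ishom_id sKG.
have [hg /bfixP fg] := gam_homs hK sz.
have [gH gM] := homs_ishom hg.
pose al := Morphism gM.
have saH : al @* K \subset H by apply/subsetP => _ /morphimP[k Kk _ ->]; apply: gH.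
exists K, al, sKG, saH.
pose z' : {x | x \in A} := exist _ z Az.
apply: (@biset_iso_span _ _ _ _ ([subg H] * [subg G])%type _ _ _ _
  (fun h u => (subg H h * u.1, u.2)) (fun u k => (u.1, u.2 * subg G k))
  (hpair sKG saH) (fun u => lact (subbiset lA rA) (val u.1) (ract (subbiset lA rA) z' (val u.2)))).
- by move=> q; have [u] := hpair_surj q; exists u.
- move=> [x Ax]; have [h [g [Hh Gg E]]] := oz x Ax.
  exists (subg H h, subg G g); apply/eqP/val_inj.
  by rewrite lact_sub ?subgP // ract_sub ?subgP //= !subgK.
- move=> [x y] [x' y'] /=; split.
    case/hpairP => k Kk /= [-> ->]; have [Ha _ Ea] := fg k Kk; have Gk := subsetP sKG k Kk.
    apply: val_inj; rewrite !lact_sub ?groupM ?subgP // !ract_sub ?groupM ?subgP //=.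
    by rewrite !subgK // ractM ?subgP // -[ract X z k]Ea lactM ?subgP // lractA ?subgP.
  move/(congr1 val); rewrite !lact_sub ?subgP // !ract_sub ?subgP //= => E.
  have E2 : ract X z (val y' * (val y)^-1) = lact X ((val x')^-1 * val x) z.
    rewrite ractM ?groupV ?subgP //.
    have -> : ract X z (val y') = lact X ((val x')^-1 * val x) (ract X z (val y)).
      by rewrite lactM ?groupV ?subgP // [lact X (val x) _]E -lactM ?groupV ?subgP // mulVg lact1.
    by rewrite lractA ?groupM ?groupV ?subgP // -ractM ?groupV ?subgP // mulgV ract1.
  have Hh : (val x')^-1 * val x \in H by rewrite groupM ?groupV ?subgP.
  have Gg : val y' * (val y)^-1 \in G by rewrite groupM ?groupV ?subgP.
  have Kk : val y' * (val y)^-1 \in K.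
    by rewrite inE Gg; apply/exists_inP; exists ((val x')^-1 * val x); rewrite // E2.
  apply/hpairP; exists (val y' * (val y)^-1) => //=.
  have [Ha _ Ea] := fg _ Kk.
  have -> : gam X K id z (val y' * (val y)^-1) = (val x')^-1 * val x.
    by apply: (lact_inj (X := X) (z := z)); rewrite // Ea.
  split; apply: val_inj; rewrite /= !subgK // ?mulKVg //.
  by rewrite mulgKV.
- by move=> h Hh u; rewrite lact_hpair.
- by move=> h Hh u; rewrite ract_hpair.
- move=> h Hh [x y]; rewrite -[val _]/(val (subg H h) * val x) subgK //.
  by rewrite lactM ?subgP.
- move=> h Hh [x y]; pose Y := subbiset lA rA.
  change (lact Y (val x) (ract Y z' (val y * val (subg G h)))
          = ract Y (lact Y (val x) (ract Y z' (val y))) h); rewrite subgK //.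
  by rewrite ractM ?subgP // lractA ?subgP.
Qed.

End SubBiset.

(** Induction on the number of points: the orbit of one point under H and G is split off. *)
Lemma bclass_gen (gT hT : finGroupType) (G : {group gT}) (H : {group hT})
    (R : burnside G H -> Prop) :
  R 0%R -> (forall x y, R x -> R y -> R (x + y)%R) ->
  (forall (K : {group gT}) (al : {morphism K >-> hT}) (sKG : K \subset G) (saH : al @* K \subset H),
     R (hclass sKG saH)) ->
  forall (T : finType) (X : lfbiset G H T), R (bclass X).
Proof.
move=> R0 RD Rh T X; have [n] := ubnP #|T|.
elim: n T X => // n IH T X leT.
case: (pickP (mem (setT : {set T}))) => [z _|noT]; last first.
  have e0 (x : T) : False by have := noT x; rewrite /= inE.
  (* An empty biset is isomorphic to the sum of two copies of itself, so its class is 0. *)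
  suff -> : bclass X = 0%R by [].
  apply: (@addrI _ (bclass X)); rewrite addr0 -bclass_sum; apply: bclass_iso.
  exists (fun s => match s with inl x => x | inr x => x end); split=> [|h _ [x|x]|h _ [x|x]] //.
  by exists inl => [[x|x]|x]; case: (e0 x).
pose A := [set lact X u.1 (ract X z u.2) | u in setX H G].
have AP x : reflect (exists h g, [/\ h \in H, g \in G & x = lact X h (ract X z g)]) (x \in A).
  apply: (iffP imsetP) => [[[h g] /setXP[Hh Gg] ->]|[h [g [Hh Gg ->]]]].
    by exists h, g.
  by exists (h, g) => //; apply/setXP.
have lA h x : h \in H -> x \in A -> lact X h x \in A.
  move=> Hh /AP[k [g [Hk Gg ->]]]; apply/AP; exists (h * k), g.
  by rewrite groupM // lactM.
have rA x g : g \in G -> x \in A -> ract X x g \in A.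
  move=> Hh /AP[k [l [Hk Gg ->]]]; apply/AP; exists k, (l * g).
  by rewrite groupM // ractM // lractA.
have lA' h x : h \in H -> x \in ~: A -> lact X h x \in ~: A.
  move=> Hh; rewrite !inE; apply: contra => /(lA h^-1 _ (groupVr Hh)).
  by rewrite -lactM ?groupV // mulVg lact1.
have rA' x g : g \in G -> x \in ~: A -> ract X x g \in ~: A.
  move=> Hh; rewrite !inE; apply: contra => /(rA _ g^-1 (groupVr Hh)).
  by rewrite -ractM ?groupV // mulgV ract1.
rewrite -(bclass_iso (biset_split lA rA lA' rA')) bclass_sum.
have Az : z \in A by apply/AP; exists 1, 1; rewrite !group1 ract1 lact1.
apply: RD.
  have [|K [al [sKG [saH iso]]]] := @orbit_hombiset _ _ _ _ _ X z A lA rA Az.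
    by move=> x /AP.
  by rewrite -(bclass_iso iso); apply: Rh.
apply: IH; rewrite card_sig; apply: (leq_trans (n := #|T|)); last by rewrite -ltnS.
have -> : #|[pred x | x \in ~: A]| = #|~: A| by apply: eq_card.
rewrite -cardsT proper_card // properT; apply/eqP => AT.
by move: Az; rewrite -[A]setCK AT !inE.
Qed.

(** * Saturation from fully automized receptive subgroups *)

Lemma ishom_imgroup (aT hT : finGroupType) (P : {group aT}) (H : {set hT}) f : ishom P H f ->
  {R : {group hT} | R = f @: P :> {set hT}}.
Proof.
move=> [fH fM]; exists (Morphism fM @* P)%G.
by rewrite /= morphimEdom.
Qed.

Lemma conjVE (gT : finGroupType) (x u : gT) : x * u * x^-1 = u ^ x^-1.
Proof. by rewrite conjgE invgK mulgA. Qed.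

Section FusionMaps.
Variables (gT : finGroupType) (S : {group gT}) (F : fusion_system S).
Implicit Types (P Q R : {group gT}) (f g : gT -> gT).

(* f restricts to a morphism P -> S of the fusion system; P is a set so that   *)
(* images f @: P need no group structure.                                      *)
Definition inF (P : {set gT}) f : Prop :=
  exists (K : {group gT}) (phi : {morphism K >-> gT}),
    [/\ K = P :> {set gT}, fhom F S phi & {in P, phi =1 f}].

Lemma inFE P f : inF P f <-> exists phi : {morphism P >-> gT}, fhom F S phi /\ {in P, phi =1 f}.
Proof.
split=> [[K [phi [EK Fphi E]]]|[phi [Fphi E]]]; last by exists P, phi.
by have EKP : K = P by [apply: group_inj]; subst K; exists phi.
Qed.

Lemma fhom_inF P (phi : {morphism P >-> gT}) : fhom F S phi -> inF P phi.
Proof. by move=> Fphi; exists P, phi. Qed.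

Lemma inF_sub P f : inF P f -> P \subset S.
Proof. by case/inFE => phi [/fhom_sub[]]. Qed.

Lemma inF_ishom P f : inF P f -> ishom P S f.
Proof.
case/inFE => phi [/fhom_sub[_ _ _ im] E].
by apply: eq_ishom (morph_ishom im) => //; exact: groupM.
Qed.

Lemma inF_inj P f : inF P f -> {in P &, injective f}.
Proof.
case/inFE => phi [/fhom_sub[_ _ /injmP inj _] E] u v Pu Pv.
by rewrite -!E //; apply: inj.
Qed.

Lemma eq_inF P f g : {in P, f =1 g} -> inF P f -> inF P g.
Proof.
move=> fg /inFE[phi [Fphi E]]; apply/inFE; exists phi; split=> // u Pu.
by rewrite E ?fg.
Qed.

Lemma inF_conj P s : P \subset S -> s \in S -> inF P (fun u => u ^ s).
Proof.
move=> sPS Ss; apply/inFE; exists (conjgm_morphism P s); split=> [|u Pu] //=.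
apply: (@fhom_conj _ _ _ _ _ s^-1) => //; first by rewrite groupV.
  by move=> u Pu; rewrite invgK -mulgA -conjgE groupJ // (subsetP sPS).
by move=> u Pu; rewrite /= conjgmE conjgE invgK mulgA.
Qed.

Lemma inF_id P : P \subset S -> inF P id.
Proof. by move=> sPS; apply: eq_inF (inF_conj sPS (group1 S)) => u _; rewrite conjg1. Qed.

Lemma inF_comp P Q f g : inF P f -> inF Q g -> f @: P \subset Q -> inF P (g \o f).
Proof.
case/inFE => phi [Fphi Ef] /inFE[psi [Fpsi Eg]] sfPQ.
have [sPS _ inj im] := fhom_sub Fphi; have [sQS _ _ imQ] := fhom_sub Fpsi.
have EfP : phi @* P = f @: P by rewrite morphimEdom; apply: eq_in_imset.
have sub : phi @* P \subset Q by rewrite EfP.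
have incl : fhom F Q (idm (phi @* P)).
  apply: (@fhom_conj _ _ _ _ _ 1) => // u Pu; rewrite invg1 mulg1 mul1g ?(subsetP sub) //.
have FQ : fhom F Q phi by apply: (fhom_comp (proj1 (fhom_iso Fphi)) incl).
have hM : {in P &, {morph (psi \o phi) : u v / u * v}}.
  by move=> u v Pu Pv /=; rewrite !morphM // (subsetP sub) // mem_morphim.
apply/inFE; exists (Morphism hM); split=> [|u Pu /=].
  exact: (fhom_comp FQ Fpsi).
by rewrite Ef // Eg // (subsetP sfPQ) // imset_f.
Qed.

Lemma inF_res P Q f : Q \subset P -> inF P f -> inF Q f.
Proof.
move=> sQP Ff; have sPS := inF_sub Ff.
apply: (inF_comp (inF_id (subset_trans sQP sPS)) Ff).
by apply/subsetP => _ /imsetP[u Qu ->]; apply: (subsetP sQP).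
Qed.

Lemma inF_inv P R f : inF P f -> f @: P = R ->
  exists g, [/\ inF R g, {in P, cancel f g} & {in R, cancel g f}].
Proof.
move=> Ff ER; have [phi [Fphi E]] := (inFE P f).1 Ff.
have [sPS _ inj im] := fhom_sub Fphi.
have ERphi : phi @* P = R by rewrite -ER morphimEdom; apply: eq_in_imset.
have EG : (phi @* P)%G = R by apply: group_inj.
have FP : fhom F P (invm inj).
  by have [_ h] := fhom_iso Fphi; apply: (h (invm_morphism inj)) => u Pu; exact: invmE.
have incl : fhom F S (idm P).
  by apply: (@fhom_conj _ _ _ _ _ 1) => // u Pu; rewrite invg1 mulg1 mul1g ?(subsetP sPS).
have FS : fhom F S (invm inj) by apply: (fhom_comp FP incl).
exists (invm inj); split.
- by rewrite -ERphi; apply: fhom_inF FS.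
- by move=> u Pu; rewrite -E //; exact: (invmE inj Pu).
- move=> v; rewrite -ER => /imsetP[u Pu ->].
  by congr f; rewrite -E //; exact: (invmE inj Pu).
Qed.

Lemma inF_card P f : inF P f -> #|f @: P| = #|P|.
Proof. by move=> Ff; rewrite card_in_imset //; apply: inF_inj. Qed.

Lemma fconjP P Q : fconjugate F P Q <-> exists f, inF P f /\ f @: P = Q.
Proof.
split=> [[f [g [Ff Fg fK gK]]]|[f [Ff EQ]]].
  have [sPS sQS injf imf] := fhom_sub Ff; have [_ _ _ img] := fhom_sub Fg.
  exists f; split.
    apply: fhom_inF; apply: (fhom_comp (g := idm Q) Ff) => //.
    by apply: (@fhom_conj _ _ _ _ _ 1) => // u Pu; rewrite invg1 mulg1 mul1g ?(subsetP sQS).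
  rewrite -morphimEdom; apply/eqP; rewrite eqEsubset imf; apply/subsetP => v Qv.
  by rewrite -[v]gK // mem_morphim // (subsetP img) // mem_morphim.
have [g [Fg fK gK]] := inF_inv Ff EQ.
have [phi [Fphi E]] := (inFE P f).1 Ff; have [psi [Fpsi E']] := (inFE Q g).1 Fg.
have [sPS _ inj im] := fhom_sub Fphi; have [sQS _ inj' im'] := fhom_sub Fpsi.
have EQphi : phi @* P = Q by rewrite -EQ morphimEdom; apply: eq_in_imset.
have EPpsi : psi @* Q = P.
  rewrite morphimEdom; apply/setP => u; apply/imsetP/idP => [[v Qv ->]|Pu].
    by rewrite E' //; move: Qv; rewrite -EQ => /imsetP[u' Pu' ->]; rewrite fK.
  by exists (f u); rewrite ?E' -?EQ ?imset_f ?fK.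
exists phi, psi; split.
- by have [+ _] := fhom_iso Fphi; have -> : (phi @* P)%G = Q by apply: group_inj.
- by have [+ _] := fhom_iso Fpsi; have -> : (psi @* Q)%G = P by apply: group_inj.
- by move=> u Pu; rewrite E // E' -?EQ ?imset_f // fK.
- move=> v Qv; rewrite E' // E ?gK //.
  by move: Qv; rewrite -EQ => /imsetP[u Pu ->]; rewrite fK.
Qed.

Definition nphi (P : {set gT}) f : {set gT} :=
  [set x in 'N_S(P) | [exists y in 'N_S(f @: P), [forall u in P, f (x * u * x^-1) == y * f u * y^-1]]].

Lemma nphiP (P : {set gT}) f x :
  reflect (x \in 'N_S(P) /\ exists2 y, y \in 'N_S(f @: P) & {in P, forall u, f (u ^ x^-1) = f u ^ y^-1})
          (x \in nphi P f).
Proof.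
apply: (iffP setIdP) => -[Nx].
  case/exists_inP => y Ny /forall_inP E; split=> //; exists y => // u Pu.
  by rewrite -!conjVE (eqP (E u Pu)).
by case=> y Ny E; split=> //; apply/exists_inP; exists y => //; apply/forall_inP => u Pu; rewrite !conjVE E.
Qed.

Lemma Nphi_nphi P (phi : {morphism P >-> gT}) : Nphi S phi = nphi P phi.
Proof. by rewrite /Nphi /nphi morphimEdom. Qed.

Lemma eq_nphi P f g : {in P, f =1 g} -> nphi P f = nphi P g.
Proof.
have sub f1 f2 : {in P, f1 =1 f2} -> nphi P f1 \subset nphi P f2.
  move=> E12; apply/subsetP => x /nphiP[Nx [y Ny h]]; apply/nphiP; split=> //.
  have nPx u : u \in P -> u ^ x^-1 \in P.
    by move=> Pu; rewrite memJ_norm // groupV; case/setIP: Nx.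
  exists y => [|u Pu]; first by rewrite -(eq_in_imset E12).
  by rewrite -!E12 ?h ?nPx.
move=> fg; apply/eqP; rewrite eqEsubset !sub // => u Pu; by rewrite fg.
Qed.

Lemma nphi_group P f : inF P f -> {N : {group gT} | N = nphi P f :> {set gT}}.
Proof.
move=> Ff; have [_ fM] := inF_ishom Ff.
exists (Nphi_group S (Morphism fM)); exact: Nphi_nphi.
Qed.

Lemma sub_nphi P f : inF P f -> P \subset nphi P f.
Proof.
move=> Ff; have [fS fM] := inF_ishom Ff; have sPS := inF_sub Ff.
have fV := ishomV (inF_ishom Ff).
apply/subsetP => x Px; apply/nphiP; split.
  by rewrite inE (subsetP sPS) // (subsetP (normG P)).
have Ex u : u \in P -> f (u ^ x^-1) = f u ^ (f x)^-1.
  by move=> Pu; rewrite !conjgE !fM ?groupM ?groupV // !fV ?groupV.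
exists (f x); last exact: Ex.
rewrite inE fS //=; have [R ER] := ishom_imgroup (inF_ishom Ff); rewrite -ER.
by apply: (subsetP (normG R)); rewrite ER imset_f.
Qed.

Lemma cent_sub_nphi P f : inF P f -> 'C_S(P) \subset nphi P f.
Proof.
move=> Ff; apply/subsetP => x /setIP[Sx Cx]; apply/nphiP; split.
  by rewrite inE Sx (subsetP (cent_sub P)).
exists 1; first exact: group1.
move=> u Pu; rewrite invg1 conjg1; congr f; apply/conjg_fixP/commgP/commute_sym/commute_sym.
by apply: commuteV; apply: commute_sym; apply: (centP Cx).
Qed.

Definition receptive R : Prop :=
  forall P f, inF P f -> f @: P = R -> exists2 g, inF (nphi P f) g & {in P, g =1 f}.

Definition automized (p : nat) R : Prop := p.-Sylow(AutF F R) (AutS S R).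

Lemma AutSE P : AutS S P = conj_aut P @* 'N_S(P).
Proof.
apply/setP => a; apply/setIdP/morphimP => [[Aa /exists_inP[x Nx /forall_inP E]]|[x Nx NSx ->]].
  have [Sx Nx'] := setIP Nx.
  exists x^-1; rewrite ?groupV //.
  apply: (eq_Aut Aa); first by rewrite (subsetP (Aut_conj_aut P 'N(P))) // mem_morphim ?groupV.
  by move=> u Pu; rewrite norm_conj_autE ?groupV // (eqP (E u Pu)) conjVE.
split; first by rewrite (subsetP (Aut_conj_aut P 'N(P))) // mem_morphim.
apply/exists_inP; exists x^-1; first by rewrite groupV.
by apply/forall_inP => u Pu; rewrite norm_conj_autE // conjVE invgK.
Qed.

Lemma card_AutS P : P \subset S -> (#|AutS S P| * #|'C_S(P)|)%N = #|'N_S(P)|.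
Proof.
move=> sPS; rewrite AutSE card_morphim ker_conj_aut (setIidPr (subsetIr _ _)).
by rewrite -indexgI -setIA (setIidPr (cent_sub P)) mulnC Lagrange // setIS // cent_sub.
Qed.

Lemma AutFP P (a : {perm gT}) : reflect (a \in Aut P /\ inF P a) (a \in AutF F P).
Proof.
apply: (iffP setIdP) => -[Aa].
  case/asboolP => f [Ff E]; split=> //.
  have [sPS _ _ _] := fhom_sub Ff.
  apply/inFE; exists f; split=> //.
  apply: (fhom_comp (g := idm P) Ff) => //.
  by apply: (@fhom_conj _ _ _ _ _ 1) => // u Pu; rewrite invg1 mulg1 mul1g ?(subsetP sPS).
case/inFE => phi [Fphi E]; split=> //; apply/asboolP; exists phi; split=> //.
have [+ _] := fhom_iso Fphi; have -> // : (phi @* P)%G = P.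
apply: group_inj; rewrite /= morphimEdom (eq_in_imset E).
have -> : [set a x | x in P] = autm_morphism Aa @* P by rewrite morphimEdom.
exact: im_autm.
Qed.

Lemma AutS_sub_AutF P : P \subset S -> AutS S P \subset AutF F P.
Proof.
move=> sPS; apply/subsetP => a /setIdP[Aa /exists_inP[x Nx /forall_inP E]].
have [Sx _] := setIP Nx.
apply/AutFP; split=> //; apply: eq_inF (inF_conj sPS (groupVr Sx)) => u Pu.
by rewrite (eqP (E u Pu)) conjVE.
Qed.

Lemma Aut_isom_AutF P R f (Ff : inF P f) (ER : f @: P = R) :
  exists phi : {morphism Aut P >-> {perm gT}},
    [/\ 'injm phi, phi @* AutF F P \subset AutF F R &
        {in Aut P & P, forall a u, phi a (f u) = f (a u)}].
Proof.
have [phi [Fphi E]] := (inFE P f).1 Ff; have [sPS _ inj im] := fhom_sub Fphi.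
have EQ : phi @* P = R by rewrite -ER morphimEdom; apply: eq_in_imset.
have aE : {in Aut P & P, forall a u, Aut_isom inj (subxx P) a (f u) = f (a u)}.
  move=> a u Aa Pu; rewrite -E // Aut_isomE // E //.
  by rewrite (perm_closed u (proj1 (setIdP Aa))).
exists (Aut_isom_morphism inj (subxx P)); split=> //.
  exact: injm_Aut_isom.
apply/subsetP => _ /morphimP[a Aa /AutFP[_ Fa] ->] /=; apply/AutFP; split.
  by have := Aut_Aut_isom inj (subxx P) a; rewrite EQ.
have [g [Fg fK gK]] := inF_inv Ff ER.
have gR : g @: R \subset P.
  apply/subsetP => _ /imsetP[v Rv ->]; move: Rv; rewrite -ER => /imsetP[u Pu ->].
  by rewrite fK.
have aP : (a \o g) @: R \subset P.
  apply/subsetP => _ /imsetP[v Rv ->] /=; rewrite (perm_closed _ (proj1 (setIdP Aa))).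
  by rewrite (subsetP gR) // imset_f.
apply: eq_inF (inF_comp (inF_comp Fg Fa gR) Ff aP) => v Rv /=.
have Pgv : g v \in P by rewrite (subsetP gR) // imset_f.
by have := aE a (g v) Aa Pgv; rewrite gK // => ->.
Qed.

Lemma card_AutF P R f : inF P f -> f @: P = R -> #|AutF F P| = #|AutF F R|.
Proof.
have le P' R' f' : inF P' f' -> f' @: P' = R' -> (#|AutF F P'| <= #|AutF F R'|)%N.
  move=> Ff ER; have [phi [inj sub _]] := Aut_isom_AutF Ff ER.
  rewrite -(card_injm inj) ?subset_leq_card //.
  by apply/subsetP => a /setIdP[].
move=> Ff ER; apply/eqP; rewrite eqn_leq (le _ _ _ Ff ER) /=.
have [g [Fg fK gK]] := inF_inv Ff ER; apply: (le _ _ _ Fg).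
apply/setP => u; apply/imsetP/idP => [[v]|Pu].
  by rewrite -ER => /imsetP[w Pw ->] ->; rewrite fK.
by exists (f u); rewrite ?fK // -ER imset_f.
Qed.

(** The map f carries Aut_S(P) to a p-subgroup of Aut_F(R). By Sylow some [a] in Aut_F(R) conjugates
    it into Aut_S(R), and then N_{a f} is all of N_S(P). *)
Lemma automized_adjust (p : nat) P R f : inF P f -> f @: P = R -> p.-group S -> automized p R ->
  exists g, [/\ inF P g, g @: P = R & nphi P g = 'N_S(P)].
Proof.
move=> Ff ER pS autR; have sPS := inF_sub Ff.
have [R' ER'] := ishom_imgroup (inF_ishom Ff).
have sRS : R \subset S.
  by rewrite -ER; apply/subsetP => _ /imsetP[u Pu ->]; case: (inF_ishom Ff) => fS _; apply: fS.
have [phi [inj sub aE]] := Aut_isom_AutF Ff ER.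
pose A := (phi @* (conj_aut P @* 'N_S(P)))%G.
have sA : A \subset AutF F R.
  apply: subset_trans sub; apply: morphimS; have := AutS_sub_AutF sPS; by rewrite AutSE.
have pA : p.-group A by rewrite !morphim_pgroup // (pgroupS (subsetIl _ _)).
pose AR := Group (AutF_group_set F sRS).
have sylR : p.-Sylow(AR) (conj_aut R @* 'N_S(R)) by move: autR; rewrite /automized AutSE.
have [a ARa sAa] := Sylow_Jsub sylR (sA : A \subset AR) pA.
have /AutFP[Aa Fa] : a \in AutF F R by [].
have aR v : (a v \in R) = (v \in R) by rewrite (perm_closed _ (proj1 (setIdP Aa))).
have fR u : u \in P -> f u \in R by move=> Pu; rewrite -ER imset_f.
have Fg : inF P (a \o f).
  by apply: (inF_comp Ff Fa); rewrite ER.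
have Eg : (a \o f) @: P = R.
  rewrite imset_comp ER; have -> : [set a x | x in R] = autm_morphism Aa @* R by rewrite morphimEdom.
  exact: im_autm.
exists (a \o f); split=> //.
apply/setP => x; apply/nphiP/idP => [[]//|Nx]; split=> //; rewrite Eg.
have Nx' : x^-1 \in 'N(P) by rewrite groupV; case/setIP: Nx.
pose b := conj_aut P x^-1.
have Ab : b \in Aut P by rewrite (subsetP (Aut_conj_aut P 'N(P))) // mem_morphim.
have : phi b ^ a \in AutS S R.
  rewrite AutSE (subsetP sAa) // memJ_conjg mem_morphim // mem_morphim //.
  by rewrite groupV.
case/setIdP => _ /exists_inP[y Ny /forall_inP E]; exists y => // u Pu /=.
have := E (a (f u)); rewrite aR fR // => /(_ isT)/eqP; rewrite conjVE => <-.
by rewrite permJ aE // norm_conj_autE.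
Qed.

(** Once [automized_adjust] has enlarged N_g to N_S(P), receptivity extends g to the whole
    normaliser. *)
Lemma receptive_ext (p : nat) P R f : inF P f -> f @: P = R -> p.-group S -> automized p R -> receptive R ->
  exists g, [/\ inF 'N_S(P) g, g @: P = R & g @: 'N_S(P) \subset 'N_S(R)].
Proof.
move=> Ff ER pS autR recR; have [g [Fg Eg Ng]] := automized_adjust Ff ER pS autR.
have [h Fh hg] := recR P g Fg Eg; rewrite Ng in Fh.
have [hS hM] := inF_ishom Fh; have sPS := inF_sub Ff.
have Eh : h @: P = R by rewrite -Eg; apply: eq_in_imset.
exists h; split=> //; apply/subsetP => _ /imsetP[x Nx ->].
have sPN : P \subset 'N_S(P) by rewrite subsetI sPS normG.
rewrite inE hS //= inE; apply/subsetP => _ /imsetP[v Rv ->].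
move: Rv; rewrite -Eh => /imsetP[u Pu ->].
have Nu := subsetP sPN u Pu.
rewrite conjgE -(ishomV (inF_ishom Fh)) // -!hM ?groupM ?groupV // -conjgE imset_f //.
by rewrite memJ_norm //; case/setIP: Nx.
Qed.

(** C_S(P) lies in N_f, and the extension of f embeds it into C_S(R). *)
Lemma receptive_cent P R f : inF P f -> f @: P = R -> receptive R -> (#|'C_S(P)| <= #|'C_S(R)|)%N.
Proof.
move=> Ff ER recR; have [g Fg gf] := recR P f Ff ER.
have [N EN] := nphi_group Ff; rewrite -EN in Fg.
have sPN : P \subset N by rewrite EN sub_nphi.
have sCN : 'C_S(P) \subset N by rewrite EN cent_sub_nphi.
have [gS gM] := inF_ishom Fg.
rewrite -(card_in_imset (f := g) (D := 'C_S(P))); last first.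
  by move=> u v /(subsetP sCN) Nu /(subsetP sCN) Nv; apply: (inF_inj Fg).
apply: subset_leq_card; apply/subsetP => _ /imsetP[x Cx ->].
rewrite inE gS ?(subsetP sCN) //=; apply/centP => v; rewrite -ER => /imsetP[u Pu ->].
have Nx := subsetP sCN x Cx; have Nu := subsetP sPN u Pu.
rewrite -gf // /commute -!gM //; congr g.
by apply: (centP (proj2 (setIP Cx))).
Qed.

Lemma inF_imJ (N : {group gT}) g x u : inF N g -> x \in N -> u \in N -> g (u ^ x) = g u ^ g x.
Proof.
move=> Fg Nx Nu; have [gS gM] := inF_ishom Fg.
by rewrite !conjgE !gM ?groupM ?groupV // (ishomV (inF_ishom Fg)).
Qed.

Lemma automizedE (p : nat) P : P \subset S ->
  automized p P <-> #|AutS S P| = (#|AutF F P|`_p)%N.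
Proof.
move=> sPS; have sA := AutS_sub_AutF sPS.
have := pHallE p (Group (AutF_group_set F sPS)) (conj_aut P @* 'N_S(P))%G.
rewrite /= -!AutSE sA /= /automized => ->; split=> [/eqP //|->]; exact: eqxx.
Qed.

(** Both axioms are transported from such a representative R along the maps N_S(P) -> N_S(R) of
    [receptive_ext]. *)
Lemma saturated_criterion (p : nat) : p.-group S ->
  (forall P, P \subset S -> exists (R : {group gT}) f,
     [/\ inF P f, f @: P = R, receptive R & automized p R]) ->
  saturated F p.
Proof.
move=> pS crit; split=> [P sPS nP|P phi Fphi cphi].
  have [R [f [Ff ER recR autR]]] := crit P sPS.
  have [g [Fg Eg sgN]] := receptive_ext Ff ER pS autR recR.
  have sPN : P \subset 'N_S(P) by rewrite subsetI sPS normG.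
  have Fg' : inF P g by apply: inF_res Fg.
  have cPR : fconjugate F P R by apply/fconjP; exists g.
  have cardN : #|g @: 'N_S(P)| = #|'N_S(P)| by exact: (inF_card Fg).
  (* Full normalisation of P makes the injection of normalisers onto, so the orders of C_S and Aut_S
     at P can be compared with those at R. *)
  have EN : g @: 'N_S(P) = 'N_S(R).
    by apply/eqP; rewrite eqEcard sgN cardN nP.
  have leC : (#|'C_S(R)| <= #|'C_S(P)|)%N.
    have sC : 'C_S(R) \subset g @: 'C_S(P).
      apply/subsetP => z Cz.
      have : z \in g @: 'N_S(P) by rewrite EN (subsetP (setIS S (cent_sub R))).
      case/imsetP => x Nx Ez; rewrite Ez imset_f // inE; have /setIP[-> _] := Nx => /=.
      apply/centP => u Pu; apply/commute_sym/commgP/conjg_fixP.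
      have Nu := subsetP sPN u Pu.
      apply: (inF_inj Fg) => //; first by rewrite groupJ.
      rewrite (inF_imJ Fg) // -Ez; apply/conjg_fixP/commgP/commute_sym.
      by apply: (centP (proj2 (setIP Cz))); rewrite -Eg imset_f.
    apply: leq_trans (subset_leq_card sC) _; exact: leq_imset_card.
  split.
    move=> Q /fconjP[h [Fh Eh]]; apply: leq_trans leC.
    have [h' [Fh' hK h'K]] := inF_inv Fh Eh.
    have Eh' : h' @: Q = P.
      apply/setP => u; apply/imsetP/idP => [[v]|Pu].
        by rewrite -Eh => /imsetP[w Pw ->] ->; rewrite hK.
      by exists (h u); rewrite ?hK // -Eh imset_f.
    apply: (receptive_cent (f := g \o h')) => //.
      by apply: (inF_comp Fh' Fg'); rewrite Eh'.
    by rewrite imset_comp Eh'.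
  have sRS : R \subset S.
    by rewrite -ER; apply/subsetP => _ /imsetP[u Pu ->]; case: (inF_ishom Ff) => fS _; apply: fS.
  have ge := receptive_cent Ff ER recR.
  have EC : #|'C_S(P)| = #|'C_S(R)| by apply/eqP; rewrite eqn_leq ge.
  have EA : #|AutS S P| = #|AutS S R|.
    apply/eqP; rewrite -(eqn_pmul2r (cardG_gt0 'C_S(P)%G)) /= card_AutS // EC card_AutS //.
    by rewrite -EN cardN.
  apply/automizedE => //; rewrite EA (card_AutF Ff ER).
  exact: (automizedE p sRS).1.
pose T := (phi @* P)%G.
have Ff := fhom_inF Fphi; have [sPS _ inj sTS] := fhom_sub Fphi.
have ET : phi @: P = T by rewrite /T /= morphimEdom.
have [R [f [Ff' ER recR autR]]] := crit T sTS.
have [g [Fg Eg sgN]] := receptive_ext Ff' ER pS autR recR.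
have sTN : T \subset 'N_S(T) by rewrite subsetI sTS normG.
have FgT : inF T g by apply: inF_res Fg.
have sRS : R \subset S.
  by rewrite -ER; apply/subsetP => _ /imsetP[u Pu ->]; case: (inF_ishom Ff') => fS _; apply: fS.
have sCN : 'C_S(T) \subset 'N_S(T) by rewrite setIS // cent_sub.
(* T is fully centralised, hence g maps its centraliser onto that of R. *)
have EC : g @: 'C_S(T) = 'C_S(R).
  apply/eqP; rewrite eqEcard; apply/andP; split.
    apply/subsetP => _ /imsetP[x Cx ->]; have [gS _] := inF_ishom Fg.
    rewrite inE gS ?(subsetP sCN) //=; apply/centP => v; rewrite -Eg => /imsetP[u Tu ->].
    apply/commute_sym/commgP/conjg_fixP.
    have Nx := subsetP sCN x Cx; have Nu := subsetP sTN u Tu.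
    rewrite -(inF_imJ Fg) //; congr g.
    apply/conjg_fixP/commgP/commute_sym; exact: (centP (proj2 (setIP Cx))).
  rewrite card_in_imset; last by move=> u v /(subsetP sCN) Nu /(subsetP sCN) Nv; apply: (inF_inj Fg).
  by apply: cphi; apply/fconjP; exists g.
have Fgf : inF P (g \o phi) by apply: (inF_comp Ff FgT); rewrite ET.
have Egf : (g \o phi) @: P = R by rewrite imset_comp ET.
have [h Fh hE] := recR P _ Fgf Egf.
have [N1 EN1] := nphi_group Ff; have [N2 EN2] := nphi_group Fgf.
rewrite -EN2 in Fh.
have phiT u : u \in P -> phi u \in T by move=> Pu; rewrite -ET imset_f.
(* If y realises the conjugation by x on the image, h(x) and g(y) act alike on R and so differ by an
   element of C_S(R) = g(C_S(T)). Thus h maps N_phi into the image of g, and composing with the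
   inverse of g extends [phi]. *)
have key x : x \in N1 -> x \in N2 /\ h x \in g @: 'N_S(T).
  rewrite EN1 => /nphiP[Nx [y Ny E]]; rewrite ET in Ny.
  have N2x : x \in N2.
    rewrite EN2; apply/nphiP; split=> //; rewrite Egf; exists (g y).
      by rewrite (subsetP sgN) // imset_f.
    move=> u Pu /=; have Nu := subsetP sTN _ (phiT u Pu).
    rewrite E // (inF_imJ Fg) ?groupV //.
    by rewrite (ishomV (inF_ishom Fg)).
  split=> //.
  have sPN2 : P \subset N2 by rewrite EN2 sub_nphi.
  have hS : h x \in S by have [hS _] := inF_ishom Fh; apply: hS.
  have gyS : g y \in S by have [gS _] := inF_ishom Fg; apply: gS.
  have : h x * (g y)^-1 \in 'C_S(R).
    rewrite inE groupM ?groupV //=; apply/centP => v; rewrite -Egf => /imsetP[u Pu ->].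
    apply/commute_sym/commgP/conjg_fixP; rewrite conjgM.
    have Pux : u ^ x \in P by rewrite memJ_norm //; case/setIP: Nx.
    have -> : (g \o phi) u ^ h x = (g \o phi) (u ^ x).
      by have N2u := subsetP sPN2 u Pu; rewrite -!hE // (inF_imJ Fh).
    have -> : (g \o phi) (u ^ x) ^ (g y)^-1 = (g \o phi) ((u ^ x) ^ x^-1).
      have Nu := subsetP sTN _ (phiT _ Pux).
      rewrite /= E // (inF_imJ Fg) ?groupV //.
      by rewrite (ishomV (inF_ishom Fg)).
    by rewrite conjgK.
  rewrite -EC => /imsetP[c Cc Ec]; apply/imsetP; exists (c * y).
    by rewrite groupM // (subsetP sCN).
  have Nc := subsetP sCN c Cc.
  by have [_ gM] := inF_ishom Fg; rewrite gM // -Ec mulgKV.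
have sN12 : N1 \subset N2 by apply/subsetP => x /key[].
have [N3 EN3] := ishom_imgroup (inF_ishom Fg).
have [k [Fk gK kK]] := inF_inv Fg (esym EN3).
have sub : h @: N1 \subset N3.
  by rewrite EN3; apply/subsetP => _ /imsetP[x N1x ->]; case: (key x N1x).
have Fkh := inF_comp (inF_res sN12 Fh) Fk sub.
have EN1' : N1 = Nphi_group S phi by apply: group_inj; rewrite EN1 /= Nphi_nphi.
rewrite EN1' in Fkh; case/inFE: Fkh => psi [Fpsi Epsi]; exists psi => // u Pu.
rewrite Epsi /=; last by rewrite Nphi_nphi (subsetP (sub_nphi Ff)).
by rewrite hE //= gK // (subsetP sTN) // phiT.
Qed.

End FusionMaps.

Local Open Scope ring_scope.

(** * Marks on the localized Burnside module *)

Section KMark.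
Variables (aT gT hT : finGroupType) (G : {group gT}) (H : {group hT}).
Implicit Types (P : {set aT}) (a : aT -> hT) (b : aT -> gT).

Definition kmark P a b : burnside G H -> int :=
  plift (fun c : biset_code G H => (bmark (projT2 c) P a b)%:Z).

Lemma kills_kmark P a b : kills (@burnside_rel _ _ G H)
  (fun c : biset_code G H => (bmark (projT2 c) P a b)%:Z).
Proof.
apply: kills_burnside => [c d cd|c d]; first by rewrite (bmark_iso _ _ _ cd).
by rewrite (bmark_iso _ _ _ (skel_iso _)) bmark_sum PoszD.
Qed.

Lemma kmarkB P a b : {morph kmark P a b : x y / x - y}.
Proof. exact/pliftB/kills_kmark. Qed.

Lemma kmarkE P a b (T : finType) (X : lfbiset G H T) : kmark P a b (bclass X) = (bmark X P a b)%:Z.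
Proof.
by rewrite /kmark plift_gen ?(bmark_iso _ _ _ (skel_iso _)) //; apply: kills_kmark.
Qed.

End KMark.

(* The number of points z with a(u) z = z b(u) for all u in P, extended        *)
(* linearly to A(G,H)_(p).                                                     *)
HB.lock Definition mark (p : nat) (aT gT hT : finGroupType) (G : {group gT}) (H : {group hT})
    (P : {set aT}) (a : aT -> hT) (b : aT -> gT) : burnside_loc p G H -> rat :=
  plift (fun uc : burnside G H * Zloc p => (kmark P a b uc.1)%:~R * val uc.2).

Section Mark.
Variables (p : nat) (aT gT hT : finGroupType) (G : {group gT}) (H : {group hT}).
Implicit Types (P : {set aT}) (a : aT -> hT) (b : aT -> gT) (x y : burnside_loc p G H).

Lemma kills_mark P a b : kills (@tensor_rel (burnside G H) (Zloc p))
  (fun uc : burnside G H * Zloc p => (kmark P a b uc.1)%:~R * val uc.2).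
Proof.
apply: kills_tensor => [c u u'|u c c'] /=.
  by rewrite (morphB_D (kmarkB P a b)) rmorphD mulrDl.
by rewrite mulrDr.
Qed.

Lemma markB P a b : {morph @mark p _ _ _ G H P a b : x y / x - y}.
Proof. by rewrite mark.unlock; exact/pliftB/kills_mark. Qed.
Lemma markD P a b : {morph @mark p _ _ _ G H P a b : x y / x + y}.
Proof. exact: morphB_D (markB P a b). Qed.
Lemma mark0 P a b : mark P a b (0 : burnside_loc p G H) = 0.
Proof. exact: morphB_0 (markB P a b). Qed.
Lemma mark_sum P a b (I : Type) (r : seq I) (Q : pred I) (F : I -> burnside_loc p G H) :
  mark P a b (\sum_(i <- r | Q i) F i) = \sum_(i <- r | Q i) mark P a b (F i).
Proof. exact: (big_morph _ (markD P a b) (mark0 P a b)). Qed.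

Lemma mark_tens P a b (x : burnside G H) (c : Zloc p) :
  mark P a b (tens x c) = (kmark P a b x)%:~R * val c.
Proof. by rewrite mark.unlock plift_gen //; apply: kills_mark. Qed.

Lemma mark_bclass P a b (T : finType) (X : lfbiset G H T) (c : Zloc p) :
  mark P a b (tens (bclass X) c) = (bmark X P a b)%:R * val c.
Proof. by rewrite mark_tens kmarkE. Qed.

Lemma bloc_ind (R : burnside_loc p G H -> Prop) :
  R 0 -> (forall x y, R x -> R y -> R (x - y)) ->
  (forall (T : finType) (X : lfbiset G H T) (c : Zloc p), R (tens (bclass X) c)) -> forall x, R x.
Proof.
move=> R0 RB Rt; elim/burnside_loc_ind => // x c.
elim/burnside_ind: x => [|x y Rx Ry|T X]; last exact: Rt.
  suff -> : tens 0 c = 0 :> burnside_loc p G H by [].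
  by apply: (@addrI _ (tens (0 : burnside G H) c)); rewrite -tensDl !addr0.
suff -> : tens (x - y) c = tens x c - tens y c :> burnside_loc p G H by apply: RB.
by apply: (@addIr _ (tens y c)); rewrite -tensDl !subrK.
Qed.

Lemma eq_mark P a a' b b' : {in P, a =1 a'} -> {in P, b =1 b'} -> @mark p _ _ _ G H P a b =1 mark P a' b'.
Proof.
move=> aa bb; elim/bloc_ind => [|x y IHx IHy|T X c].
- by rewrite !mark0.
- by rewrite !markB IHx IHy.
by rewrite !mark_bclass /bmark (eq_bfix _ aa bb).
Qed.

Lemma mark_eq0 P a b x :
  (forall (T : finType) (X : lfbiset G H T), bmark X P a b = 0%N) -> mark P a b x = 0.
Proof.
move=> b0; elim/bloc_ind: x => [|x y IHx IHy|T X c].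
- by rewrite !mark0.
- by rewrite !markB IHx IHy subr0.
by rewrite mark_bclass b0 mul0r.
Qed.

Lemma mark_neq0 P a b x : mark P a b x != 0 ->
  exists (T : finType) (X : lfbiset G H T) (z : T), z \in bfix X P a b.
Proof.
apply: contra_neqP => no; apply: mark_eq0 => T X; apply/eqP; rewrite cards_eq0.
apply/eqP/setP => z; rewrite in_set0; apply/negbTE/negP => fz.
by apply: no; exists T, X, z.
Qed.

(** If b(u) = 1, then a(u) fixes a point, and left freeness applies. *)
Lemma mark_ker P a b x : mark P a b x != 0 -> {in P, forall u, b u = 1%g -> a u = 1%g}.
Proof.
case/mark_neq0 => T [X [z /bfixP fz]] u Pu bu; have [Ha _] := fz u Pu.
by rewrite bu ract1 => /(lact_free Ha).
Qed.

Lemma mark_conjl (P : {set aT}) a b x h : {in P, forall u, a u \in H} -> {in P, forall u, b u \in G} -> h \in H ->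
  mark P (fun u => a u ^ h)%g b x = mark P a b x.
Proof.
move=> aH bG Hh; elim/bloc_ind: x => [|x y IHx IHy|T X c].
- by rewrite !mark0.
- by rewrite !markB IHx IHy.
rewrite !mark_bclass; congr (_%:R * _).
have fI : injective (lact X h^-1).
  by move=> z z' /(congr1 (lact X h)); rewrite -!lactM ?groupV // mulgV !lact1.
have key u w : a u \in H -> (lact X (a u ^ h) (lact X h^-1 w) = lact X h^-1 (lact X (a u) w))%g.
  move=> Ha; rewrite -!lactM ?groupJ ?groupV //; congr (lact X _ w).
  by rewrite conjgE -!mulgA mulgV mulg1.
rewrite /bmark -[RHS](card_imset _ fI); apply: eq_card => z.
have -> : z = lact X h^-1 (lact X h z) by rewrite -lactM ?groupV // mulVg lact1.
move: (lact X h z) => w; rewrite mem_imset //.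
apply/bfixP/bfixP => fz u Pu; have [_ Gb] := fz u Pu; have Ha := aH u Pu.
  by rewrite key // lractA ?groupV // => /fI.
by move=> E; split; rewrite ?groupJ // key // E lractA ?groupV.
Qed.

Lemma mark_conjr (P : {set aT}) a b x g : {in P, forall u, b u \in G} -> g \in G ->
  mark P a (fun u => b u ^ g)%g x = mark P a b x.
Proof.
move=> bG Gg; elim/bloc_ind: x => [|x y IHx IHy|T X c].
- by rewrite !mark0.
- by rewrite !markB IHx IHy.
rewrite !mark_bclass; congr (_%:R * _).
have fI : injective (ract X ^~ g).
  by move=> z z' /(congr1 (ract X ^~ g^-1%g)); rewrite -!ractM ?groupV // mulgV !ract1.
have key u w : b u \in G -> (ract X (ract X w g) (b u ^ g) = ract X (ract X w (b u)) g)%g.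
  move=> Gb; rewrite -!ractM ?groupJ ?groupV //; congr (ract X w _).
  by rewrite conjgE mulKVg.
rewrite /bmark -[RHS](card_imset _ fI); apply: eq_card => z.
have -> : z = ract X (ract X z g^-1) g by rewrite -ractM ?groupV // mulVg ract1.
move: (ract X z g^-1) => w; rewrite -[X in X \in imset _ _]/((ract X ^~ g) w) mem_imset //.
apply/bfixP/bfixP => fz u Pu; have [Ha _] := fz u Pu; have Gb := bG u Pu.
  by rewrite key // -lractA // => /fI.
by move=> E; split; rewrite ?groupJ // key // -E lractA.
Qed.

(** Carries divisibility of counts on bisets over to p-local combinations of bisets. *)
Lemma zloc_lin (L : burnside_loc p G H -> rat) (d : nat) :
  {morph L : x y / x - y} ->
  (forall (T : finType) (X : lfbiset G H T) (c : Zloc p),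
     exists n : int, L (tens (bclass X) c) = (n * d%:Z)%:~R * val c) ->
  forall x, L x / d%:R \in zloc_pred p.
Proof.
move=> LB Ld; case: d Ld => [_ x|d Ld]; first by rewrite invr0 mulr0 rpred0.
elim/bloc_ind => [|x y IHx IHy|T X c].
- by rewrite (morphB_0 LB) mul0r rpred0.
- by rewrite LB mulrBl rpredB.
- have [n ->] := Ld T X c; rewrite intrM mulrAC mulfK ?pnatr_eq0 //.
  by rewrite rpredM ?rpred_int //; apply: valP.
Qed.

End Mark.

(** A mark depends only on the set of pairs (a(v), b(v)). *)
Lemma mark_reparam (p : nat) (aT bT gT hT : finGroupType) (G : {group gT}) (H : {group hT})
    (P : {set bT}) (f : bT -> aT) a b (x : burnside_loc p G H) :
  mark (f @: P) a b x = mark P (a \o f) (b \o f) x.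
Proof.
elim/bloc_ind: x => [|x y IHx IHy|T X c].
- by rewrite !mark0.
- by rewrite !markB IHx IHy.
rewrite !mark_bclass; congr (_%:R * _); apply: eq_card => z; apply/bfixP/bfixP => fz u.
  by move=> Pu; apply: fz; apply: imset_f.
by case/imsetP => v Pv ->; apply: fz.
Qed.

Section MarkComp.
Variables (p : nat) (aT gT hT lT : finGroupType).
Variables (G : {group gT}) (H : {group hT}) (L : {group lT}).

Lemma mark_comp (P : {group aT}) a c (x : burnside_loc p H L) (y : burnside_loc p G H) :
  {in P, forall u, a u \in L} -> ishom P G c ->
  #|H|%:R * mark P a c (comp_loc x y) =
  \sum_(b in homs P H) mark P a b x * mark P b c y.
Proof.
move=> aL hc; elim/bloc_ind: x => [|x x' IH IH'|T X d].
- rewrite (morphB_0 (comp_locBl _)) mark0 mulr0 big1 // => b _.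
  by rewrite mark0 mul0r.
- rewrite comp_locBl markB mulrBr IH IH' -sumrB; apply: eq_bigr => b _.
  by rewrite markB mulrBl.
elim/bloc_ind: y => [|x x' IH IH'|T' Y d'].
- rewrite (morphB_0 (comp_locBr _)) mark0 mulr0 big1 // => b _.
  by rewrite mark0 mulr0.
- rewrite comp_locBr markB mulrBr IH IH' -sumrB; apply: eq_bigr => b _.
  by rewrite markB mulrBr.
rewrite comp_loc_tens burnside_compE mark_bclass mulrA -natrM bmark_comp //.
rewrite natr_sum mulr_suml; apply: eq_bigr => b _.
by rewrite !mark_bclass natrM rmorphM mulrACA.
Qed.

Lemma mark_hom (P : {set aT}) a (b : aT -> gT) (phi : {morphism G >-> hT})
    (sphiH : phi @* G \subset H) (x : burnside_loc p H L) :
  {in P, forall u, b u \in G} ->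
  mark P a b (comp_loc x (hclass_loc p (subxx G) sphiH)) = mark P a (phi \o b) x.
Proof.
move=> bG; elim/bloc_ind: x => [|x x' IH IH'|T X d].
- by rewrite (morphB_0 (comp_locBl _)) !mark0.
- by rewrite comp_locBl [LHS]markB IH IH' -markB.
by rewrite comp_loc_tens burnside_compE !mark_bclass bmark_hom // mulr1.
Qed.

End MarkComp.

Lemma mark_prod (p : nat) (aT gT1 gT2 hT1 hT2 : finGroupType) (G1 : {group gT1})
    (G2 : {group gT2}) (H1 : {group hT1}) (H2 : {group hT2}) (P : {set aT})
    (a : aT -> hT1 * hT2) (b : aT -> gT1 * gT2)
    (x : burnside_loc p G1 H1) (y : burnside_loc p G2 H2) :
  mark P a b (prod_loc x y) =
  mark P (fst \o a) (fst \o b) x * mark P (snd \o a) (snd \o b) y.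
Proof.
elim/bloc_ind: x => [|x x' IH IH'|T X d].
- by rewrite (morphB_0 (prod_locBl _)) !mark0 mul0r.
- have -> : prod_loc (x - x') y = prod_loc x y - prod_loc x' y by exact: prod_locBl.
  by rewrite [LHS]markB IH IH' -mulrBl -markB.
elim/bloc_ind: y => [|x x' IH IH'|T' Y d'].
- by rewrite (morphB_0 (prod_locBr _)) !mark0 mulr0.
- have -> : prod_loc (tens (bclass X) d) (x - x') = prod_loc (tens (bclass X) d) x - prod_loc (tens (bclass X) d) x' by exact: prod_locBr.
  by rewrite [LHS]markB IH IH' -mulrBr -markB.
rewrite prod_loc_tens burnside_prodE !mark_bclass bmark_prod natrM rmorphM.
exact: mulrACA.
Qed.

Section MarkCongruence.
Variables (p : nat) (aT gT hT : finGroupType) (G : {group gT}) (H : {group hT}).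
Hypotheses (p_prime : prime p) (pH : p.-group H).
Implicit Type x : burnside_loc p G H.

Lemma mark_sum_mod (P Q : {group aT}) (b : aT -> gT) (B : pred {ffun aT -> hT}) x :
  p.-group Q -> P <| Q -> ishom Q G b ->
  (forall a h u, a \in homs P H -> h \in H -> u \in Q -> B a ->
     B (rs P (fun v => (a (v ^ u^-1)) ^ h)%g)) ->
  (\sum_(a in homs P H | B a) mark P a b x -
   \sum_(c in homs Q H | B (rs P c)) mark Q c b x) / (p * #|H|)%:R \in zloc_pred p.
Proof.
move=> pQ nPQ hb BJ; move: x.
apply: zloc_lin => [x y|T X c].
  under eq_bigr do rewrite markB.
  under [X in _ - X]eq_bigr do rewrite markB.
  by rewrite !sumrB !opprB addrACA [RHS]addrACA; congr (_ + _); apply: addrC.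
have /eqP := sum_bmark_mod X p_prime pH pQ nPQ hb BJ.
set A := (\sum_(_ in _ | _) _)%N; set C := (\sum_(_ in _ | _) _)%N => E.
have /dvdzP[n nE] : ((p * #|H|)%:Z %| A%:Z - C%:Z)%Z.
  by rewrite -eqz_mod_dvd !modz_nat (eqP E).
exists n; rewrite -nE intrB mulrBl; congr (_ - _);
by rewrite -pmulrn ?/A ?/C natr_sum mulr_suml; apply: eq_bigr => a _; rewrite mark_bclass.
Qed.

Lemma mark_sum_dvd (P : {group aT}) (b : aT -> gT) (B : pred {ffun aT -> hT}) x :
  p.-group P -> ishom P G b ->
  (forall a h, a \in homs P H -> h \in H -> B a -> B (rs P (fun v => (a v) ^ h)%g)) ->
  (\sum_(a in homs P H | B a) mark P a b x) / #|H|%:R \in zloc_pred p.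
Proof.
move=> pP hb BJ; move: x.
apply: zloc_lin => [x y|T X c].
  by rewrite -sumrB; apply: eq_bigr => a _; rewrite markB.
(* Precomposing [a] with conjugation by an element of P is conjugation by a value of [a], which the
   assumption on H covers. *)
have BJ' a h u : a \in homs P H -> h \in H -> u \in P -> B a ->
  B (rs P (fun v => (a (v ^ u^-1)) ^ h)%g).
  move=> ha Hh Pu Ba; have [aH aM] := homs_ishom ha.
  have -> : rs P (fun v => (a (v ^ u^-1)) ^ h)%g = rs P (fun v => (a v ^ ((a u)^-1 * h))%g).
    apply: eq_rs => v Pv; rewrite conjgM; congr (_ ^ _)%g.
    rewrite !conjgE !invgK !aM ?groupM ?groupV //.
    by rewrite (ishomV (homs_ishom ha)).
  by apply: BJ; rewrite // groupM ?groupV ?aH.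
have /dvdnP[n nE] := sum_bmark_dvd X p_prime pH pP (normal_refl P) hb BJ'.
exists n%:Z; rewrite -PoszM -nE -pmulrn.
by rewrite natr_sum mulr_suml; apply: eq_bigr => a _; rewrite mark_bclass.
Qed.

End MarkCongruence.

Lemma mark_cauchy (p : nat) (aT gT hT : finGroupType) (G : {group gT}) (H : {group hT})
    (x : burnside_loc p G H) (P N : {group aT}) a b :
  P <| N -> ishom N G b ->
  (\sum_(u in N) \sum_(c in homs <<u |: P>> H | [forall v in P, c v == a v])
     mark <<u |: P>> c b x) / #|gnorm H P N a|%:R \in zloc_pred p.
Proof.
move=> nPN hb; move: x; apply: zloc_lin => [x y|T X c].
  rewrite -sumrB; apply: eq_bigr => u _; rewrite -sumrB; apply: eq_bigr => c _.
  by rewrite markB.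
have /dvdnP[n nE] := bmark_cauchy X a nPN hb.
exists n%:Z; rewrite -PoszM -nE -pmulrn.
rewrite natr_sum mulr_suml; apply: eq_bigr => u _.
by rewrite natr_sum mulr_suml; apply: eq_bigr => d _; rewrite mark_bclass.
Qed.

(** * Marks separate elements *)

Section TensExtra.
Variables U V : zmodType.

Lemma tens0r (u : U) : tens u (0 : V) = 0.
Proof. by apply: (@addrI _ (tens u 0)); rewrite -tensDr !addr0. Qed.

Lemma tens0l (v : V) : tens (0 : U) v = 0.
Proof. by apply: (@addrI _ (tens 0 v)); rewrite -tensDl !addr0. Qed.

Lemma tensBr (u : U) (v w : V) : tens u (v - w) = tens u v - tens u w.
Proof. by apply: (@addIr _ (tens u w)); rewrite -tensDr !subrK. Qed.

Lemma tens_sumr (I : finType) (Q : pred I) (u : U) (F : I -> V) :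
  tens u (\sum_(i | Q i) F i) = \sum_(i | Q i) tens u (F i).
Proof. exact: (big_morph _ (tensDr u) (tens0r u)). Qed.

End TensExtra.

Definition bspec (gT hT : finGroupType) (G : {group gT}) (H : {group hT})
    (i : {group gT} * {ffun gT -> hT}) (v : burnside G H) : Prop :=
  exists (al : {morphism i.1 >-> hT}) (sKG : i.1 \subset G) (saH : (al @* i.1)%g \subset H),
    {in i.1, al =1 i.2} /\ v = hclass sKG saH.

(* The class [K, phi] for i = (K, phi), and 0 when i does not make sense.      *)
HB.lock Definition bas (gT hT : finGroupType) (G : {group gT}) (H : {group hT})
    (i : {group gT} * {ffun gT -> hT}) : burnside G H :=
  match pselect (exists v, @bspec _ _ G H i v) with
  | left ex => projT1 (cid ex) | right _ => 0 end.

Section Basis.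
Variables (gT hT : finGroupType) (G : {group gT}) (H : {group hT}).
Local Notation I := ({group gT} * {ffun gT -> hT})%type.
Implicit Type i j : I.
Local Notation bas := (@bas _ _ G H).

Definition idx : {set I} := [set i : I | (i.1 \subset G) && (i.2 \in homs i.1 H)].

Lemma basP i : i \in idx -> @bspec _ _ G H i (bas i).
Proof.
rewrite inE => /andP[sKG /homs_ishom[aH aM]]; rewrite bas.unlock; case: pselect => [ex|[]].
  by case: (cid ex).
pose al := Morphism aM.
have saH : (al @* i.1)%g \subset H by apply/subsetP => _ /morphimP[k Kk _ ->]; apply: aH.
by exists (hclass sKG saH), al, sKG, saH.
Qed.

Lemma hclass_bas (K : {group gT}) (al : {morphism K >-> hT}) (sKG : K \subset G)
    (saH : (al @* K)%g \subset H) : (K, rs K al) \in idx /\ hclass sKG saH = bas (K, rs K al).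
Proof.
have hi : (K, rs K al) \in idx by rewrite inE sKG /= rs_homs //; apply: morph_ishom.
split=> //; have [be [sKG' [sbH [E ->]]]] := basP hi.
apply: bclass_iso; apply: (@hombiset_conj_iso _ _ _ _ _ _ _ _ _ _ _ _ 1%g 1%g) => //.
  by rewrite invg1 conjsg1.
by move=> q Kq; rewrite E //= rsE // !invg1 !conjg1.
Qed.

Lemma kmark_bas i (Q : {set gT}) (c : gT -> hT) : i \in idx ->
  {in Q, forall q, c q \in H} -> Q \subset G -> kmark Q c id (bas i) != 0 ->
  exists s t, [/\ s \in H, t \in G &
    {in Q, forall q, q ^ t^-1 \in i.1 /\ c q = i.2 (q ^ t^-1) ^ s^-1}%g].
Proof.
move=> hi cH sQG; have [al [sKG [saH [E ->]]]] := basP hi.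
rewrite /hclass kmarkE => nz.
have := card_subconj sKG saH cH sQG.
have [-> /esym/eqP|[[s t]]] := set_0Vmem (subconj G H al Q c).
  rewrite cards0 muln_eq0 -leqn0 leqNgt cardG_gt0 /= => /eqP e0.
  by move: nz; rewrite e0.
move=> /subconjP[Hs Gt f] _; exists s, t; split=> // q Qq; have [Kq cE] := f q Qq.
by rewrite Kq cE E.
Qed.

Lemma kmark_bas_self i : i \in idx -> kmark i.1 i.2 id (bas i) != 0.
Proof.
move=> hi; have := hi; rewrite inE => /andP[_ /homs_ishom[aH _]].
have [al [sKG [saH [E ->]]]] := basP hi.
rewrite /hclass kmarkE; have := card_subconj sKG saH aH sKG.
have [e|[w _]] := set_0Vmem (subconj G H al i.1 i.2).
  have : (1, 1)%g \in subconj G H al i.1 i.2.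
    apply/subconjP; split=> // q Kq; rewrite !invg1 !conjg1 E //.
  by rewrite e inE.
have [-> |] := eqVneq (bmark (hombiset sKG saH) i.1 i.2 id) 0%N; last by [].
rewrite muln0 => /eqP; rewrite cards_eq0 => /eqP e0.
have : (1, 1)%g \in subconj G H al i.1 i.2.
  by apply/subconjP; split=> // q Kq; rewrite !invg1 !conjg1 E.
by rewrite e0 inE.
Qed.

(** Triangularity of the table of marks: a nonzero mark makes the graph of j subconjugate to that of
    i; by orders the two are conjugate, and so define the same class. *)
Lemma kmark_bas_eq i j : i \in idx -> j \in idx -> (#|i.1| <= #|j.1|)%N ->
  kmark j.1 j.2 id (bas i) != 0 -> #|i.1| = #|j.1| /\ bas i = bas j.
Proof.
move=> hi hj le; have := hj; rewrite inE => /andP[sjG /homs_ishom[jH _]].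
case/(kmark_bas hi jH sjG) => s [t [Hs Gt f]].
have sub : (j.1 :^ t^-1)%g \subset i.1.
  by apply/subsetP => _ /imsetP[q jq ->]; case: (f q jq).
have Eji : (j.1 :^ t^-1)%g = i.1 by apply/eqP; rewrite eqEcard sub cardJg.
split; first by rewrite -Eji cardJg.
have [al [sKG [saH [E ->]]]] := basP hi; have [be [sLG [sbH [E' ->]]]] := basP hj.
apply: bclass_iso; apply: (hombiset_conj_iso sKG saH sLG sbH Hs Gt Eji) => q jq.
by have [Kq] := f q jq; rewrite E' // E.
Qed.

Section Span.
Variable p : nat.
Implicit Type x : burnside_loc p G H.

Lemma bas_span x : exists c : I -> Zloc p, x = \sum_(i in idx) tens (bas i) (c i).
Proof.
elim/bloc_ind: x => [|x y [c ->] [d ->]|T X c].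
- by exists (fun _ => 0); rewrite big1 // => i _; rewrite tens0r.
- by exists (fun i => c i - d i); rewrite -sumrB; apply: eq_bigr => i _; rewrite tensBr.
move: c; apply: (bclass_gen (R := fun v => forall d, exists c : I -> Zloc p,
   tens v d = \sum_(i in idx) tens (bas i) (c i) :> burnside_loc p G H)).
- by move=> d; exists (fun _ => 0); rewrite tens0l big1 // => i _; rewrite tens0r.
- move=> x y hx hy d; have [c1 E1] := hx d; have [c2 E2] := hy d.
  exists (fun i => c1 i + c2 i); rewrite tensDl E1 E2 -big_split.
  by apply: eq_bigr => i _; rewrite tensDr.
- move=> K al sKG saH d; have [hi ->] := hclass_bas sKG saH.
  exists (fun i => if i == (K, rs K al) then d else 0).
  rewrite (bigD1 _ hi) /= eqxx big1 ?addr0 // => i /andP[_ /negbTE->].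
  exact: tens0r.
Qed.

(** At the top order k only classes equal to [bas j] have a nonzero mark at j, so a vanishing mark
    forces their coefficients to sum to 0. Conjugate pairs are listed separately in [idx], hence the
    grouping by equal classes; [tau] selects a part of the level closed under equality of
    classes. *)
Lemma bas_peel k (tau : pred I) (Q : pred I) (c : I -> Zloc p) :
  (forall i, Q i -> (#|i.1| <= k)%N) ->
  {in idx &, forall i j, #|i.1| = k -> Q j -> bas i = bas j -> #|j.1| = k -> tau j -> Q i && tau i} ->
  {in idx, forall j, Q j -> #|j.1| = k -> tau j ->
     mark j.1 j.2 id (\sum_(i in idx | Q i) tens (bas i) (c i)) = 0} ->
  \sum_(i in idx | [&& Q i, #|i.1| == k & tau i]) tens (bas i) (c i) = 0 :> burnside_loc p G H.
Proof.
move=> Qk cl mj; pose L := [set i in idx | [&& Q i, #|i.1| == k & tau i]].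
have LP i : reflect [/\ i \in idx, Q i, #|i.1| = k & tau i] (i \in L).
  rewrite [i \in L]in_set; apply: (iffP and4P) => [[? ? /eqP ? ?]|[? ? /eqP ? ?]]; by split.
have c0 j : j \in L -> \sum_(i in L | bas i == bas j) c i = 0.
  case/LP=> hj Qj kj tj; have := mj j hj Qj kj tj; rewrite mark_sum => E.
  apply: val_inj; rewrite [LHS](raddf_sum (val : Zloc p -> rat)); transitivity (0 : rat); last by [].
  have nz := kmark_bas_self hj.
  have nzq : (kmark j.1 j.2 id (bas j))%:~R != 0 :> rat by rewrite intr_eq0.
  apply: (mulfI nzq); rewrite mulr0 -[RHS]E mulr_sumr.
  rewrite big_mkcond [RHS]big_mkcond /=; apply: eq_bigr => i _; rewrite mark_tens.
  case: ifP => [/andP[/LP[hi Qi ki ti] /eqP Eb]|/negbT nL].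
    by rewrite hi Qi Eb.
  case: ifP => // /andP[hi Qi]; have [->|nz'] := eqVneq (kmark j.1 j.2 id (bas i)) 0.
    by rewrite mul0r.
  have le : (#|i.1| <= #|j.1|)%N by rewrite kj Qk.
  have [ki Eb] := kmark_bas_eq hi hj le nz'; rewrite kj in ki.
  have /andP[_ ti] := cl i j hi hj ki Qj Eb kj tj.
  by case/negP: nL; rewrite Eb eqxx andbT; apply/LP.
(* [g] picks one index for each class occurring in [L]. *)
have [g gP gE] : exists2 g : I -> I, forall i, i \in L -> (g i \in L) && (bas (g i) == bas i) &
    forall i j, i \in L -> bas i = bas j -> g i = g j.
  exists (fun i => odflt i [pick j in L | bas j == bas i]) => [i Li|i j Li Eb].
    by case: pickP => [j //|no] /=; have := no i; rewrite /= Li eqxx.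
  have -> : [pick j0 in L | bas j0 == bas i] = [pick j0 in L | bas j0 == bas j].
    by apply: eq_pick => l; rewrite Eb.
  by case: pickP => [//|no]; have := no i; rewrite /= Li Eb eqxx.
transitivity (\sum_(i in L) tens (bas i) (c i) : burnside_loc p G H).
  by apply: eq_bigl => i; rewrite [RHS]in_set.
rewrite (partition_big g (mem L)) /=; last by move=> i /gP/andP[].
apply: big1 => j Lj.
have [gj|gj] := eqVneq (g j) j.
  transitivity (\sum_(i in L | bas i == bas j) tens (bas j) (c i) : burnside_loc p G H).
    apply: eq_big => [i|i /andP[Li /eqP gi]].
      case: (boolP (i \in L)) => //= Li; apply/eqP/eqP => [gi|Eb].
        by have /andP[_ /eqP] := gP i Li; rewrite gi.
      by rewrite (gE i j).
    by have /andP[_ /eqP] := gP i Li; rewrite gi => ->.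
  by rewrite -tens_sumr c0 ?tens0r.
rewrite big_pred0 // => i; apply/negP => /andP[Li /eqP gi].
have /andP[_ /eqP] := gP i Li; rewrite gi => Eb.
by move: gj; rewrite (gE j i Lj Eb) gi eqxx.
Qed.

(** Levels are peeled off from |G| downwards until the sum is empty. *)
Lemma mark_inj0 x :
  (forall (P : {group gT}) (a : {ffun gT -> hT}), P \subset G -> a \in homs P H -> mark P a id x = 0) ->
  x = 0.
Proof.
have [c Ex] := bas_span x; move=> m0.
have key n : x = \sum_(i in idx | (#|i.1| + n <= #|G|)%N) tens (bas i) (c i).
  elim: n => [|n IH].
    rewrite Ex; apply: eq_bigl => i; rewrite addn0.
    by case: (boolP (i \in idx)) => //; rewrite inE => /andP[/subset_leq_card ->].
  have [lt|le] := ltnP #|G| n.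
    by rewrite IH !big_pred0 // => i; apply/negP => /andP[_]; lia.
  have := @bas_peel (#|G| - n) xpredT (fun i => (#|i.1| + n <= #|G|)%N) c.
  rewrite -IH => peel; rewrite {1}IH (bigID (fun i : I => #|i.1| == #|G| - n)%N) /=.
  rewrite [X in X + _](_ : _ = 0) ?add0r; last first.
    rewrite -[RHS]peel; first by apply: eq_bigl => i; rewrite andbT andbA.
    - by move=> i Qi; rewrite -(leq_add2r n) subnK.
    - by move=> i j _ _ ki _ _ _ _; rewrite ki subnK ?leqnn.
    - by move=> j; rewrite inE => /andP[sG hj] _ _ _; apply: m0.
  apply: eq_bigl => i; rewrite -andbA; congr andb.
  by rewrite addnS ltn_neqAle andbC -(eqn_add2r n) subnK.
by rewrite (key #|G|.+1) big_pred0 // => i; apply/negP => /andP[_]; lia.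
Qed.

Lemma mark_inj x y :
  (forall (P : {group gT}) (a : {ffun gT -> hT}), P \subset G -> a \in homs P H ->
     mark P a id x = mark P a id y) -> x = y.
Proof.
move=> mxy; apply/eqP; rewrite -subr_eq0; apply/eqP; apply: mark_inj0 => P a sPG ha.
by rewrite markB mxy // subrr.
Qed.

End Span.
End Basis.

(** * The Nishida ideal in terms of marks *)

Section NishidaMarks.
Variables (p : nat) (gT : finGroupType) (S : {group gT}).
Implicit Type x : burnside_loc p S S.

(** A nonzero mark of [P, psi] at an injective [a] on S forces P = S and psi injective, hence psi(P)
    = S. *)
Lemma nishida_mark x (a : {ffun gT -> gT}) :
  nishida_loc x -> a \in homs S S -> {in S &, injective a} -> mark S a id x = 0.
Proof.
move=> Jx ha aI; elim: Jx => [|y z _ IHy _ IHz|_ [v [c [Jv ->]]]].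
- by rewrite mark0.
- by rewrite markB IHy IHz subr0.
rewrite mark_tens; suff -> : kmark S a id v = 0 by rewrite mul0r.
elim: Jv => [|y z _ IHy _ IHz|_ [P [psi [sPS [spS [neq ->]]]]]].
- exact: morphB_0 (kmarkB _ _ _).
- by rewrite kmarkB IHy IHz subr0.
have [hi ->] := hclass_bas sPS spS.
apply/eqP/negPn/negP => /(kmark_bas hi (proj1 (homs_ishom ha)) (subxx S)) [s [t [Ss St f]]].
apply: neq; have EP : P = S.
  apply/group_inj/eqP; rewrite eqEsubset sPS; apply/subsetP => q Sq.
  have [] := f (q ^ t)%g; first by rewrite groupJ.
  by rewrite conjgK.
subst P; apply/eqP; rewrite eqEcard spS /= card_injm //.
apply/subsetP => q /morphpreP[Sq] /set1P pq; rewrite inE; apply/eqP.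
have [Sqt] := f (q ^ t)%g (groupJ Sq St).
rewrite conjgK /= rsE // pq conj1g => a1.
have : (q ^ t)%g = 1%g by apply: aI; rewrite ?groupJ // a1 (ishom1 (homs_ishom ha)).
by move/(canRL (conjgK t)); rewrite conj1g.
Qed.

(** By [bas_peel] the terms with P = S and an injective map cancel. Each remaining generator has an
    image smaller than S. *)
Lemma mark_nishida x :
  (forall a : {ffun gT -> gT}, a \in homs S S -> {in S &, injective a} -> mark S a id x = 0) ->
  nishida_loc x.
Proof.
move=> m0; have [c Ex] := bas_span x.
pose tau (i : {group gT} * {ffun gT -> gT}) := `[< {in S &, injective i.2} >].
pose Q (i : {group gT} * {ffun gT -> gT}) := (#|i.1| <= #|S|)%N.
have {}Ex : x = \sum_(i in idx S S | Q i) tens (bas S S i) (c i).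
  rewrite Ex; apply: eq_bigl => i; case: (boolP (i \in _)) => //.
  by rewrite inE /Q => /andP[/subset_leq_card ->].
have iS i : i \in idx S S -> #|i.1| = #|S| -> i.1 = S.
  rewrite inE => /andP[sS _] E; apply/group_inj/eqP; rewrite eqEcard sS /= E.
  exact: leqnn.
have := @bas_peel _ _ S S p #|S| tau Q c; rewrite -Ex => peel.
rewrite Ex (bigID (fun i : {group gT} * {ffun gT -> gT} => (#|i.1| == #|S|) && tau i)) /=.
rewrite [X in X + _](_ : _ = 0) ?add0r; last first.
  rewrite -[RHS]peel; first by apply: eq_bigl => i; rewrite -andbA.
  - by [].
  - move=> i j hi hj ki Qj Eb kj /asboolP tj; apply/andP; split; first by rewrite /Q ki.
    have := kmark_bas_self hj; rewrite -Eb.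
    move: (hj); rewrite inE => /andP[sjS /homs_ishom[jH _]].
    case/(kmark_bas hi jH sjS) => s [t [Ss St]].
    rewrite (iS i hi ki) (iS j hj kj) => f.
    apply/asboolP => u v Su Sv Euv; apply: (conjg_inj t); apply: tj; rewrite ?groupJ //.
    have [_ ->] := f _ (groupJ Su St); have [_ ->] := f _ (groupJ Sv St).
    by rewrite !conjgK Euv.
  - move=> [P a] hj _ kj /asboolP tj; move: (hj); rewrite inE /= => /andP[_].
    rewrite [P](iS _ hj kj) => ha; exact: m0.
apply: (big_ind (@nishida_loc p gT S)) => [|u v Ju Jv|i /andP[/andP[hi _] ni]].
- exact: addspan0.
- by rewrite -[v]opprK -[- v]add0r; apply: addspanB => //; apply: addspanB => //; apply: addspan0.
apply: addspan_gen; exists (bas S S i), (c i); split=> //; apply: addspan_gen.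
have [al [sKG [saH [E ->]]]] := basP hi.
exists i.1, al, sKG, saH; split=> // Eim; move: ni; apply/negP; rewrite negbK.
have le : (#|S| <= #|i.1|)%N by rewrite -{1}Eim leq_morphim.
have ki : #|i.1| = #|S| by apply/eqP; rewrite eqn_leq subset_leq_card.
rewrite ki eqxx; apply/asboolP => u v; rewrite -{1 2}(iS i hi ki) => iu iv.
rewrite -!E //; move: u v iu iv; apply/injmP; rewrite -card_im_injm.
by rewrite Eim ki.
Qed.

End NishidaMarks.

(** * Stable elements *)

Lemma zloc_Vp (p : nat) : prime p -> p%:R^-1 \notin zloc_pred p.
Proof.
move=> p_prime; apply/negP => cp; have : coprime p `|denq p%:R^-1| by [].
have p0 : p%:R != 0 :> rat by rewrite pnatr_eq0 -lt0n prime_gt0.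
have : (numq p%:R^-1)%:~R * p%:R = (denq p%:R^-1)%:~R :> rat by rewrite numqE mulrAC mulVf // mul1r.
rewrite -[p%:R in X in X = _]/(p%:Z%:~R) -intrM => /eqP; rewrite eqr_int => /eqP <-.
by rewrite abszM coprimeMr [coprime p `|p|]/coprime /= gcdnn eqn_leq leqNgt prime_gt1 ?andbF.
Qed.

Lemma orbit_sum (p : nat) (aT : finGroupType) (rT : finType) (D : {group aT})
    (to : action D rT) (A : {group aT}) (X : {set rT}) (g : rT -> rat) (d : rat) :
  [acts A, on X | to] -> (forall x a, x \in X -> a \in A -> g (to x a) = g x) ->
  (forall x, x \in X -> #|orbit to A x|%:R * g x / d \in zloc_pred p) ->
  (\sum_(x in X) g x) / d \in zloc_pred p.
Proof.
move=> aX gI gd.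
rewrite (partition_big_imset (orbit to A)) /= mulr_suml rpred_sum // => _ /imsetP[x Xx ->].
rewrite (_ : \sum_(_ in _ | _) _ = #|orbit to A x|%:R * g x) ?gd //.
have sA := acts_dom aX.
rewrite mulr_natl -sumr_const; apply: eq_big => [y|y /andP[Xy /eqP Ey]].
  apply/andP/idP => [[Xy /eqP <-]|yx]; first exact: orbit_refl.
  split; first by apply: acts_in_orbit yx Xx.
  by apply/eqP/orbit_in_eqP.
have : y \in orbit to A x by rewrite -Ey orbit_refl.
by case/orbitP => a Aa <-; rewrite gI.
Qed.

Section ConjAction.
Variables (aT gT : finGroupType).

Definition cact_fun (f : {ffun aT -> gT}) (s : gT) : {ffun aT -> gT} := [ffun u => f u ^ s]%g.

Lemma cact_is_action : is_action setT cact_fun.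
Proof.
apply: is_total_action => [f|f s t]; apply/ffunP => u; rewrite !ffunE; first exact: conjg1.
exact: conjgM.
Qed.
Canonical cact := Action cact_is_action.

Lemma cactE f s u : cact f s u = (f u ^ s)%g.
Proof. by rewrite /= ffunE. Qed.

Lemma cact_rs (P : {set aT}) (f : aT -> gT) s : cact (rs P f) s = rs P (fun u => f u ^ s)%g.
Proof. by apply/ffunP => u; rewrite cactE !ffunE; case: ifP => //; rewrite conj1g. Qed.

Variables (S : {group gT}) (P : {group aT}).

Lemma acts_homs : [acts S, on homs P S | cact].
Proof.
apply/actsP => s Ss f; apply/homsP/homsP => -[hf f1].
  split=> [|u Pu]; last by have := f1 u Pu; rewrite cactE => /(canRL (conjgK s)); rewrite conj1g.
  have [fS fM] := hf; split=> [u Pu|u v Pu Pv].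
    by have := fS u Pu; rewrite cactE groupJr.
  by have := fM u v Pu Pv; rewrite !cactE -conjMg => /conjg_inj.
split=> [|u Pu]; last by rewrite cactE f1 // conj1g.
have [fS fM] := hf; split=> [u Pu|u v Pu Pv]; first by rewrite cactE groupJ ?fS.
by rewrite !cactE fM // conjMg.
Qed.

(** The stabiliser of f under conjugation of values is the centraliser of f(P). *)
Lemma card_orbit_cact (f : aT -> gT) :
  (#|orbit cact S (rs P f)| * #|'C_S(f @: P)|)%N = #|S|.
Proof.
rewrite -(card_orbit_stab cact S (rs P f)); congr (_ * #|pred_of_set _|)%N.
apply/setP => s; rewrite 2!inE; congr andb; rewrite (sameP astab1P eqP) cact_rs.
apply/centP/eqP => [Cs|E].
  apply: eq_rs => u Pu; apply/conjg_fixP/commgP/commute_sym; apply: Cs; exact: imset_f.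
move=> _ /imsetP[u Pu ->]; apply/commute_sym/commgP/conjg_fixP.
exact: (rs_eqP E).
Qed.

Lemma orbit_homs (f : aT -> gT) a : ishom P S f -> a \in orbit cact S (rs P f) -> a \in homs P S.
Proof. by move=> hf ao; apply: acts_in_orbit acts_homs ao (rs_homs hf). Qed.

End ConjAction.

(** A proper subgroup of a p-group is properly contained in its normaliser, so Q = N_S(P) serves in
    the step. *)
Lemma desc_ind (p : nat) (gT : finGroupType) (S : {group gT}) (R : {group gT} -> Prop) :
  p.-group S -> R S ->
  (forall P Q : {group gT}, Q \subset S -> P <| Q -> P \proper Q -> R Q -> R P) ->
  forall P : {group gT}, P \subset S -> R P.
Proof.
move=> pS RS Rstep P; have [n] := ubnP (#|S| - #|P|)%N.
elim: n P => // n IH P le sPS.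
have [EPS|neq] := eqVneq P S; first by rewrite EPS.
have prop : P \proper S by rewrite properEneq sPS andbT; apply: contraNneq neq => /group_inj->.
have pN := nilpotent_proper_norm (pgroup_nil pS) prop.
apply: (Rstep P 'N_S(P)%G) => //; first exact: subsetIl.
  by apply: normalSG.
apply: IH; last exact: subsetIl.
have := proper_card pN; have /= := subset_leq_card (subsetIl S 'N(P)); have := subset_leq_card sPS.
by move: le => /=; lia.
Qed.

Lemma ishom_inj (aT hT : finGroupType) (P : {group aT}) (H : {set hT}) f :
  ishom P H f -> {in P, forall u, f u = 1%g -> u = 1%g} -> {in P &, injective f}.
Proof.
move=> hf k u v Pu Pv E; apply/eqP; rewrite eq_mulgV1; apply/eqP.
apply: k; first by rewrite groupM ?groupV.
by case: (hf) => _ ->; rewrite ?groupV // (ishomV hf) // E mulgV.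
Qed.

Lemma hom_inv (aT hT : finGroupType) (P : {group aT}) (H : {set hT}) f :
  ishom P H f -> {in P &, injective f} ->
  exists (R : {group hT}) (g : hT -> aT), [/\ R = f @: P :> {set hT}, ishom R P g,
    {in P, cancel f g} & {in R, cancel g f}].
Proof.
move=> [fH fM] inj; pose phi := Morphism fM.
have injphi : 'injm phi by apply/injmP.
exists (phi @* P)%G, (invm injphi); split.
- by rewrite /= morphimEdom.
- split; last exact: morphM.
  move=> v /morphimP[u Pu _ ->]; suff -> : invm injphi (phi u) = u by [].
  exact: (invmE injphi Pu).
- by move=> u Pu; exact: (invmE injphi Pu).
- by move=> v Rv; exact: (invmK injphi Rv).
Qed.

Lemma ishom_im_sub (aT hT : finGroupType) (P : {set aT}) (H : {set hT}) f :
  ishom P H f -> f @: P \subset H.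
Proof. by move=> [fH _]; apply/subsetP => _ /imsetP[u Pu ->]; apply: fH. Qed.

Section RightStable.
Variables (p : nat) (gT hT : finGroupType) (S : {group gT}) (H : {group hT}).
Variable F : fusion_system S.

(** Composing with [P, phi] replaces the right argument id of a mark by phi, and marks separate
    elements. *)
Lemma right_stableP (x : burnside_loc p S H) : right_stable F x <->
  forall (P : {group gT}) f, inF F P f -> forall a, ishom P H a -> mark P a f x = mark P a id x.
Proof.
split=> [st P f Ff a ha|st P phi Fphi].
  have [phi [Fphi E]] := (inFE F P f).1 Ff.
  have := congr1 (mark P a id) (st P phi Fphi); rewrite !mark_hom // => Em.
  transitivity (mark P a (phi \o id) x); first by apply: eq_mark => // u Pu; rewrite /= E.
  by rewrite Em.
apply: mark_inj => Q a sQP ha.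
have QP : {in Q, forall u, id u \in P} by apply/subsetP.
rewrite !mark_hom //.
by rewrite (st Q phi (inF_res sQP (fhom_inF Fphi)) a (homs_ishom ha)).
Qed.

Variable w : burnside_loc p S S.
Hypotheses (w_stab : forall (P : {group gT}) f, inF F P f -> forall a, ishom P S a ->
              mark P a f w = mark P a id w)
  (w_supp : forall (P : {group gT}) f, P \subset S -> ishom P S f -> mark P f id w != 0 -> inF F P f)
  (w_sum : forall P : {group gT}, P \subset S -> \sum_(a in homs P S) mark P a id w = #|S|%:R).

(** In the composition formula for x o w only [b] in F contribute. For stable x each term has the
    factor mark of x at (a, id), and the other factors sum to |S|. Conversely, x o w is stable
    because w is. *)
Lemma right_stable_comp (x : burnside_loc p S H) : right_stable F x <-> comp_loc x w = x.
Proof.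
have S0 : #|S|%:R != 0 :> rat by rewrite pnatr_eq0 -lt0n cardG_gt0.
rewrite right_stableP; split=> [st|Ex P f Ff a ha].
  apply: mark_inj => P a sPS ha; have [aH _] := homs_ishom ha.
  apply: (mulfI S0); rewrite (mark_comp x w aH (ishom_id sPS)).
  transitivity (\sum_(b in homs P S) mark P a id x * mark P b id w).
    apply: eq_bigr => b hb; have [->|nz] := eqVneq (mark P b id w) 0; first by rewrite !mulr0.
    by rewrite st //; [apply: w_supp => // | ]; apply: homs_ishom.
  by rewrite -mulr_sumr w_sum // mulrC.
have sPS := inF_sub Ff; have hf := inF_ishom Ff; have [aH _] := ha.
apply: (mulfI S0); rewrite -Ex (mark_comp x w aH (ishom_id sPS)) (mark_comp x w aH hf).
by apply: eq_bigr => b hb; rewrite w_stab //; apply: homs_ishom.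
Qed.

End RightStable.

(** * The fusion system stabilising a given element *)

Section Stabilizer.
Variables (p : nat) (gT : finGroupType) (S : {group gT}) (w : burnside_loc p S S).
Implicit Types (P Q R : {group gT}).

Definition stab (P : {set gT}) (b : gT -> gT) : Prop :=
  forall a, ishom P S a -> mark P a b w = mark P a id w.

Lemma eq_stab (P : {set gT}) b b' : {in P, b =1 b'} -> stab P b -> stab P b'.
Proof. by move=> bb st a ha; rewrite -st //; apply: eq_mark => // u Pu; rewrite bb. Qed.

Lemma ishom_factor P (H : {set gT}) (f a : gT -> gT) : ishom P H f -> {in P &, injective f} -> ishom P S a ->
  exists2 a', ishom (f @: P) S a' & {in P, a' \o f =1 a}.
Proof.
move=> hf inj ha; have [R [g [ER hg fK gK]]] := hom_inv hf inj.
exists (a \o g); last by move=> u Pu; rewrite /= fK.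
by rewrite -ER; apply: ishom_comp hg ha.
Qed.

Lemma stab_comp P (f g : gT -> gT) : ishom P S f -> {in P &, injective f} ->
  stab P f -> stab (f @: P) g -> stab P (g \o f).
Proof.
move=> hf inj stf stg a ha; have [a' ha' E] := ishom_factor hf inj ha.
rewrite -(stf a ha); transitivity (mark P (a' \o f) (g \o f) w).
  by apply: eq_mark => // u Pu; rewrite E.
rewrite -mark_reparam stg // mark_reparam.
by apply: eq_mark => // u Pu; rewrite E.
Qed.

Lemma stab_uncomp P (f g : gT -> gT) : ishom P S f -> {in P &, injective f} ->
  stab P (g \o f) -> stab (f @: P) g -> stab P f.
Proof.
move=> hf inj stgf stg a ha; have [a' ha' E] := ishom_factor hf inj ha.
rewrite -(stgf a ha); transitivity (mark P (a' \o f) (id \o f) w).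
  by apply: eq_mark => // u Pu; rewrite E.
rewrite -mark_reparam -stg // mark_reparam.
by apply: eq_mark => // u Pu; rewrite E.
Qed.

(** Stability is imposed at every subgroup R of P because restrictions of morphisms have to be
    morphisms. *)
Definition rst_hom (P Q : {group gT}) (f : {morphism P >-> gT}) : Prop :=
  [/\ P \subset S, Q \subset S, 'injm f, (f @* P)%g \subset Q &
      forall R : {group gT}, R \subset P -> stab R f].

Lemma rst_ishom P Q (f : {morphism P >-> gT}) : rst_hom Q f -> ishom P S f.
Proof. by case=> _ sQS _ im _; apply: morph_ishom; apply: subset_trans im sQS. Qed.

Lemma rst_comp P Q R (f : {morphism P >-> gT}) (g : {morphism Q >-> gT}) (h : {morphism P >-> gT}) :
  rst_hom Q f -> rst_hom R g -> {in P, forall u, h u = g (f u)} -> rst_hom R h.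
Proof.
move=> rf rg E; have hf := rst_ishom rf; have [sPS sQS injf imf stf] := rf.
have [_ sRS injg img stg] := rg.
have fQ u : u \in P -> f u \in Q by move=> Pu; rewrite (subsetP imf) // mem_morphim.
split=> //.
- apply/injmP => u v Pu Pv; rewrite !E // => /(injmP injg) Ef.
  by apply: (injmP injf) => //; apply: Ef; apply: fQ.
- apply/subsetP => _ /morphimP[u Pu _ ->]; rewrite E // (subsetP img) // mem_morphim ?fQ //.
- move=> T sTP; apply: (@eq_stab _ (g \o f)); first by move=> u Tu; rewrite E // (subsetP sTP).
  have hfT := ishom_sub sTP hf.
  have injT : {in T &, injective f}.
    by move=> u v Tu Tv; apply: (injmP injf); apply: (subsetP sTP).
  apply: stab_comp => //; first exact: stf.
  have [T' ET'] := ishom_imgroup hfT; rewrite -ET'; apply: stg; rewrite ET'.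
  by apply/subsetP => _ /imsetP[u Tu ->]; apply: fQ; apply: (subsetP sTP).
Qed.

Lemma rst_conj P Q x (f : {morphism P >-> gT}) :
  P \subset S -> Q \subset S -> x \in S ->
  {in P, forall u, x * u * x^-1 \in Q}%g ->
  {in P, forall u, f u = x * u * x^-1}%g -> rst_hom Q f.
Proof.
move=> sPS sQS Sx PQ fE; split=> //.
- apply/injmP => u v Pu Pv; rewrite !fE // => /mulIg; exact: mulgI.
- by apply/subsetP => _ /morphimP[u Pu _ ->]; rewrite fE // PQ.
- move=> R sRP a ha; transitivity (mark R a (fun u => id u ^ x^-1)%g w).
    by apply: eq_mark => // u Ru; rewrite fE ?conjVE // (subsetP sRP).
  rewrite mark_conjr ?groupV // => u Ru.
  by rewrite (subsetP sPS) // (subsetP sRP).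
Qed.

Lemma rst_iso P Q (f : {morphism P >-> gT}) : rst_hom Q f ->
  rst_hom (f @* P)%G f /\
  forall g : {morphism f @* P >-> gT}, {in P, cancel f g} -> rst_hom P g.
Proof.
move=> rf; have [sPS sQS inj im st] := rf; split.
  split=> //; exact: subset_trans im sQS.
move=> g fK.
have gK : {in f @* P, cancel g f} by move=> _ /morphimP[u Pu _ ->]; rewrite fK.
split=> //.
- exact: subset_trans im sQS.
- by apply/injmP => u v iu iv E; rewrite -[u]gK // E gK.
- by apply/subsetP => _ /morphimP[_ /morphimP[u Pu _ ->] _ ->]; rewrite fK.
move=> R sRim a ha; pose R0 := (g @* R)%G.
have sR0 : R0 \subset P.
  apply/subsetP => _ /morphimP[v vi Rv ->]; case/morphimP: vi => u Pu _ ->; by rewrite fK.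
have ER : R = f @: R0 :> {set gT}.
  apply/setP => v; apply/idP/imsetP => [Rv|[_ /morphimP[u iu Ru ->] ->]].
    by exists (g v); rewrite ?gK ?mem_morphim // (subsetP sRim).
  by rewrite gK.
rewrite ER [LHS]mark_reparam [RHS]mark_reparam.
have haf : ishom R0 S (a \o f).
  apply: ishom_comp ha; split=> [u R0u|u v R0u R0v]; last by rewrite morphM ?(subsetP sR0).
  by rewrite ER imset_f.
rewrite [RHS](st R0 sR0 _ haf); apply: eq_mark => // u R0u.
by rewrite /= fK // (subsetP sR0).
Qed.

Lemma rst_sub P Q (f : {morphism P >-> gT}) : rst_hom Q f ->
  [/\ P \subset S, Q \subset S, 'injm f & (f @* P)%g \subset Q].
Proof. by case. Qed.

(* The largest fusion system for which w is right stable.                      *)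
Definition rst : fusion_system S :=
  FusionSystem rst_sub rst_comp rst_conj rst_iso.

Lemma inF_rst P (f : gT -> gT) : inF rst P f <->
  [/\ P \subset S, ishom P S f, {in P &, injective f} & forall R : {group gT}, R \subset P -> stab R f].
Proof.
split=> [Ff|[sPS hf inj st]].
  split; [exact: inF_sub Ff | exact: inF_ishom Ff | exact: inF_inj Ff | ].
  have [phi [[_ _ _ _ st] E]] := (inFE _ P f).1 Ff.
  by move=> R sRP; apply: eq_stab (st R sRP) => u Ru; rewrite E // (subsetP sRP).
have [fS fM] := hf; apply/inFE; exists (Morphism fM); split=> //; split=> //.
  exact/injmP.
by rewrite morphimEdom; apply: ishom_im_sub hf.
Qed.

End Stabilizer.

(** * The fusion system of a Frobenius idempotent *)

Section MarkOrbits.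
Variables (p : nat) (gT : finGroupType) (S : {group gT}) (w : burnside_loc p S S).
Hypotheses (p_prime : prime p) (pS : p.-group S).
Implicit Types (P Q R : {group gT}) (f b : gT -> gT).

Lemma natr_card_neq0 (A : {group gT}) : #|A|%:R != 0 :> rat.
Proof. by rewrite pnatr_eq0 -lt0n cardG_gt0. Qed.

Lemma natr_card_cent_neq0 (A : {set gT}) : #|('C_S(A))%g|%:R != 0 :> rat.
Proof. by rewrite pnatr_eq0 -lt0n cardG_gt0. Qed.

Lemma mark_cact P b (a : {ffun gT -> gT}) s : a \in homs P S -> ishom P S b -> s \in S ->
  mark P (cact gT gT a s) b w = mark P a b w.
Proof.
move=> ha [bS _] Ss; have [[aS _] _] := homsP _ _ _ ha.
rewrite -(mark_conjl w aS bS Ss); apply: eq_mark => // u Pu.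
by rewrite cactE.
Qed.

(** Marks are constant on the S-conjugates of f, of which there are |S| / |C_S(f(P))|. *)
Lemma sum_orbit P f b : ishom P S f -> ishom P S b ->
  \sum_(a in homs P S | a \in orbit (cact gT gT) S (rs P f)) mark P a b w =
  #|S|%:R / #|('C_S(f @: P))%g|%:R * mark P f b w.
Proof.
move=> hf hb; have hrf := rs_homs hf.
transitivity (\sum_(a in orbit (cact gT gT) S (rs P f)) mark P f b w).
  apply: eq_big => [a|a /andP[ha /orbitP[s Ss <-]]].
    by case: (boolP (a \in orbit _ _ _)) => ao; rewrite ?andbF // (orbit_homs hf ao).
  rewrite mark_cact //; apply: eq_mark => // u Pu; exact: rsE.
rewrite sumr_const -[LHS]mulr_natl; congr (_ * _).
apply: (canRL (mulfK _)); first exact: natr_card_cent_neq0.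
by rewrite -natrM card_orbit_cact.
Qed.

Lemma orbit_precomp P f a h u : ishom P S f -> u \in 'N(P)%g ->
  (exists2 s, s \in S & {in P, forall v, f (v ^ u^-1) = f v ^ s}%g) -> h \in S ->
  a \in orbit (cact gT gT) S (rs P f) ->
  rs P (fun v => (a (v ^ u^-1)) ^ h)%g \in orbit (cact gT gT) S (rs P f).
Proof.
move=> hf Nu [s Ss E] Sh /orbitP[t St <-]; apply/orbitP; exists (s * t * h)%g.
  by rewrite !groupM.
rewrite cact_rs; apply: eq_rs => v Pv.
by rewrite cactE rsE ?memJ_norm ?groupV // E // !conjgM.
Qed.

(** [mark_sum_dvd] applied to the family of S-conjugates of f. *)
Lemma mark_unit_int P f b : P \subset S -> ishom P S f -> ishom P S b ->
  mark P f b w / #|('C_S(f @: P))%g|%:R \in zloc_pred p.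
Proof.
move=> sPS hf hb; have pP := pgroupS sPS pS.
have := mark_sum_dvd (B := fun a => a \in orbit (cact gT gT) S (rs P f)) p_prime pS w pP hb.
have -> : mark P f b w / #|('C_S(f @: P))%g|%:R =
    #|S|%:R / #|('C_S(f @: P))%g|%:R * mark P f b w / #|S|%:R.
  by field; rewrite natr_card_neq0 natr_card_cent_neq0.
rewrite sum_orbit //; apply=> a h ha Sh /orbitP[s Ss <-]; apply/orbitP; exists (s * h)%g; first exact: groupM.
by rewrite !cact_rs; apply: eq_rs => u Pu; rewrite rsE // conjgM.
Qed.

Lemma mark_precomp P (a : gT -> gT) u : P \subset S -> ishom P S a -> u \in 'N_S(P)%g ->
  mark P (fun v => a (v ^ u))%g id w = mark P a id w.
Proof.
move=> sPS ha /setIP[Su Nu].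
have idS : {in P, forall v, id v \in S} by apply/subsetP.
rewrite -[LHS](mark_conjr (fun v => a (v ^ u))%g w idS Su).
rewrite -[LHS](@mark_reparam _ _ _ _ _ _ _ P (fun v => v ^ u)%g a id w).
by congr (mark _ _ _ _); apply: (normP Nu).
Qed.

End MarkOrbits.

(** The maps in F from P onto R are the composites of [f0] with Aut_F(R). *)
Lemma card_inF_onto (gT : finGroupType) (S : {group gT}) (F : fusion_system S)
    (P R : {group gT}) (f0 : gT -> gT) : inF F P f0 -> f0 @: P = R ->
  #|[set f in homs P S | `[< inF F P f >] && (f @: P == R)]| = #|AutF F R|.
Proof.
move=> F0 E0; have [g0 [G0 fK gK]] := inF_inv F0 E0.
have f0R u : u \in P -> f0 u \in R by move=> Pu; rewrite -E0 imset_f.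
have gE0 : g0 @: R = P.
  apply/setP => u; apply/imsetP/idP => [[v]|Pu].
    by rewrite -E0 => /imsetP[u' Pu' ->] ->; rewrite fK.
  by exists (f0 u); rewrite ?fK ?f0R.
rewrite -(card_in_imset (f := fun a : {perm gT} => rs P (a \o f0)) (D := AutF F R)); last first.
  move=> a b /AutFP[Aa _] /AutFP[Ab _] E; apply: (eq_Aut Aa Ab) => v.
  by rewrite -E0 => /imsetP[u Pu ->]; apply: (rs_eqP E Pu).
apply: eq_card => f; apply/idP/imsetP => [|[a /AutFP[Aa Fa] ->]].
  case/setIdP => hf; case/andP=> /asboolP Ff /eqP Ef.
  have Ffg : inF F R (f \o g0) by apply: inF_comp G0 Ff _; rewrite gE0.
  have [phi [Fphi Ephi]] := (inFE F R _).1 Ffg; have [sRS _ inj _] := fhom_sub Fphi.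
  have im : (phi @* R)%g = R by rewrite morphimEdom (eq_in_imset Ephi) imset_comp gE0.
  exists (aut inj im).
    apply/AutFP; split; first exact: Aut_aut.
    by apply: eq_inF Ffg => v Rv; rewrite autE // Ephi.
  apply: (homs_eq hf); first apply: rs_homs; last first.
    by move=> u Pu; rewrite rsE //= autE ?f0R // Ephi ?f0R //= fK.
  apply: eq_ishom (homs_ishom hf); first exact: groupM.
  by move=> u Pu; rewrite /= autE ?f0R // Ephi ?f0R //= fK.
have Faf : inF F P (a \o f0) by apply: inF_comp F0 Fa _; rewrite E0.
have Err : {in P, a \o f0 =1 rs P (a \o f0)} by move=> u Pu; rewrite rsE.
apply/setIdP; split; first by apply: rs_homs; apply: inF_ishom Faf.
apply/andP; split.
  by apply/asboolP; apply: eq_inF Faf.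
rewrite -(eq_in_imset Err) imset_comp E0.
have -> : [set a x | x in R] = (autm_morphism Aa @* R)%g by rewrite morphimEdom.
by rewrite im_autm.
Qed.

Section Frobenius.
Variables (p : nat) (gT : finGroupType) (S : {group gT}) (w : burnside_loc p S S).
Hypotheses (p_prime : prime p) (pS : p.-group S).
Implicit Types (P Q R : {group gT}).

Hypothesis w_idem : comp_loc w w = w.
Hypothesis w_frob : forall P (a b : gT -> gT), P \subset S -> ishom P S a -> ishom P S b ->
  mark P b id w != 0 -> mark P a b w = mark P a id w.
Variable al0 : gT -> gT.
Hypotheses (al0_hom : ishom S S al0) (al0_inj : {in S &, injective al0})
  (al0_mark : mark S al0 id w != 0).

Let E P := (\sum_(a in homs P S) mark P a id w) / #|S|%:R.

Let S0 : #|S|%:R != 0 :> rat. Proof. exact: natr_card_neq0. Qed.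

Lemma frob_stab P b : P \subset S -> ishom P S b -> mark P b id w != 0 -> stab w P b.
Proof. by move=> sPS hb nz a ha; apply: w_frob. Qed.

(** Expand w o w = w by the composition formula; reciprocity replaces the mark at (a, b) by that at
    (a, id) in every nonzero term. *)
Lemma sum_mark_idem P a : P \subset S -> ishom P S a -> mark P a id w = mark P a id w * E P.
Proof.
move=> sPS ha; have [aS _] := ha; apply: (mulfI S0).
have -> : #|S|%:R * (mark P a id w * E P) = mark P a id w * (\sum_(b in homs P S) mark P b id w).
  by rewrite /E; field; apply: S0.
rewrite -{1}w_idem (mark_comp w w aS (ishom_id sPS)) mulr_sumr; apply: eq_bigr => b hb.
have [->|nz] := eqVneq (mark P b id w) 0; first by rewrite !mulr0.
by rewrite w_frob //; apply: homs_ishom.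
Qed.

Lemma sum_mark1_ex P a : P \subset S -> ishom P S a -> mark P a id w != 0 -> E P = 1.
Proof.
by move=> sPS ha nz; apply: (mulfI nz); rewrite mulr1 -sum_mark_idem.
Qed.

(** Either E P = 1 or all marks at P vanish. The second is excluded since E P and E Q = 1 agree
    modulo p. *)
Lemma sum_mark1 P : P \subset S -> E P = 1.
Proof.
apply: (desc_ind (R := fun P => E P = 1) pS) => [|{}P Q sQS nPQ _ EQ].
  exact: sum_mark1_ex al0_mark.
have sPS := subset_trans (normal_sub nPQ) sQS.
have pQ := pgroupS sQS pS.
have := mark_sum_mod (B := xpredT) p_prime pS w pQ nPQ (ishom_id sQS).
move/(_ (fun _ _ _ _ _ _ _ => isT)).
rewrite mulrBl natrM invfM !mulrA ![_ / p%:R / _]mulrAC.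
under eq_bigl do rewrite andbT.
under [X in _ - X / _ / _ \in _]eq_bigl do rewrite andbT.
rewrite -/(E P) -/(E Q) EQ mul1r.
have [[a ha nz]|no] := pselect (exists2 a, a \in homs P S & mark P a id w != 0).
  by move=> _; apply: sum_mark1_ex (homs_ishom ha) nz.
have -> : E P = 0.
  rewrite /E big1 ?mul0r // => a ha; apply/eqP/negPn/negP => nz.
  by apply: no; exists a.
by rewrite mul0r sub0r rpredN => h; have := zloc_Vp p_prime; rewrite h.
Qed.

(** For homomorphisms into S this is p-local by [mark_unit_int], so [unitn] says that it is a unit
    of Z_(p). *)
Let nval P f := mark P f id w / #|('C_S(f @: P))%g|%:R.
Let unitn P f := nval P f / p%:R \notin zloc_pred p.

Lemma unitn_neq0 P f : unitn P f -> mark P f id w != 0.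
Proof. by apply: contraNneq => m0; rewrite /nval m0 !mul0r rpred0. Qed.

Lemma eq_unitn P f g : {in P, f =1 g} -> unitn P f = unitn P g.
Proof.
by move=> fg; rewrite /unitn /nval (eq_in_imset fg) (@eq_mark _ _ _ _ _ _ P f g id id fg).
Qed.

(** Otherwise the congruence with Q makes the sum of the unit marks at P divisible by p|S|. The
    other marks also sum to a multiple of p|S|, whereas the total is |S|. *)
Lemma ex_unitn P Q : Q \subset S -> P <| Q ->
  exists g, [/\ ishom Q S g, mark Q g id w != 0 & unitn P g].
Proof.
move=> sQS nPQ; have sPQ := normal_sub nPQ; have sPS := subset_trans sPQ sQS.
have pQ := pgroupS sQS pS.
have [[g []]|no] := pselect (exists g, [/\ ishom Q S g, mark Q g id w != 0 & unitn P g]).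
  by exists g.
have BJ (a : {ffun gT -> gT}) h u : a \in homs P S -> h \in S -> u \in Q ->
    unitn P (rs P (fun v => a (v ^ u^-1) ^ h)%g) = unitn P a.
  move=> ha Sh Qu; rewrite (eq_unitn (rsE _)) /unitn /nval.
  have -> : mark P (fun v => a (v ^ u^-1) ^ h)%g id w = mark P a id w.
    have Nu : (u^-1)%g \in 'N_S(P)%g.
      by rewrite groupV inE (subsetP sQS) // (subsetP (normal_norm nPQ)).
    have hau : ishom P S (fun v => a (v ^ u^-1))%g.
      have [aS aM] := homs_ishom ha; have /setIP[_ Nu'] := Nu.
      split=> [v Pv|v v' Pv Pv']; first by rewrite aS // memJ_norm.
      by rewrite conjMg aM // memJ_norm.
    have [auS _] := hau; have [idS _] := ishom_id sPS.
    by rewrite (mark_conjl w auS idS Sh) mark_precomp //; apply: homs_ishom.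
  have -> : [set (a (v ^ u^-1) ^ h)%g | v in P] = ((a @: P) :^ h)%g.
    apply/setP => z; apply/imsetP/imsetP => [[v Pv ->]|[_ /imsetP[v Pv ->] ->]].
      exists (a (v ^ u^-1))%g => //; apply: imset_f.
      by rewrite memJ_norm // groupV (subsetP (normal_norm nPQ)).
    exists (v ^ u)%g; last by rewrite conjgK.
    by rewrite memJ_norm // (subsetP (normal_norm nPQ)).
  by rewrite centJ -{1}(conjGid Sh) -conjIg cardJg.
have := mark_sum_mod (B := fun a => unitn P a) p_prime pS w pQ nPQ (ishom_id sQS).
move/(_ (fun a h u ha Sh Qu Ba => etrans (BJ a h u ha Sh Qu) Ba)).
rewrite [X in _ - X](_ : _ = 0) ?subr0; last first.
  rewrite big1 // => c /andP[hc Uc]; apply/eqP/negPn/negP => nz; apply: no; exists c.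
  split=> //; first exact: homs_ishom.
  by rewrite -(eq_unitn (rsE _)).
move=> h1.
(* Each S-orbit contributes |S| times a value of [nval] divisible by p. *)
have h2 : (\sum_(a in homs P S | ~~ unitn P a) mark P a id w) / (p * #|S|)%:R \in zloc_pred p.
  pose X := [set a in homs P S | ~~ unitn P a].
  rewrite (eq_bigl (fun a => a \in X)); last by move=> a; rewrite [in RHS]in_set.
  have sX a : a \in X -> a \in homs P S by rewrite in_set => /andP[].
  have actX : [acts S, on X | cact gT gT].
    apply: acts_onI => [|s a Ss Xa]; first exact: subsetT.
    have ha := sX a Xa; move: Xa; rewrite [a \in X]in_set => /andP[_ Ua].
    rewrite [_ \in X]in_set.
    rewrite (acts_act (acts_homs S P)) // ha /= -(rs_id ha) cact_rs.
    have -> : rs P (fun v => (a v ^ s)%g) = rs P (fun v => (a (v ^ 1^-1) ^ s)%g).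
      by apply: eq_rs => v _; rewrite invg1 conjg1.
    by rewrite BJ.
  apply: (orbit_sum (g := fun a : {ffun gT -> gT} => mark P a id w) actX) => [a s Xa Ss|a Xa].
    by rewrite mark_cact ?sX //; apply: ishom_id.
  have ha := sX a Xa; move: Xa; rewrite in_set => /andP[_]; rewrite /unitn negbK /nval.
  have := card_orbit_cact S P a; rewrite (rs_id ha) => Ek.
  have nz := natr_card_cent_neq0 S (a @: P).
  have -> : #|orbit (cact gT gT) S a|%:R = #|S|%:R / #|('C_S(a @: P))%g|%:R :> rat.
    by apply: (canRL (mulfK nz)); rewrite -natrM Ek.
  have p0 : p%:R != 0 :> rat by rewrite pnatr_eq0 -lt0n prime_gt0.
  set m := mark P a id w; rewrite (_ : _ * m / _ = m / #|('C_S(a @: P))%g|%:R / p%:R) //.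
  by rewrite natrM; field; rewrite p0 S0 nz.
exfalso; have := zloc_Vp p_prime; apply/negP; rewrite negbK.
have := rpredD h1 h2; rewrite -mulrDl -bigID natrM invfM mulrA mulrAC.
by rewrite -/(E P) sum_mark1 // mul1r.
Qed.

(** One injective d with nonzero mark at P suffices ([key]): reciprocity makes the mark at (d, b)
    nonzero, so the kernel of b lies in that of d. By induction the map supplied by [ex_unitn] on
    the larger Q is such a d. *)
Lemma frob_inj P b : P \subset S -> ishom P S b -> mark P b id w != 0 -> {in P &, injective b}.
Proof.
move=> sPS; move: P sPS b.
have key (P : {group gT}) d b : P \subset S -> ishom P S d -> {in P &, injective d} -> mark P d id w != 0 ->
    ishom P S b -> mark P b id w != 0 -> {in P &, injective b}.
  move=> sPS hd dI nzd hb nzb; apply: (ishom_inj hb) => u Pu bu.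
  apply: dI => //; rewrite (ishom1 hd).
  have nz : mark P d b w != 0 by rewrite w_frob.
  exact: mark_ker nz u Pu bu.
apply: (desc_ind (R := fun P => forall b, ishom P S b -> mark P b id w != 0 -> {in P &, injective b}) pS).
  by move=> b; apply: key al0_mark.
move=> P Q sQS nPQ _ IH b.
have sPQ := normal_sub nPQ.
have [g [hg nzg /unitn_neq0 nzPg]] := ex_unitn sQS nPQ.
apply: (key _ g) => //; [exact: subset_trans sPQ sQS | exact: ishom_sub hg |].
by move=> u v Pu Pv; apply: (IH g) => //; apply: (subsetP sPQ).
Qed.

(** Choose d on g(Q) with nonzero mark there and unit mark on g(P), and compare the congruences over
    the S-conjugates of d g with right arguments d g and id. Their Q-sums agree, so the mark of w at
    (d g, id) on P is congruent to a unit after normalisation. It is thus nonzero, d g is stable on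
    P, and d can be removed. *)
Lemma stab_normal P Q g : Q \subset S -> P <| Q -> ishom Q S g -> {in Q &, injective g} ->
  stab w Q g -> stab w P g.
Proof.
move=> sQS nPQ hg gI stg; have sPQ := normal_sub nPQ; have sPS := subset_trans sPQ sQS.
have pQ := pgroupS sQS pS; have hgP := ishom_sub sPQ hg.
have gIP : {in P &, injective g} by move=> u v Pu Pv; apply: gI; apply: (subsetP sPQ).
have [Q' EQ'] := ishom_imgroup hg; have [P' EP'] := ishom_imgroup hgP.
have sQ'S : Q' \subset S by rewrite EQ' ishom_im_sub.
have nP'Q' : P' <| Q'.
  rewrite /normal EP' EQ' imsetS //=; apply/subsetP => _ /imsetP[x Qx ->].
  rewrite inE; apply/subsetP => _ /imsetP[_ /imsetP[u Pu ->] ->].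
  have [_ gM] := hg; have Qu := subsetP sPQ u Pu.
  rewrite conjgE -(ishomV hg) // -!gM ?groupM ?groupV // -conjgE imset_f //.
  by rewrite memJ_norm // (subsetP (normal_norm nPQ)).
have [d [hd nzd Ud]] := ex_unitn sQ'S nP'Q'.
have hdP' := ishom_sub (normal_sub nP'Q') hd.
have sP'S := subset_trans (normal_sub nP'Q') sQ'S.
have std : stab w Q' d by apply: frob_stab.
have std' : stab w P' d by apply: frob_stab => //; apply: unitn_neq0.
pose th := d \o g.
have hth : ishom Q S th by apply: ishom_comp hd; rewrite EQ'; split=> [u Qu|]; [apply: imset_f | case: hg].
have stth : stab w Q th by apply: stab_comp => //; rewrite -EQ'.
have hthP := ishom_sub sPQ hth.
pose B := fun a : {ffun gT -> gT} => a \in orbit (cact gT gT) S (rs P th).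
have BJ (a : {ffun gT -> gT}) h u : a \in homs P S -> h \in S -> u \in Q -> B a ->
    B (rs P (fun v => a (v ^ u^-1) ^ h)%g).
  move=> _ Sh Qu; apply: orbit_precomp => //; first by rewrite (subsetP (normal_norm nPQ)).
  have [thS thM] := hth; exists (th u)^-1%g; first by rewrite groupV thS.
  move=> v Pv; have Qv := subsetP sPQ v Pv.
  by rewrite !conjgE !thM ?groupM ?groupV // !(ishomV hth) // groupV.
have m1 := mark_sum_mod p_prime pS w pQ nPQ hth BJ.
have m2 := mark_sum_mod p_prime pS w pQ nPQ (ishom_id sQS) BJ.
have := rpredB m1 m2; rewrite -mulrBl.
have -> : \sum_(c in homs Q S | B (rs P c)) mark Q c th w = \sum_(c in homs Q S | B (rs P c)) mark Q c id w.
  by apply: eq_bigr => c /andP[hc _]; apply: stth; apply: homs_ishom.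
(* With the Q-sums cancelled, the marks on P at (th, th) and (th, id) remain. *)
rewrite opprB addrA addrNK !sum_orbit //; last exact: ishom_id.
have -> : mark P th th w = mark P' d id w.
  rewrite -(w_frob sP'S hdP' hdP') ?unitn_neq0 //.
  by rewrite [in RHS]EP' mark_reparam.
have Eim : th @: P = d @: P' by rewrite imset_comp EP'.
have p0 : p%:R != 0 :> rat by rewrite pnatr_eq0 -lt0n prime_gt0.
set A := mark P' d id w; set A' := mark P th id w.
rewrite (_ : _ / (p * #|S|)%:R = nval P' d / p%:R - A' / #|('C_S(th @: P))%g|%:R / p%:R); last first.
  by rewrite /nval Eim natrM -/A; field; rewrite p0 S0 natr_card_cent_neq0.
move=> hh; apply: (@stab_uncomp _ _ _ _ _ _ d) => //; last by rewrite -EP'.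
apply: frob_stab => //; rewrite -/th -/A'.
apply/negP => /eqP A0; move: Ud; rewrite /unitn.
by rewrite A0 !mul0r subr0 in hh; rewrite hh.
Qed.

(** [stab_normal] along a subnormal chain from P up to Q. *)
Lemma stab_sub P Q g : Q \subset S -> P \subset Q -> ishom Q S g -> {in Q &, injective g} ->
  stab w Q g -> stab w P g.
Proof.
move=> sQS sPQ hg gI stg; move: P sPQ.
apply: (desc_ind (R := fun P => stab w P g) (pgroupS sQS pS)) => // P R sRQ nPR _ stR.
apply: stab_normal nPR _ _ stR; first exact: subset_trans sRQ sQS.
  exact: ishom_sub hg.
by move=> u v Ru Rv; apply: gI; apply: (subsetP sRQ).
Qed.

Lemma stab_inF P f : P \subset S -> ishom P S f -> {in P &, injective f} -> stab w P f -> inF (rst w) P f.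
Proof. by move=> sPS hf fI st; apply/inF_rst; split=> // R sRP; apply: stab_sub st. Qed.

Lemma mark_inF P f : P \subset S -> ishom P S f -> mark P f id w != 0 -> inF (rst w) P f.
Proof.
move=> sPS hf nz; apply: stab_inF => //; first exact: frob_inj.
exact: frob_stab.
Qed.

Lemma inF_stab P f : inF (rst w) P f -> stab w P f.
Proof. by case/inF_rst => _ _ _; apply. Qed.

Lemma frob_right_stable (hT : finGroupType) (H : {group hT}) (x : burnside_loc p S H) :
  right_stable (rst w) x <-> comp_loc x w = x.
Proof.
apply: right_stable_comp => [P f Ff a ha|P f|P sPS]; [exact: inF_stab | exact: mark_inF |].
by have := sum_mark1 sPS; rewrite /E => E1; rewrite -[LHS](divfK S0) E1 mul1r.
Qed.

(** N_f preserves the S-orbit of f, so the congruence between P and N_f applies to it. The P-side is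
    |S| times a unit; hence some map on N_f with nonzero mark extends an S-conjugate of f. *)
Lemma unitn_receptive R : R \subset S -> unitn R id -> receptive (rst w) R.
Proof.
move=> sRS UR P f Ff EfP; have sPS := inF_sub Ff; have hf := inF_ishom Ff.
have [Q EQ] := nphi_group Ff.
have sPQ : P \subset Q by rewrite EQ (sub_nphi Ff).
have sQN : Q \subset 'N_S(P)%g by rewrite EQ; apply/subsetP => x /nphiP[].
have sQS : Q \subset S := subset_trans sQN (subsetIl _ _).
have nPQ : P <| Q by rewrite /normal sPQ (subset_trans sQN) ?subsetIr.
have pQ := pgroupS sQS pS.
pose B := fun a : {ffun gT -> gT} => a \in orbit (cact gT gT) S (rs P f).
have BJ (a : {ffun gT -> gT}) h u : a \in homs P S -> h \in S -> u \in Q -> B a ->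
    B (rs P (fun v => a (v ^ u^-1) ^ h)%g).
  move=> _ Sh Qu; apply: orbit_precomp => //; first by rewrite (subsetP (normal_norm nPQ)).
  move: Qu; rewrite EQ => /nphiP[_ [y /setIP[Sy _] Ey]].
  by exists y^-1%g; rewrite ?groupV.
have := mark_sum_mod p_prime pS w pQ nPQ (ishom_id sQS) BJ.
have [[g hg [nz Bg]]|no] := pselect (exists2 g, g \in homs Q S & mark Q g id w != 0 /\ B (rs P g)).
  move=> _; case/orbitP: Bg => s Ss Eg.
  have Fg := mark_inF sQS (homs_ishom hg) nz.
  exists (fun u => g u ^ s^-1)%g.
    rewrite -EQ; apply: (inF_comp Fg (inF_conj _ (subxx S) (groupVr Ss))).
    exact: ishom_im_sub (homs_ishom hg).
  move=> u Pu; have := congr1 (fun a : {ffun gT -> gT} => a u) Eg.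
  by rewrite cactE !rsE // => <-; rewrite conjgK.
rewrite [X in _ - X](_ : _ = 0) ?subr0; last first.
  rewrite big1 // => c /andP[hc Bc]; apply/eqP/negPn/negP => nz.
  by apply: no; exists c.
rewrite sum_orbit //; last exact: ishom_id.
(* Stability of w along f moves the mark from P to its image. *)
have -> : mark P f id w = mark R id id w.
  rewrite -[LHS](inF_stab Ff hf).
  by rewrite -[LHS](@mark_reparam _ _ _ _ _ _ _ P f id id w) EfP.
rewrite EfP => hh; exfalso; move: UR; rewrite /unitn /nval imset_id.
have p0 : p%:R != 0 :> rat by rewrite pnatr_eq0 -lt0n prime_gt0.
apply/negP; rewrite negbK.
rewrite (_ : _ / p%:R = #|S|%:R / #|('C_S(R))%g|%:R * mark R id id w / (p * #|S|)%:R) //.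
by rewrite natrM; field; rewrite p0 S0 natr_card_cent_neq0.
Qed.

(** The marks at P sum to |S|, so some S-class of images T contributes a sum not divisible by p|S|.
    That sum is |S| times the index of Aut_S(R) in Aut_F(R) times [nval R id], so neither factor is
    divisible by p. *)
Lemma ex_unitn_automized P : P \subset S -> exists (R : {group gT}) f,
  [/\ inF (rst w) P f, f @: P = R, unitn R id & automized (rst w) p R].
Proof.
move=> sPS; have := sum_mark1 sPS; rewrite /E => E1.
pose g (T : {set gT}) := \sum_(b in homs P S | b @: P == T) mark P b id w.
have Eg : \sum_(b in homs P S) mark P b id w = \sum_(T in [set: {set gT}]) g T.
  rewrite (partition_big (fun b : {ffun gT -> gT} => b @: P) (mem [set: {set gT}])) //=.
  by move=> b _; rewrite in_setT.
have idS := ishom_id sPS.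
have gJ T s : s \in S -> g (T :^ s)%g = g T.
  move=> Ss; rewrite /g (reindex_inj (act_inj (cact gT gT) s)) /=.
  apply: eq_big => [b|b /andP[hb _]].
    congr andb; first by rewrite (acts_act (acts_homs S P)).
    have -> : (cact gT gT b s) @: P = ((b @: P) :^ s)%g.
      apply/setP => z; apply/imsetP/imsetP => [[v Pv ->]|[_ /imsetP[v Pv ->] ->]].
        by exists (b v); rewrite ?imset_f // cactE.
      by exists v; rewrite ?cactE.
    by rewrite (inj_eq (act_inj 'Js s)).
  by rewrite mark_cact // -(acts_act (acts_homs S P) Ss).
have [[T nT]|all] := pselect (exists T : {set gT}, #|orbit 'Js S T|%:R * g T / (p * #|S|)%:R \notin zloc_pred p); last first.
  have acts : [acts S, on [set: {set gT}] | 'Js] by apply: acts_onI => [|a x _ _]; rewrite ?subsetT ?inE.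
  exfalso; have := zloc_Vp p_prime; apply/negP; rewrite negbK.
  have := @orbit_sum p _ _ _ 'Js S [set: {set gT}] g (p * #|S|)%:R acts.
  rewrite -Eg natrM invfM mulrA mulrAC E1 mul1r; apply => [T s _ Ss|T _]; first exact: gJ.
  by apply/negPn/negP => h; apply: all; exists T; rewrite natrM invfM.
have gT0 : g T != 0 by apply: contraNneq nT => ->; rewrite mulr0 mul0r rpred0.
have [[b hb [nzb Eb]]|no] := pselect (exists2 b, b \in homs P S & mark P b id w != 0 /\ b @: P = T); last first.
  exfalso; move/eqP: gT0; apply; apply: big1 => b /andP[hb /eqP Eb].
  by apply/eqP/negPn/negP => nz; apply: no; exists b.
have Fb := mark_inF sPS (homs_ishom hb) nzb.
have [R ER] := ishom_imgroup (homs_ishom hb); rewrite Eb in ER.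
have sRS : R \subset S by rewrite ER -Eb ishom_im_sub //; apply: homs_ishom.
have EbR : b @: P = R by rewrite Eb ER.
(* Maps with nonzero mark lie in F; those in F onto R number |Aut_F(R)|, and their marks all equal
   that of the inclusion of R. *)
have gE : g T = #|AutF (rst w) R|%:R * mark R id id w.
  rewrite -(card_inF_onto Fb EbR) /g mulr_natl -sumr_const big_mkcond [RHS]big_mkcond /=.
  apply: eq_bigr => f _; rewrite [in RHS]in_set ER.
  case: (boolP (f \in homs P S)) => //= hf; case: eqP => [Ef|_]; last by rewrite andbF.
  rewrite andbT; case: asboolP => [Ff|nF].
    rewrite -[LHS](inF_stab Ff (homs_ishom hf)) -[LHS](@mark_reparam _ _ _ _ _ _ _ P f id id w).
    by rewrite Ef.
  by apply/eqP/negPn/negP => nz; apply: nF; apply: mark_inF => //; apply: homs_ishom.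
have sylE := automizedE (rst w) p sRS.
pose k := #|AutF (rst w) R : AutS S R|.
have sA : AutS S R \subset AutF (rst w) R := AutS_sub_AutF _ sRS.
have Ek : #|AutF (rst w) R| = (#|AutS S R| * k)%N.
  rewrite /k; have := Lagrange (G := Group (AutF_group_set (rst w) sRS)) (H := (conj_aut R @* 'N_S(R))%G).
  by rewrite /= -AutSE => ->.
have p0 : p%:R != 0 :> rat by rewrite pnatr_eq0 -lt0n prime_gt0.
have Eorb : (#|orbit 'Js S T| * #|'N_S(R)|)%N = #|S|.
  rewrite -(card_orbit_stab 'Js S T); congr (_ * #|pred_of_set _|)%N.
  by rewrite astab1Js ER.
have EN := card_AutS sRS.
have Eval : #|orbit 'Js S T|%:R * g T / (p * #|S|)%:R = k%:R * nval R id / p%:R.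
  have AS0 : #|AutS S R|%:R != 0 :> rat.
    by rewrite AutSE pnatr_eq0 -lt0n cardG_gt0.
  have N0 : #|'N_S(R)|%:R != 0 :> rat by rewrite pnatr_eq0 -lt0n cardG_gt0.
  have C0 : #|'C_S(R)|%:R != 0 :> rat by rewrite pnatr_eq0 -lt0n cardG_gt0.
  have -> : #|orbit 'Js S T|%:R = #|S|%:R / (#|AutS S R|%:R * #|'C_S(R)|%:R) :> rat.
    by rewrite -natrM EN; apply: (canRL (mulfK N0)); rewrite -natrM Eorb.
  rewrite gE Ek /nval imset_id !natrM; field.
  by rewrite p0 S0 AS0 C0.
rewrite Eval in nT.
have nint : nval R id \in zloc_pred p by apply: mark_unit_int => //; apply: ishom_id.
exists R, b; split=> //.
  apply: contraNN nT => h; rewrite -mulrA rpredM //; exact: rpred_nat.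
apply/sylE.
have pk : ~~ (p %| k)%N.
  apply: contraNN nT => /dvdnP[l El]; rewrite El natrM.
  rewrite (_ : _ / _ = l%:R * nval R id); last by field.
  by rewrite rpredM // rpred_nat.
rewrite Ek partnM; last first.
- by rewrite lt0n; apply: contraNneq pk => ->.
- by rewrite AutSE cardG_gt0.
have pAS : p.-nat #|AutS S R|.
  by rewrite AutSE; apply: morphim_pgroup; apply: pgroupS pS; apply: subsetIl.
by rewrite (part_pnat_id pAS) part_p'nat ?muln1 // p'natE.
Qed.

Lemma frob_saturated : saturated (rst w) p.
Proof.
apply: saturated_criterion => // P sPS.
have [R [f [Ff Ef UR autR]]] := ex_unitn_automized sPS; exists R, f; split=> //.
apply: unitn_receptive => //.
by rewrite -Ef; apply: ishom_im_sub (inF_ishom Ff).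
Qed.

End Frobenius.

(** * Characteristic elements of saturated fusion systems *)

Lemma zloc_unitV (p : nat) (e : rat) : prime p -> e \in zloc_pred p -> e / p%:R \notin zloc_pred p ->
  e^-1 \in zloc_pred p.
Proof.
move=> p_prime ez; have pd : coprime p `|denq e| by [].
case: (boolP (p %| `|numq e|)%N) => [/dvdnP[n En]|pn _].
  case/negP; apply: (@zloc_predP p _ (sgz (numq e) * n%:Z) (denq e)) => //.
  have p0 : p%:R != 0 :> rat by rewrite pnatr_eq0 -lt0n prime_gt0.
  have En' : numq e = sgz (numq e) * n%:Z * p%:Z by rewrite -mulrA -PoszM -En -intEsg.
  apply: (mulIf p0); rewrite mulrAC divfK // -numqE.
  by rewrite {1}En' intrM.
apply: (@zloc_predP p _ (denq e) (numq e)).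
- by rewrite prime_coprime.
- by apply: contraNneq pn => ->; rewrite dvdn0.
have e0 : e != 0 by apply: contraNneq pn => ->; rewrite dvdn0.
by rewrite numqE mulKf.
Qed.

Section ScaleLoc.
Variables (p : nat) (gT : finGroupType) (S : {group gT}).

Definition scl (c : Zloc p) (x : burnside_loc p S S) : burnside_loc p S S :=
  comp_loc (tens (burnside_id S) c) x.

Lemma mark_scl (aT : finGroupType) (P : {set aT}) a b c x : mark P a b (scl c x) = val c * mark P a b x.
Proof.
elim/bloc_ind: x => [|x y IHx IHy|T X d].
- by rewrite /scl (morphB_0 (comp_locBr _)) !mark0 mulr0.
- have -> : scl c (x - y) = scl c x - scl c y by exact: comp_locBr.
  by rewrite [LHS]markB IHx IHy -mulrBr -markB.
by rewrite /scl comp_loc_tens burnside_comp1l !mark_bclass /= mulrCA.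
Qed.

End ScaleLoc.

Section Construction.
Variables (p : nat) (gT : finGroupType) (S : {group gT}) (F : fusion_system S).
Hypotheses (p_prime : prime p) (pS : p.-group S).
Implicit Types (P Q R : {group gT}) (x : burnside_loc p S S).
Local Notation I := ({group gT} * {ffun gT -> gT})%type.
Local Notation bas := (bas S S).
Local Notation idx := (idx S S).

Lemma idx_sub (i : I) : i \in idx -> i.1 \subset S.
Proof. by rewrite inE => /andP[]. Qed.

Lemma idx_hom (i : I) : i \in idx -> ishom i.1 S i.2.
Proof. by rewrite inE => /andP[_ /homs_ishom]. Qed.

Lemma mark_conj_pair x (i j : I) s t : i \in idx -> j \in idx -> s \in S -> t \in S ->
  (j.1 :^ t^-1)%g = i.1 -> {in j.1, forall q, j.2 q = i.2 (q ^ t^-1) ^ s^-1}%g ->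
  mark j.1 j.2 id x = mark i.1 i.2 id x.
Proof.
move=> hi hj Ss St Eji E; have [iS _] := idx_hom hi; have sjS := idx_sub hj.
have jS : {in j.1, forall u, id u \in S} by apply/subsetP.
have j1 u : u \in j.1 -> (u ^ t^-1)%g \in i.1 by move=> ju; rewrite -Eji memJ_conjg.
transitivity (mark j.1 (fun u => (i.2 (u ^ t^-1)) ^ s^-1)%g id x); first exact: eq_mark.
rewrite (mark_conjl (a := fun u => i.2 (u ^ t^-1)%g)) ?groupV //; last by move=> u /j1/iS.
rewrite -(mark_conjr _ _ jS (groupVr St)).
by rewrite -[LHS](@mark_reparam _ _ _ _ _ _ _ j.1 (fun u => u ^ t^-1)%g i.2 id x) -Eji.
Qed.

Definition supported x := forall P a, P \subset S -> ishom P S a -> mark P a id x != 0 -> inF F P a.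

Definition lev k : {set I} := [set i in idx | (#|i.1| == k) && `[< inF F i.1 i.2 >]].

(** The mark of [P, f] at itself, equal to |N_f| |C_S(f(P))| / |P| for f in F by [wtE]. *)
Definition wt (i : I) : rat := (kmark i.1 i.2 id (bas i))%:~R.

Lemma levP k i : reflect [/\ i \in idx, #|i.1| = k & inF F i.1 i.2] (i \in lev k).
Proof.
apply: (iffP setIdP) => [[hi /andP[/eqP ki /asboolP Fi]]|[hi ki Fi]] //; split=> //.
by apply/andP; split; [apply/eqP | apply/asboolP].
Qed.

Lemma rs_lev P f : inF F P f -> (P, rs P f) \in lev #|P|.
Proof.
move=> Ff; apply/levP; split=> //=.
  by rewrite inE (inF_sub Ff) /=; apply: rs_homs; apply: inF_ishom Ff.
by apply: eq_inF Ff => u Pu; rewrite rsE.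
Qed.

(** Maps with nonzero mark are conjugates of restrictions of [i.2]. *)
Lemma bas_supported i c : i \in idx -> inF F i.1 i.2 -> supported (tens (bas i) c).
Proof.
move=> hi Fi P a sPS [aS aM]; rewrite mark_tens mulf_eq0 intr_eq0 negb_or => /andP[nz _].
have [s [t [Ss St E]]] := kmark_bas hi aS sPS nz.
have sub : (fun u => u ^ t^-1)%g @: P \subset i.1.
  by apply/subsetP => _ /imsetP[u Pu ->]; case: (E u Pu).
have F1 := inF_comp (inF_conj F sPS (groupVr St)) Fi sub.
have F2 := inF_comp F1 (inF_conj F (subxx S) (groupVr Ss)) (ishom_im_sub (inF_ishom F1)).
by apply: eq_inF F2 => u Pu /=; case: (E u Pu).
Qed.

Lemma bas_conj i j : i \in idx -> j \in idx -> (#|i.1| <= #|j.1|)%N ->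
  kmark j.1 j.2 id (bas i) != 0 -> exists s t, [/\ s \in S, t \in S, (j.1 :^ t^-1)%g = i.1 &
    {in j.1, forall q, j.2 q = i.2 (q ^ t^-1) ^ s^-1}%g].
Proof.
move=> hi hj le nz; have [jS _] := idx_hom hj.
have [s [t [Ss St E]]] := kmark_bas hi jS (idx_sub hj) nz.
exists s, t; split=> //; last by move=> q jq; case: (E q jq).
apply/eqP; rewrite eqEcard cardJg le andbT.
by apply/subsetP => _ /imsetP[q jq ->]; case: (E q jq).
Qed.

(** A multiple of [bas i] corrects the mark at i and at its conjugates, leaves the rest of level k
    alone, and has zero marks at larger subgroups. Induction on the number of wrong marks. *)
Lemma adjust_level k (tau : {set gT} -> rat) x :
  (forall (T : {set gT}) s, s \in S -> tau (T :^ s)%g = tau T) -> supported x ->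
  (forall i, i \in lev k -> (tau (i.2 @: i.1) - mark i.1 i.2 id x) / wt i \in zloc_pred p) ->
  exists x', [/\ supported x',
    forall P a, P \subset S -> ishom P S a -> (k < #|P|)%N -> mark P a id x' = mark P a id x &
    forall i, i \in lev k -> mark i.1 i.2 id x' = tau (i.2 @: i.1)].
Proof.
move=> tauJ; have [n] := ubnP #|[set i in lev k | mark i.1 i.2 id x != tau (i.2 @: i.1)]|.
elim: n x => // n IH x le sx dx.
have [U0|[i]] := set_0Vmem [set i in lev k | mark i.1 i.2 id x != tau (i.2 @: i.1)].
  exists x; split=> // i ki; apply/eqP/negPn/negP => neq.
  by move/setP/(_ i): U0; rewrite in_set0 => /negP; apply; apply/setIdP.
move=> Ui; have /setIdP[Li neqi] := Ui; have /levP[hi ki Fi] := Li.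
have wi : wt i != 0 by rewrite intr_eq0 kmark_bas_self.
pose c : Zloc p := @exist rat (fun z => z \in zloc_pred p) _ (dx i Li); pose y := tens (bas i) c : burnside_loc p S S.
have yE (P : {set gT}) a : mark P a id y = (kmark P a id (bas i))%:~R * ((tau (i.2 @: i.1) - mark i.1 i.2 id x) / wt i).
  exact: mark_tens.
have key j : j \in lev k -> mark j.1 j.2 id (x + y) = tau (j.2 @: j.1) \/
    mark j.1 j.2 id (x + y) = mark j.1 j.2 id x.
  move=> Lj; have /levP[hj kj Fj] := Lj; rewrite markD yE.
  have [->|nz] := eqVneq (kmark j.1 j.2 id (bas i)) 0; first by right; rewrite mul0r addr0.
  left; have le' : (#|i.1| <= #|j.1|)%N by rewrite ki kj.
  have [s [t [Ss St Eji E]]] := bas_conj hi hj le' nz.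
  have mE z := mark_conj_pair z hi hj Ss St Eji E.
  have -> : tau (j.2 @: j.1) = tau (i.2 @: i.1).
    rewrite -(tauJ (i.2 @: i.1) s^-1%g) ?groupV //; congr tau.
    rewrite -Eji; apply/setP => z; apply/imsetP/imsetP => [[q jq ->]|[_ /imsetP[_ /imsetP[q jq ->] ->] ->]].
      by exists (i.2 (q ^ t^-1)%g); rewrite ?E // imset_f // memJ_conjg.
    by exists q; rewrite ?E.
  have -> : (kmark j.1 j.2 id (bas i))%:~R = wt i.
    have := mE (tens (bas i) 1); rewrite !mark_tens /= => /(mulIf _); apply.
    exact: oner_neq0.
  by rewrite mE mulrC divfK // addrC subrK.
have mi : mark i.1 i.2 id (x + y) = tau (i.2 @: i.1).
  by rewrite markD yE -/(wt i) mulrC divfK // addrC subrK.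
have [|||x' [sx' hx' lx']] := IH (x + y).
- apply: (@leq_trans #|[set i in lev k | mark i.1 i.2 id x != tau (i.2 @: i.1)]|); last by rewrite -ltnS.
  apply: proper_card; apply/properP; split.
    apply/subsetP => j /setIdP[Lj nj]; apply/setIdP; split=> //.
    by case: (key j Lj) => [Ej|<-] //; move: nj; rewrite Ej eqxx.
  by exists i => //; apply/negP => /setIdP[_]; rewrite mi eqxx.
- move=> P a sPS ha; rewrite markD => nz.
  have [x0|xn] := eqVneq (mark P a id x) 0; last exact: sx.
  by apply: (bas_supported (c := c) hi Fi) => //; move: nz; rewrite x0 add0r.
- by move=> j Lj; case: (key j Lj) => -> //; rewrite ?subrr ?mul0r ?rpred0 // dx.
exists x'; split=> // P a sPS ha lt; rewrite hx' // markD yE.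
suff -> : kmark P a id (bas i) = 0 by rewrite mul0r addr0.
apply/eqP/negPn/negP => nz; have [aS _] := ha.
have [s [t [Ss St E]]] := kmark_bas hi aS sPS nz.
have : (P :^ t^-1)%g \subset i.1.
  by apply/subsetP => _ /imsetP[q jq ->]; case: (E q jq).
by move/subset_leq_card; rewrite cardJg ki leqNgt lt.
Qed.

(** By [card_subconj] the left side counts the pairs carrying the graph of f to itself; inverting
    the first component turns them into [gnorm]. *)
Lemma wtE P f (N : {group gT}) : inF F P f -> N = nphi S P f :> {set gT} ->
  wt (P, rs P f) * #|P|%:R = (#|N| * #|('C_S(f @: P))%g|)%:R.
Proof.
move=> Ff EN; have sPS := inF_sub Ff; have hf := inF_ishom Ff.
have /levP[hi _ _] := rs_lev Ff.
have := basP hi; rewrite /bspec /= => -[al [sKG [saH [E Eb]]]]; rewrite /wt /= Eb.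
have [fS fM] := hf.
have rS : {in P, forall q, rs P f q \in S} by move=> q Pq; rewrite rsE // fS.
rewrite /hclass kmarkE mulrC -pmulrn -natrM -(card_subconj sKG saH rS sPS).
have nPN : P <| N.
  rewrite /normal EN (sub_nphi Ff) /=; apply/subsetP => x /nphiP[/setIP[_ Nx] _]; exact: Nx.
have ex u : u \in N -> exists2 h, h \in S & {in P, forall v, f (v ^ u^-1) = f v ^ h^-1}%g.
  by rewrite EN => /nphiP[_ [y /setIP[Sy _] Ey]]; exists y.
rewrite -(card_gnorm ex); congr _%:R.
have invI : injective (fun u : gT * gT => (u.1^-1, u.2)%g).
  by move=> [a b] [a' b'] /= [/invg_inj -> ->].
rewrite -(card_imset _ invI); apply: eq_card => -[s t]; apply/imsetP/gnormP => [[[s' t'] /subconjP[Ss St h] [-> ->]]|[Ss Nt h]].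
  have h' v : v \in P -> (f (v ^ t'^-1) = f v ^ s')%g.
    move=> Pv; have [Pvt] := h v Pv; rewrite rsE // E // rsE // => ->.
    by rewrite conjgKV.
  have nP : (t'^-1)%g \in 'N(P)%g.
    by rewrite inE; apply/subsetP => _ /imsetP[v Pv ->]; case: (h v Pv).
  split; [by rewrite groupV | rewrite EN | by move=> v Pv; rewrite invgK h'].
  apply/nphiP; split; first by rewrite inE St -groupV.
  exists (s'^-1)%g; last by move=> u Pu; rewrite invgK h'.
  rewrite inE groupV Ss -groupV invgK inE; apply/subsetP => _ /imsetP[_ /imsetP[v Pv ->] ->].
  by rewrite -h' // imset_f // memJ_norm.
exists (s^-1, t)%g; last by rewrite /= invgK.
have St : t \in S by move: Nt; rewrite EN => /nphiP[/setIP[]].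
apply/subconjP; split; rewrite ?groupV // => q Pq.
have Pqt : (q ^ t^-1)%g \in P.
  by rewrite memJ_norm // groupV; move: Nt; rewrite EN => /nphiP[/setIP[]].
by split=> //; rewrite E //= !rsE // h // invgK conjgKV.
Qed.

Definition stable_above k x :=
  forall P f, inF F P f -> (k < #|P|)%N -> forall a, ishom P S a -> mark P a f x = mark P a id x.

(** With g inverse to f, the mark at (a, f) is that at (a g, id) on f(P). The maps a and a g have
    the same image, and one lies in F exactly when the other does. *)
Lemma stable_level k x tau : supported x ->
  (forall i, i \in lev k -> mark i.1 i.2 id x = tau (i.2 @: i.1)) ->
  forall P f, inF F P f -> #|P| = k -> forall a, ishom P S a -> mark P a f x = mark P a id x.
Proof.
move=> sx lx.
have tE P f : inF F P f -> #|P| = k -> mark P f id x = tau (f @: P).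
  move=> Ff Pk; have := rs_lev Ff; rewrite Pk => /lx /=.
  have fr : {in P, rs P f =1 f} by move=> u Pu; rewrite rsE.
  by rewrite (eq_in_imset fr) => <-; apply: eq_mark => // u Pu; rewrite rsE.
move=> P f Ff Pk a ha; have sPS := inF_sub Ff; have hf := inF_ishom Ff.
have [R ER] := ishom_imgroup hf; have [g [Fg fK gK]] := inF_inv Ff (esym ER).
have sRS := inF_sub Fg.
have Rk : #|R| = k by rewrite ER (inF_card Ff).
have gR : g @: R = P.
  apply/setP => u; apply/imsetP/idP => [[v]|Pu].
    by rewrite ER => /imsetP[w Pw ->] ->; rewrite fK.
  by exists (f u); rewrite ?fK // ER imset_f.
have hg := inF_ishom Fg.
have hag : ishom R S (a \o g).
  apply: ishom_comp ha; split; last by case: hg.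
  by move=> v Rv; rewrite -gR imset_f.
have -> : mark P a f x = mark R (a \o g) id x.
  rewrite ER mark_reparam; apply: eq_mark => // u Pu /=.
  by rewrite fK.
have [Fa|nFa] := pselect (inF F P a).
  have Fag : inF F R (a \o g) by apply: inF_comp Fg Fa _; rewrite gR.
  by rewrite !tE // imset_comp gR.
rewrite [RHS](_ : _ = 0); last by apply/eqP/negPn/negP => nz; apply: nFa; apply: sx.
apply/eqP/negPn/negP => nz; apply: nFa; have Fag := sx _ _ sRS hag nz.
have := inF_comp Ff Fag; rewrite -ER subxx => /(_ isT); apply: eq_inF => u Pu /=.
by rewrite fK.
Qed.

Hypothesis sat : saturated F p.

(** Take R fully normalised in the class of T. *)
Lemma ex_receptive (T : {group gT}) : T \subset S -> exists (R : {group gT}) f,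
  [/\ inF F T f, f @: T = R, receptive F R & automized F p R].
Proof.
move=> sTS.
pose X := [set R : {group gT} | `[< exists f, inF F T f /\ f @: T = R >]].
have XT : T \in X by rewrite inE; apply/asboolP; exists id; split; [apply: inF_id | rewrite imset_id].
case: (@arg_maxnP _ T (mem X) (fun R : {group gT} => #|'N_S(R)|) XT) => R /= XR Rmax.
have /asboolP[f [Ff Ef]] : `[< exists f, inF F T f /\ f @: T = R >] by move: XR; rewrite inE.
have sRS : R \subset S by rewrite -Ef; apply: ishom_im_sub (inF_ishom Ff).
have nR : fully_normalized F R.
  move=> Q /fconjP[g [Fg Eg]]; apply: Rmax; rewrite inE; apply/asboolP.
  by exists (g \o f); split; [apply: inF_comp Ff Fg _; rewrite Ef | rewrite imset_comp Ef].
have [satI satII] := sat; have [cR sylR] := satI R sRS nR.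
exists R, f; split=> // P h Fh Eh.
have [phi [Fphi Ephi]] := (inFE F P h).1 Fh.
have EphiR : (phi @* P)%G = R.
  by apply: group_inj; rewrite /= morphimEdom (eq_in_imset Ephi).
have cphi : fully_centralized F (phi @* P)%G by rewrite EphiR.
have [psi Fpsi Epsi] := satII P phi Fphi cphi; exists psi.
  exists (Nphi_group S phi), psi; split=> //=.
  by rewrite Nphi_nphi; apply: eq_nphi.
by move=> u Pu; rewrite Epsi // Ephi.
Qed.

(* If f extends to tb on N = N_f, then for each u in N outside P the terms of  *)
(* mark_cauchy for b = tb and b = id agree by stability above level k, so only *)
(* the terms at P survive in their difference.                                 *)
Lemma ex_level_target k x (T0 : {group gT}) : stable_above k x -> T0 \subset S ->
  exists t : rat, forall P f s, inF F P f -> #|P| = k -> s \in S -> f @: P = (T0 :^ s)%g ->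
    (t - mark P f id x) / wt (P, rs P f) \in zloc_pred p.
Proof.
move=> stx sT0S; have [R [psi0 [Fpsi0 Epsi0 recR autR]]] := ex_receptive sT0S.
have [psi [Fpsi EpsiR sub]] := receptive_ext Fpsi0 Epsi0 pS autR recR.
have sT0N : T0 \subset 'N_S(T0)%g by rewrite subsetI sT0S normG.
have FpsiT : inF F T0 psi by apply: inF_res Fpsi.
have [rho [Frho psiK rhoK]] := inF_inv FpsiT EpsiR.
exists (mark R rho id x) => P f s Ff Pk Ss Ef.
have sPS := inF_sub Ff; have [N EN] := nphi_group Ff.
have sPN : P \subset N by rewrite EN (sub_nphi Ff).
have sNS : N \subset S by rewrite EN; apply/subsetP => u /nphiP[/setIP[]].
have nPN : P <| N.
  rewrite /normal sPN EN /=; apply/subsetP => u /nphiP[/setIP[_ Nu] _]; exact: Nu.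
have fT0 u : u \in P -> (f u ^ s^-1)%g \in T0.
  by move=> Pu; rewrite -mem_conjg -Ef imset_f.
have FfS := inF_ishom Ff.
have Ffs : inF F P (fun u => f u ^ s^-1)%g.
  apply: (inF_comp Ff (inF_conj F (subxx S) (groupVr Ss))).
  exact: ishom_im_sub FfS.
have imfs : (fun u => f u ^ s^-1)%g @: P = T0.
  apply/setP => v; apply/imsetP/idP => [[u Pu ->]|Tv]; first exact: fT0.
  have : (v ^ s)%g \in f @: P by rewrite Ef memJ_conjg.
  by case/imsetP => u Pu Eu; exists u => //; rewrite -Eu conjgK.
pose th := psi \o (fun u => f u ^ s^-1)%g.
have Fth : inF F P th by apply: (inF_comp Ffs FpsiT); rewrite imfs.
have Eth : th @: P = R by rewrite /th imset_comp imfs.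
have [tb Ftb tbE] := recR P th Fth Eth.
have sN : N \subset nphi S P th.
  rewrite EN; apply/subsetP => u /nphiP[Nu [y /setIP[Sy Ny] Ey]]; apply/nphiP; split=> //.
  have Nys : (y ^ s^-1)%g \in 'N_S(T0)%g.
    rewrite inE groupJ ?groupV //= -(conjsgK s T0) -Ef normJ memJ_conjg.
    exact: Ny.
  exists (psi (y ^ s^-1)%g).
    by rewrite Eth (subsetP sub) // imset_f.
  move=> v Pv; rewrite /th /= Ey // -(ishomV (inF_ishom Fpsi)) //.
  have NT := subsetP sT0N _ (fT0 v Pv).
  rewrite -(inF_imJ Fpsi) ?groupV //; congr psi.
  by rewrite -!conjgM -conjVg; congr (_ ^ _)%g; rewrite conjgE invgK !mulgA mulVg mul1g.
have [N2 EN2] := nphi_group Fth; rewrite -EN2 in Ftb sN.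
have FtbN : inF F N tb by apply: inF_res Ftb.
have c1 := mark_cauchy x f nPN (inF_ishom FtbN).
have c2 := mark_cauchy x f nPN (ishom_id sNS).
have := rpredB c1 c2; rewrite -mulrBl -sumrB.
have ex u : u \in N -> exists2 h, h \in S & {in P, forall v, f (v ^ u^-1) = f v ^ h^-1}%g.
  by rewrite EN => /nphiP[_ [y /setIP[Sy _] Ey]]; exists y.
rewrite (card_gnorm ex) -(wtE Ff EN).
have mth : mark P f th x = mark R rho id x.
  have -> : mark P f th x = mark P (fun u => f u ^ s^-1)%g th x.
    have [fS _] := FfS; have [thS _] := inF_ishom Fth.
    by rewrite (mark_conjl x fS thS (groupVr Ss)).
  rewrite -Eth mark_reparam; apply: eq_mark => // u Pu.
  by rewrite /th /= psiK // fT0.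
have P0 : #|P|%:R != 0 :> rat by rewrite pnatr_eq0 -lt0n cardG_gt0.
have w0 : wt (P, rs P f) != 0.
  by rewrite intr_eq0; apply: kmark_bas_self; have /levP[] := rs_lev Ff.
rewrite (_ : \sum_(i in N) _ = #|P|%:R * (mark R rho id x - mark P f id x)).
  set A := mark R rho id x - mark P f id x; set W := wt _ in w0 *.
  by have -> : #|P|%:R * A / (W * #|P|%:R) = A / W by field; rewrite w0 P0.
rewrite mulr_natl -sumr_const (big_setID P) /= (setIidPr sPN) [X in _ + X]big1 ?addr0.
  apply: eq_bigr => u Pu.
  have EP : <<u |: P>> = P by rewrite (setUidPr _) ?sub1set // genGid.
  have one b : \sum_(c in homs <<u |: P>> S | [forall v in P, c v == f v]) mark <<u |: P>> c b x = mark P f b x.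
    rewrite EP (big_pred1 (rs P f)).
      by apply: eq_mark => // v Pv; rewrite rsE.
    move=> c /=; apply/andP/eqP => [[hc /forall_inP E]|->].
      apply: (homs_eq hc (rs_homs FfS)) => v Pv; rewrite rsE //; exact/eqP/E.
    by split; [apply: rs_homs | apply/forall_inP => v Pv; rewrite rsE].
  rewrite !one -mth; congr (_ - _); apply: eq_mark => // v Pv; exact: tbE.
move=> u /setDP[Nu nPu]; apply/eqP; rewrite subr_eq0; apply/eqP.
apply: eq_bigr => c /andP[hc _].
have sQN : <<u |: P>> \subset N by rewrite gen_subG subUset sub1set Nu.
apply: (stx <<u |: P>>%G); [exact: inF_res FtbN | | exact: homs_ishom].
rewrite -Pk; apply: proper_card; apply/properP; split; first by rewrite sub_gen // subsetUr.
by exists u => //; rewrite mem_gen // setU11.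
Qed.

End Construction.

Lemma zloc_nat_divp (p m : nat) : prime p -> m%:R / p%:R \in zloc_pred p -> (p %| m)%N.
Proof.
move=> p_prime; set e := m%:R / p%:R => ez; have pd : coprime p `|denq e| by [].
have p0 : p%:R != 0 :> rat by rewrite pnatr_eq0 -lt0n prime_gt0.
have E : numq e * p%:Z = m%:Z * denq e.
  apply/eqP; rewrite -(eqr_int rat) !intrM numqE /e; apply/eqP.
  rewrite -[p%:Z%:~R]/(p%:R) -[m%:Z%:~R]/(m%:R).
  by rewrite mulrAC divfK.
rewrite -(Gauss_dvdl _ pd); apply/dvdnP; exists `|numq e|%N.
by rewrite -[m]/`|m%:Z|%N -[p]/`|p%:Z|%N -!abszM E.
Qed.

Section Build.
Variables (p : nat) (gT : finGroupType) (S : {group gT}) (F : fusion_system S).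
Hypotheses (p_prime : prime p) (pS : p.-group S) (sat : saturated F p).
Implicit Types (P Q R : {group gT}) (x : burnside_loc p S S).
Local Notation I := ({group gT} * {ffun gT -> gT})%type.

(** [ex_level_target] gives one value for each S-class of images, and [tau] reads it off the orbit
    of T. *)
Lemma ex_target k x : stable_above F k x -> exists2 tau : {set gT} -> rat,
  forall (T : {set gT}) s, s \in S -> tau (T :^ s)%g = tau T &
  forall i, i \in lev F k -> (tau (i.2 @: i.1) - mark i.1 i.2 id x) / wt S i \in zloc_pred p.
Proof.
move=> stx.
have ex (C : {set {set gT}}) : exists t, forall P f, inF F P f -> #|P| = k -> C = orbit 'Js S (f @: P) ->
    (t - mark P f id x) / wt S (P, rs P f) \in zloc_pred p.
  have [[P0 [f0 [F0 _ EC]]]|no] := pselect (exists P f, [/\ inF F P f, #|P| = k & C = orbit 'Js S (f @: P)]).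
    have [T0 ET0] := ishom_imgroup (inF_ishom F0).
    have sT0 : T0 \subset S by rewrite ET0; apply: ishom_im_sub (inF_ishom F0).
    have [t ht] := ex_level_target pS sat stx sT0; exists t => P f Ff Pk E.
    have : f @: P \in orbit 'Js S (f0 @: P0) by rewrite -EC E orbit_refl.
    by case/orbitP => s Ss Es; apply: (ht P f s) => //; rewrite -Es ET0.
  by exists 0 => P f Ff Pk E; exfalso; apply: no; exists P, f.
have [t ht] := choice ex.
exists (fun T => t (orbit 'Js S T)) => [T s Ss|[P f] /levP[hi Pk Fi] /=].
  by congr t; apply/orbit_eqP; apply: (mem_orbit 'Js).
rewrite /= in hi Pk Fi; have := ht _ P f Fi Pk erefl.
by move: hi; rewrite inE => /andP[_ hf]; rewrite (rs_id hf).
Qed.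

(** The target |C_S(S)| is exactly the weight of each (S, f), so starting from 0 the required
    coefficient is 1. *)
Lemma ex_stable_top : exists x, [/\ supported F x, stable_above F (#|S| - 1) x &
  forall f, inF F S f -> mark S f id x = #|('C_S(S))%g|%:R].
Proof.
pose tau := fun _ : {set gT} => #|('C_S(S))%g|%:R : rat.
have s0 : supported F (0 : burnside_loc p S S) by move=> P a _ _; rewrite mark0 eqxx.
have C0 : #|('C_S(S))%g|%:R != 0 :> rat by rewrite pnatr_eq0 -lt0n cardG_gt0.
have S0 : #|S|%:R != 0 :> rat by rewrite pnatr_eq0 -lt0n cardG_gt0.
have PS P : P \subset S -> #|P| = #|S| -> P = S.
  by move=> sPS E; apply/group_inj/eqP; rewrite eqEcard sPS E leqnn.
have fS f : inF F S f -> f @: S = S.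
  move=> Ff; apply/eqP; rewrite eqEcard (inF_card Ff) leqnn andbT.
  exact: ishom_im_sub (inF_ishom Ff).
have [] := @adjust_level p gT S F #|S| tau 0.
- by [].
- exact: s0.
- move=> [P f] /levP[hi /= Pk Fi]; rewrite /= in Fi.
  have EPS := PS P (inF_sub Fi) Pk; subst P.
  have hf : f \in homs S S by move: hi; rewrite inE => /andP[].
  have EN : S = nphi S S f :> {set gT}.
    apply/eqP; rewrite eqEsubset (sub_nphi Fi) /=; apply/subsetP => u /nphiP[/setIP[Su _] _].
    exact: Su.
  have := wtE Fi EN; rewrite (rs_id hf) fS // natrM mulrC => /(mulfI S0) ->.
  by rewrite mark0 subr0 divff // rpred1.
move=> x [sx _ lx]; exists x; split=> // [P f Ff lt a ha|f Ff].
  have Pk : #|P| = #|S|.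
    by move: lt (subset_leq_card (inF_sub Ff)) (cardG_gt0 S) => /=; lia.
  exact: (stable_level sx lx Ff).
rewrite -[RHS](lx (S, rs S f)) /=; last by rewrite rs_lev.
by apply: eq_mark => // u Su; rewrite rsE.
Qed.

Lemma ex_stable_above n : exists x, [/\ supported F x, stable_above F (#|S| - n.+1) x &
  forall f, inF F S f -> mark S f id x = #|('C_S(S))%g|%:R].
Proof.
elim: n => [|n [x [sx stx tx]]]; first exact: ex_stable_top.
(* Subtraction is truncated: once the threshold is 0 it stays there. *)
have [n0|kpos] := posnP (#|S| - n.+1)%N.
  by exists x; split=> //; move: stx; rewrite n0 (_ : #|S| - n.+2 = 0)%N //; move: n0; lia.
set k := (#|S| - n.+1)%N in stx kpos.
have [tau tauJ dtau] := ex_target stx.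
have [x' [sx' hx' lx']] := adjust_level tauJ sx dtau.
exists x'; split=> // [P f Ff lt a ha|f Ff].
  have [Pk|neq] := eqVneq #|P| k; first exact: (stable_level sx' lx' Ff Pk).
  have ltk : (k < #|P|)%N by move: lt neq; rewrite /k; lia.
  (* Above level k a mark at (a, f) is a mark at (a', id) on f(P), which the adjustment has not
     changed. *)
  have sPS := inF_sub Ff; have [a' ha' E] := ishom_factor (inF_ishom Ff) (inF_inj Ff) ha.
  have [R ER] := ishom_imgroup (inF_ishom Ff).
  have sRS : R \subset S by rewrite ER; apply: ishom_im_sub (inF_ishom Ff).
  have ltR : (k < #|R|)%N by rewrite ER (inF_card Ff).
  rewrite -ER in ha'.
  have rep z : mark P a f z = mark R a' id z.
    by rewrite ER mark_reparam; apply: eq_mark => // u Pu; rewrite E.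
  by rewrite rep hx' // -rep stx // hx'.
rewrite hx' ?tx //; first exact: inF_ishom Ff.
by rewrite /k; have := cardG_gt0 S; lia.
Qed.

Lemma ex_stable : exists x, [/\ supported F x,
    forall P f, inF F P f -> forall a, ishom P S a -> mark P a f x = mark P a id x &
    forall f, inF F S f -> mark S f id x = #|('C_S(S))%g|%:R].
Proof.
have [x [sx stx tx]] := ex_stable_above #|S|; exists x; split=> // P f Ff a ha.
by apply: (stx P f) => //; rewrite (_ : #|S| - #|S|.+1 = 0)%N ?cardG_gt0 //; lia.
Qed.

(** * Normalising a stable element *)

Section Normalize.
Variable om : burnside_loc p S S.
Hypotheses (om_supp : supported F om)
  (om_stab : forall P f, inF F P f -> forall a, ishom P S a -> mark P a f om = mark P a id om)
  (om_top : forall f, inF F S f -> mark S f id om = #|('C_S(S))%g|%:R).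

Let E P := (\sum_(a in homs P S) mark P a id om) / #|S|%:R.
Let S0 : #|S|%:R != 0 :> rat. Proof. by rewrite pnatr_eq0 -lt0n cardG_gt0. Qed.

Lemma E_int P : P \subset S -> E P \in zloc_pred p.
Proof.
move=> sPS; have := mark_sum_dvd (B := xpredT) p_prime pS om (pgroupS sPS pS) (ishom_id sPS).
under eq_bigl do rewrite andbT.
exact.
Qed.

(** The marks at S sum to |Aut_F(S)| |Z(S)|, and Aut_S(S), of order |S| / |Z(S)|, is Sylow in
    Aut_F(S). So E S is the p'-part of |Aut_F(S)|. *)
Lemma E_top : E S / p%:R \notin zloc_pred p.
Proof.
have fS f : inF F S f -> f @: S = S.
  move=> Ff; apply/eqP; rewrite eqEcard (inF_card Ff) leqnn andbT.
  exact: ishom_im_sub (inF_ishom Ff).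
have nS : fully_normalized F S.
  move=> Q _; have -> : 'N_S(S)%g = S by apply/setIidPl; apply: normG.
  by rewrite subset_leq_card // subsetIl.
have [_ sylS] := sat.1 S (subxx S) nS.
have EA := (automizedE F p (subxx S)).1 sylS.
have EC := card_AutS (subxx S); have NS : 'N_S(S)%g = S by apply/setIidPl; apply: normG.
rewrite NS in EC.
have Es : \sum_(a in homs S S) mark S a id om = #|AutF F S|%:R * #|('C_S(S))%g|%:R.
  rewrite -(card_inF_onto (inF_id F (subxx S)) (imset_id S)) mulr_natl -sumr_const.
  rewrite big_mkcond [RHS]big_mkcond /=; apply: eq_bigr => f _; rewrite [in RHS]in_set.
  case: (boolP (f \in homs S S)) => //= hf; case: asboolP => [Ff|nF] /=.
    by rewrite fS // eqxx om_top.
  by apply/eqP/negPn/negP => nz; apply: nF; apply: om_supp => //; apply: homs_ishom.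
have A0 : (0 < #|AutF F S|)%N := cardG_gt0 (Group (AutF_group_set F (subxx S))).
have -> : E S = (#|AutF F S|`_p^')%N%:R.
  rewrite /E Es; apply: (canLR (mulfK S0)).
  rewrite -EC natrM EA mulrA; congr (_ * _).
  by rewrite -natrM mulnC partnC.
apply/negP => /(zloc_nat_divp p_prime) dv.
have := part_pnat p^' #|AutF F S|; move/pnat_dvd => /(_ _ dv).
by rewrite pnatE // !inE eqxx.
Qed.

(** E P and E Q agree modulo p when P is normal in Q. *)
Lemma E_unit P : P \subset S -> E P / p%:R \notin zloc_pred p.
Proof.
apply: (desc_ind (R := fun P => E P / p%:R \notin zloc_pred p) pS); first exact: E_top.
move=> {}P Q sQS nPQ _; apply: contraNN => EP.
have := mark_sum_mod (B := xpredT) p_prime pS om (pgroupS sQS pS) nPQ (ishom_id sQS).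
move/(_ (fun _ _ _ _ _ _ _ => isT)).
under eq_bigl do rewrite andbT.
under [X in (_ - X) / _ \in _]eq_bigl do rewrite andbT.
have p0 : p%:R != 0 :> rat by rewrite pnatr_eq0 -lt0n prime_gt0.
rewrite (_ : _ / _ = E P / p%:R - E Q / p%:R); last first.
  by rewrite /E natrM; field; rewrite S0 p0.
by move=> h; rewrite -(subKr (E P / p%:R) (E Q / p%:R)) rpredB.
Qed.

Lemma mark_comp_om P f a x q : inF F P f -> ishom P S a ->
  (forall P f, inF F P f -> forall a, ishom P S a -> mark P a f x = mark P a id x) ->
  (forall P a, P \subset S -> ishom P S a -> mark P a id x = mark P a id om * q P) ->
  mark P a f (comp_loc x om) = mark P a id om * q P * E P.
Proof.
move=> Ff ha stx qx; have [aS _] := ha; have sPS := inF_sub Ff.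
apply: (mulfI S0); rewrite (mark_comp x om aS (inF_ishom Ff)).
transitivity (\sum_(b in homs P S) mark P a id om * q P * mark P b id om).
  apply: eq_bigr => b hb; rewrite om_stab //; last exact: homs_ishom.
  have [->|nz] := eqVneq (mark P b id om) 0; first by rewrite !mulr0.
  by rewrite stx ?qx //; apply: om_supp => //; apply: homs_ishom.
by rewrite -mulr_sumr /E; field; apply: S0.
Qed.

(* With E P = (sum of the marks of om at P) / |S|, the passage from x to       *)
(* x + (om - x o om) / E Q multiplies 1 - E P * q P by 1 - E P / E Q, which    *)
(* vanishes at P = Q.                                                          *)
Lemma ex_normalized (r : seq {group gT}) : all (fun Q : {group gT} => Q \subset S) r ->
  exists x q, [/\ forall P f, inF F P f -> forall a, ishom P S a -> mark P a f x = mark P a id x,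
    forall P a, P \subset S -> ishom P S a -> mark P a id x = mark P a id om * q P &
    forall P, 1 - E P * q P = \prod_(Q <- r) (1 - E P / E Q)].
Proof.
elim: r => [_|Q r IH /= /andP[sQS /IH[x [q [stx qx qE]]]]].
  exists 0, (fun _ => 0); split=> [P f Ff a ha|P a sPS ha|P].
  - by rewrite !mark0.
  - by rewrite mark0 mulr0.
  - by rewrite mulr0 subr0 big_nil.
have cz := zloc_unitV p_prime (E_int sQS) (E_unit sQS).
pose c : Zloc p := @exist rat (fun z => z \in zloc_pred p) _ cz.
exists (x + scl c (om - comp_loc x om)), (fun P => q P + (E Q)^-1 * (1 - q P * E P)).
have mE P f a : inF F P f -> ishom P S a ->
    mark P a f (x + scl c (om - comp_loc x om)) = mark P a id om * (q P + (E Q)^-1 * (1 - q P * E P)).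
  move=> Ff ha; have sPS := inF_sub Ff.
  rewrite [LHS]markD mark_scl [X in _ * X]markB (mark_comp_om Ff ha stx qx).
  rewrite stx // qx // om_stab // (_ : val c = (E Q)^-1) //.
  by move: (E Q)^-1 (mark P a id om) (q P) (E P) => e1 e2 e3 e4; ring.
split=> [P f Ff a ha|P a sPS ha|P].
- by rewrite (mE P f) // (mE P id) //; apply: inF_id (inF_sub Ff).
- by rewrite (mE P id) //; apply: inF_id.
- rewrite big_cons -qE.
  by move: (E Q)^-1 (q P) (E P) => e1 e3 e4; ring.
Qed.

End Normalize.

Lemma ex_characteristic : exists w : burnside_loc p S S,
  [/\ forall P f, inF F P f -> forall a, ishom P S a -> mark P a f w = mark P a id w,
      forall P f, P \subset S -> ishom P S f -> mark P f id w != 0 -> inF F P f &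
      forall P, P \subset S -> \sum_(a in homs P S) mark P a id w = #|S|%:R].
Proof.
have [om [sx stx tx]] := ex_stable.
(* Running over all subgroups of S puts a vanishing factor 1 - E P / E P in each product, so E P * q
   P = 1. *)
pose r : seq {group gT} := [seq Q : {group gT} <- enum {group gT} | gval Q \subset S].
have rS : all (fun Q : {group gT} => Q \subset S) r by apply/allP => Q; rewrite mem_filter => /andP[].
have [w [q [stw qw qE]]] := ex_normalized sx stx tx rS.
have S0 : #|S|%:R != 0 :> rat by rewrite pnatr_eq0 -lt0n cardG_gt0.
exists w; split=> // [P f sPS hf|P sPS].
  by rewrite qw // => nz; apply: sx => //; apply: contraNneq nz => ->; rewrite mul0r.
have Pr : P \in r by rewrite mem_filter sPS mem_enum.
have Eu := E_unit sx tx sPS.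
have E0 : (\sum_(a in homs P S) mark P a id om) / #|S|%:R != 0.
  by apply: contraNneq Eu => ->; rewrite mul0r rpred0.
have := qE P; rewrite (big_rem P Pr) /= divff // subrr mul0r => /eqP.
rewrite subr_eq0 => /eqP E1.
transitivity ((\sum_(a in homs P S) mark P a id om) * q P).
  by rewrite mulr_suml; apply: eq_bigr => a ha; rewrite qw //; apply: homs_ishom.
transitivity (#|S|%:R * ((\sum_(a in homs P S) mark P a id om) / #|S|%:R * q P)); first by field.
by rewrite -E1 mulr1.
Qed.

End Build.

(** * Retractive transfers *)

Section KappaMarks.
Variables (p : nat) (gT : finGroupType) (S : {group gT}).
Implicit Types (P : {group gT}) (x y w : burnside_loc p S S).

Lemma mark_kappaA P a (c : gT -> gT) x y : {in P, forall u, c u \in S} ->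
  mark P a c (kappaA x y) = mark P (fst \o a) c x * mark P (snd \o a) c y.
Proof. by move=> cS; rewrite /kappaA mark_hom // mark_prod. Qed.

Lemma mark_one_conj P b c : mark P b c (bloc p (burnside_id S)) != 0 ->
  exists2 s, s \in S & {in P, forall u, c u \in S /\ b u = (c u ^ s)%g}.
Proof.
rewrite mark_bclass mulf_eq0 negb_or pnatr_eq0 => /andP[+ _].
rewrite -lt0n card_gt0 => /set0Pn[z]; have [[s t] /eqP <-] := hpair_surj z => /bfixP fz.
exists (val (s * t)^-1)%g; first exact: subgP.
move=> u Pu; have [Sb Sc] := fz u Pu.
rewrite lact_hpair // ract_hpair // => /hpairP[k Sk /= [E1 E2]].
split=> //; have /(congr1 val) := E1; have /(congr1 val) := E2.
rewrite /= !subgK // => E2' E1'.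
by rewrite conjgE invgK invMg -!mulgA (mulgA _ (c u)) E2' (mulgA (k * _)%g) mulgK mulgA -E1' mulgK.
Qed.

(** Take marks at ((a, b), id). On the left only conjugates [c] of [b] contribute, as the mark of 1
    at (b, c) vanishes otherwise, and they give the mark at (a, b) times that at (b, id). The right
    side is the product of the marks at (a, id) and (b, id). *)
Lemma frobenius_marks w : comp_loc (kappaA w (bloc p (burnside_id S))) w = kappaA w w ->
  forall P a b, P \subset S -> ishom P S a -> ishom P S b ->
    mark P b id w != 0 -> mark P a b w = mark P a id w.
Proof.
move=> Fro P a b sPS [aS _] [bS _] nz; apply: (mulIf nz).
have S0 : #|S|%:R != 0 :> rat by rewrite pnatr_eq0 -lt0n cardG_gt0.
pose ab u := (a u, b u).
have idS : {in P, forall u, id u \in S} by apply/subsetP.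
have <- : mark P ab id (kappaA w w) = mark P a id w * mark P b id w by rewrite mark_kappaA.
rewrite -Fro; apply: (mulfI S0).
rewrite mark_comp ?ishom_id //; last by move=> u Pu; apply/setXP; rewrite aS ?bS.
rewrite mulrCA -{2}[w]comp_loc1l mark_comp ?ishom_id // mulr_sumr.
apply: eq_bigr => c hc; have [cS _] := homs_ishom hc.
rewrite mark_kappaA // mulrA; congr (_ * _).
have [E0|nz1] := eqVneq (mark P b c (bloc p (burnside_id S))) 0.
  by rewrite -[snd \o ab]/b E0 !mulr0.
congr (_ * _); have [s Ss E] := mark_one_conj nz1.
by rewrite -(mark_conjr a w cS Ss); apply: eq_mark => // u /E[].
Qed.

(** By [mark_nishida] x has a nonzero mark at some injective [a]. Expanding x = x o w yields b with
    nonzero marks of x at (a, b) and of w at (b, id), and b is injective because [a] is. *)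
Lemma exists_mark_neq0 w x : ~ nishida_loc x -> comp_loc x w = x ->
  exists a : gT -> gT, [/\ ishom S S a, {in S &, injective a} & mark S a id w != 0].
Proof.
move=> nJ Ex; apply: contrapT => no; apply: nJ; apply: mark_nishida => a ha aI.
have S0 : #|S|%:R != 0 :> rat by rewrite pnatr_eq0 -lt0n cardG_gt0.
have [aS _] := homs_ishom ha.
rewrite -Ex; apply: (mulfI S0); rewrite (mark_comp _ _ aS (ishom_id (subxx S))) mulr0.
apply: big1 => b hb; apply/eqP; rewrite mulf_eq0.
case: eqVneq => //= nzab; apply/negPn/negP => nzb; apply: no.
exists b; split=> //; first exact: homs_ishom.
apply: (ishom_inj (homs_ishom hb)) => u Su bu; apply: aI; rewrite // (ishom1 (homs_ishom ha)).
exact: mark_ker nzab u Su bu.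
Qed.

End KappaMarks.

Section Transfer.
Variables (p : nat) (gT hT : finGroupType) (S : {group gT}) (H : {group hT}).
Variables (w : burnside_loc p S S).
Variable W : submodClosed (burnside_loc p S H : lmodType (burnside_ring p H)).
Hypothesis compW : forall x : burnside_loc p S H, comp_loc x w \in W.

Definition transfer (x : burnside_loc p S H) : submod_of W := SubmodOf (compW x).

Lemma transfer_linear : linear transfer.
Proof.
move=> a x y; apply: val_inj; rewrite linearP /=.
rewrite (morphB_D (comp_locBl w)); congr (_ + _).
exact/esym/comp_locA.
Qed.

HB.instance Definition _ := GRing.isLinear.Build _ _ _ _ transfer transfer_linear.

End Transfer.

(** This is k4 for the transfer x -> x o w: where w has a nonzero mark at (c, id), c lies in F, and
    r has the same mark at (a, c) as at (a, id). *)
Lemma kappaA_comp (p : nat) (gT : finGroupType) (S : {group gT}) (F : fusion_system S)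
    (w r x : burnside_loc p S S) :
  (forall (P : {group gT}) f, P \subset S -> ishom P S f -> mark P f id w != 0 -> inF F P f) ->
  right_stable F r -> comp_loc (kappaA r x) w = kappaA r (comp_loc x w).
Proof.
move=> w_supp /right_stableP r_st; apply: mark_inj => P ab sPS /homs_ishom hab.
have S0 : #|S|%:R != 0 :> rat by rewrite pnatr_eq0 -lt0n cardG_gt0.
have [abS abM] := hab; have idS : {in P, forall u, id u \in S} by apply/subsetP.
have haS : ishom P S (fst \o ab).
  split=> [u Pu|u v Pu Pv] /=; last by rewrite abM.
  by have := abS u Pu; case: (ab u) => s t /setXP[].
have hbS : ishom P S (snd \o ab).
  split=> [u Pu|u v Pu Pv] /=; last by rewrite abM.
  by have := abS u Pu; case: (ab u) => s t /setXP[].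
rewrite mark_kappaA //; apply: (mulfI S0).
rewrite (mark_comp _ _ abS (ishom_id sPS)) mulrCA (mark_comp _ _ (proj1 hbS) (ishom_id sPS)).
rewrite mulr_sumr; apply: eq_bigr => c /homs_ishom hc; have [cS _] := hc; rewrite mark_kappaA //.
rewrite mulrA; have [->|nz] := eqVneq (mark P c id w) 0; first by rewrite !mulr0.
by rewrite (r_st P c (w_supp P c sPS hc nz) _ haS).
Qed.

Theorem theorem5 (p : nat) (gT : finGroupType) (S : {group gT})
    (p_prime : prime p) (pS : p.-group S) (K : kappa_submodule p S) :
  (exists F : fusion_system S,
     [/\ saturated F p,
         forall x : burnside_loc p S S, x \in ksub K <-> right_stable F x &
         forall x : burnside_loc p S (setX S S),
           x \in ksub' K <-> right_stable F x])
  <->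
  (~ (forall x : burnside_loc p S S, x \in ksub K -> nishida_loc x)
   /\ has_retractive_transfer K).
Proof.
split=> [[F [sat KF KF']]|[nJ [t [t' [tK t'K tcomp tkap]]]]].
  have [w [w_stab w_supp w_sum]] := ex_characteristic p_prime pS sat.
  have inK x : x \in ksub K <-> comp_loc x w = x.
    by rewrite KF; apply: right_stable_comp.
  have inK' x : x \in ksub' K <-> comp_loc x w = x.
    by rewrite KF'; apply: right_stable_comp.
  have Fw : right_stable F w by apply/right_stableP.
  have ww : comp_loc w w = w by apply/inK/KF.
  have tW x : comp_loc x w \in ksub K by apply/inK; rewrite -comp_locA ww.
  have tW' x : comp_loc x w \in ksub' K by apply/inK'; rewrite -comp_locA ww.
  split=> [J|].
    (* Membership in the Nishida ideal would kill all marks of w at S, although they sum to |S|. *)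
    have Jw : nishida_loc w by apply/J/KF.
    have S0 : #|S|%:R != 0 :> rat by rewrite pnatr_eq0 -lt0n cardG_gt0.
    move/eqP: S0; apply; rewrite -(w_sum S) //; apply: big1 => a ha.
    apply/eqP/negPn/negP => nz; move/eqP: (nz); apply; apply: nishida_mark => //.
    exact: inF_inj (w_supp S a (subxx S) (homs_ishom ha) nz).
  exists (transfer tW), (transfer tW'); split=> [r|r'|h x|r x]; first 1 last.
  - by apply: val_inj; apply/inK'; apply: valP.
  - by rewrite /= comp_locA.
  - apply: val_inj; rewrite kappa2 /=; apply: kappaA_comp w_supp _.
    by apply/KF; apply: valP.
  by apply: val_inj; apply/inK; apply: valP.
pose e := bloc p (burnside_id S); pose w : burnside_loc p S S := val (t e).
(* Linearity over the Burnside ring, applied to x = x o 1. *)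
have tE x : val (t x) = comp_loc x w.
  have {1}-> : x = (x : burnside_ring p S) *: e by rewrite -[LHS]comp_loc1r.
  by rewrite linearZ linearZ.
(* This is k3 at x = 1. *)
have t'E h : val (t' h) = comp_loc h w by rewrite -{1}[h]comp_loc1r tcomp.
have inK x : x \in ksub K <-> comp_loc x w = x.
  split=> [Kx|<-]; last by rewrite -tE; apply: valP.
  by rewrite -tE; have := congr1 val (tK (SubmodOf Kx)).
have inK' x : x \in ksub' K <-> comp_loc x w = x.
  split=> [Kx|<-]; last by rewrite -t'E; apply: valP.
  by rewrite -t'E; have := congr1 val (t'K (SubmodOf Kx)).
have ww : comp_loc w w = w by apply/inK; apply: valP.
have w_frob := @frobenius_marks p gT S w.
(* This is k4 at r = w, x = 1. *)
have Fro : comp_loc (kappaA w e) w = kappaA w w by rewrite -t'E tkap kappa2.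
have {Fro}w_frob := w_frob Fro.
have [x [Kx nJx]] : exists x, x \in ksub K /\ ~ nishida_loc x.
  apply: contrapT => no; apply: nJ => x Kx; apply: contrapT => nJx.
  by apply: no; exists x.
have [al [al_hom al_inj al_mark]] := exists_mark_neq0 nJx ((inK x).1 Kx).
exists (rst w); split=> [|y|y].
- exact: frob_saturated al_mark.
- by rewrite inK; apply: iff_sym; apply: frob_right_stable al_mark _ _ _.
- by rewrite inK'; apply: iff_sym; apply: frob_right_stable al_mark _ _ _.
Qed.
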